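(* For an ensemble of $K$ decision trees with at most $n$ leaves per tree and $d$-dimensional features, the robustness verification decision problem (given the ensemble, an input $x\in\mathbb{R}^d$ with original label $y_0=-1$, and $\epsilon\ge 0$, decide whether there exists $x'\in\mathrm{Ball}(x,\epsilon)$ at which the ensemble predicts a label different from $y_0$) can be solved exactly in time $$\min\{O(n^K),\ O((2Kn)^d)\}.$$
   Context: A decision tree on $\mathbb{R}^d$ is a finite rooted binary tree in which each internal node $i$ has a left child, a right child and a feature-threshold pair $(t_i,\eta_i)\in\{1,\dots,d\}\times\mathbb{R}$. An input $x\in\mathbb{R}^d$ starts at the root and at internal node $i$ goes to the left child if $x_{t_i}\le\eta_i$ and to the right child otherwise, until it reaches a leaf. Each leaf $i$ carries a real prediction value $v_i$. A tree ensemble consists of $K$ decision trees; $S^{(k)}$ is the set of leaves of tree $k$, and $m^{(k)}(x)\in S^{(k)}$ is the leaf of tree $k$ reached by $x$. The ensemble is a binary classifier predicting $\mathrm{sign}\big(\sum_{k=1}^K v_{m^{(k)}(x)}\big)$. The given input $x$ is assumed to be predicted $y_0=-1$, i.e. $\sum_k v_{m^{(k)}(x)}<0$. $\mathrm{Ball}(x,\epsilon)=\{x'\in\mathbb{R}^d:\|x'-x\|_\infty\le\epsilon\}$. The decision problem asks whether there is $x'\in\mathrm{Ball}(x,\epsilon)$ with $\sum_{k=1}^K v_{m^{(k)}(x')}>0$.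
   Formalization: The O-constant is absolute only for n ≥ 2 and d ≥ 2; for n = 1 or d = 1 it may depend on K, since with d = 1 the bound O(Kn) contradicts an Ω(K log K) lower bound on a real RAM, and with n = 1 the bound O(1) does not allow reading K trees. *)

(* Defs.v *)
(* MathComp / MathComp-Analysis *)
From mathcomp Require Import all_boot all_order all_algebra.
From mathcomp Require Import reals topology normedtype.
Set Implicit Arguments.
Unset Strict Implicit.
Unset Printing Implicit Defensive.
Import Order.TTheory GRing.Theory Num.Theory.
Import numFieldNormedType.Exports.
Local Open Scope ring_scope.

Inductive dtree (R : Type) (d : nat) : Type :=
  | Leaf of R
  | Node of 'I_d & R & dtree R d & dtree R d.
Arguments Leaf {R d} _.
Arguments Node {R d} _ _ _ _.

Fixpoint nleaves (R : Type) (d : nat) (T : dtree R d) : nat :=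
  match T with
  | Leaf _ => 1
  | Node _ _ l r => nleaves l + nleaves r
  end%N.

Fixpoint nnodes (R : Type) (d : nat) (T : dtree R d) : nat :=
  match T with
  | Leaf _ => 1
  | Node _ _ l r => (nnodes l + nnodes r).+1
  end%N.

(* The value v_{m(x)} carried by the leaf m(x) that x reaches. *)
Fixpoint predict (R : realType) (d : nat) (T : dtree R d) (x : 'rV[R]_d) : R :=
  match T with
  | Leaf v => v
  | Node t eta l r => if x ord0 t <= eta then predict l x else predict r x
  end.

Definition score (R : realType) (d K : nat) (E : K.-tuple (dtree R d))
    (x : 'rV[R]_d) : R :=
  \sum_(k < K) predict (tnth E k) x.

(* The norm of 'rV[R]_d is the sup norm (mx_norm). *)
Definition inBall (R : realType) (d : nat) (x : 'rV[R]_d) (eps : R)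
    (x' : 'rV[R]_d) : Prop :=
  `|x' - x| <= eps.

(* For an input x of label -1. *)
Definition attackable (R : realType) (d K : nat) (E : K.-tuple (dtree R d))
    (x : 'rV[R]_d) (eps : R) : Prop :=
  exists x', inBall x eps x' /\ 0 < score E x'.

(** Time is measured on a uniform unit-cost real RAM, programmed in a While
    language.  A program uses finitely many infinite arrays, indexed by natural
    numbers; an array holds either natural numbers or reals (a scalar variable
    is a cell with a literal index).  Naturals serve as counters and addresses;
    they have addition and truncated subtraction but no unit-cost
    multiplication, and a real can never be turned into a natural (no floor).
    Reals have exact field operations (with z / 0 = 0) and comparisons, and the
    only real literals are natural numbers.  A program thus depends neither on
    the data nor on n, K or d. *)

Inductive nexp : Type :=
  | NLit of nat
  | NGet (a : nat) (i : nexp)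
  | NAdd of nexp & nexp
  | NSub of nexp & nexp.

Inductive rexp : Type :=
  | RNat of nexp
  | RGet (a : nat) (i : nexp)
  | RAdd of rexp & rexp
  | RSub of rexp & rexp
  | RMul of rexp & rexp
  | RDiv of rexp & rexp.

Inductive bexp : Type :=
  | BNle of nexp & nexp
  | BRle of rexp & rexp
  | BNot of bexp
  | BAnd of bexp & bexp.

Inductive com : Type :=
  | Skip
  | NSet (a : nat) (i : nexp) (e : nexp)
  | RSet (a : nat) (i : nexp) (e : rexp)
  | Seq of com & com
  | If of bexp & com & com
  | While of bexp & com.

Record state (R : Type) : Type :=
  State { narr : nat -> nat -> nat; rarr : nat -> nat -> R }.

Definition upd (V : Type) (f : nat -> nat -> V) (a i : nat) (v : V) :
    nat -> nat -> V :=
  fun a' i' => if (a' == a) && (i' == i) then v else f a' i'.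

Fixpoint nval (R : realType) (s : state R) (e : nexp) : nat :=
  match e with
  | NLit n => n
  | NGet a i => narr s a (nval s i)
  | NAdd e1 e2 => nval s e1 + nval s e2
  | NSub e1 e2 => nval s e1 - nval s e2
  end%N.

Fixpoint rval (R : realType) (s : state R) (e : rexp) : R :=
  match e with
  | RNat e1 => (nval s e1)%:R
  | RGet a i => rarr s a (nval s i)
  | RAdd e1 e2 => rval s e1 + rval s e2
  | RSub e1 e2 => rval s e1 - rval s e2
  | RMul e1 e2 => rval s e1 * rval s e2
  | RDiv e1 e2 => rval s e1 / rval s e2
  end.

Fixpoint bval (R : realType) (s : state R) (b : bexp) : bool :=
  match b with
  | BNle e1 e2 => (nval s e1 <= nval s e2)%N
  | BRle e1 e2 => rval s e1 <= rval s e2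
  | BNot b1 => ~~ bval s b1
  | BAnd b1 b2 => bval s b1 && bval s b2
  end.

(* Each literal, memory access, operation and comparison costs one unit. *)
Fixpoint ncost (e : nexp) : nat :=
  match e with
  | NLit _ => 1
  | NGet _ i => (ncost i).+1
  | NAdd e1 e2 | NSub e1 e2 => (ncost e1 + ncost e2).+1
  end%N.

Fixpoint rcost (e : rexp) : nat :=
  match e with
  | RNat e1 => (ncost e1).+1
  | RGet _ i => (ncost i).+1
  | RAdd e1 e2 | RSub e1 e2 | RMul e1 e2 | RDiv e1 e2 =>
      (rcost e1 + rcost e2).+1
  end%N.

Fixpoint bcost (b : bexp) : nat :=
  match b with
  | BNle e1 e2 => (ncost e1 + ncost e2).+1
  | BRle e1 e2 => (rcost e1 + rcost e2).+1
  | BNot b1 => (bcost b1).+1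
  | BAnd b1 b2 => (bcost b1 + bcost b2).+1
  end%N.

(* [exec c s s' t]: started in s, c halts in s' after t units of time. *)
Inductive exec (R : realType) : com -> state R -> state R -> nat -> Prop :=
  | ExecSkip s : exec Skip s s 1
  | ExecNSet a i e s :
      exec (NSet a i e) s
        (State (upd (narr s) a (nval s i) (nval s e)) (rarr s))
        (ncost i + ncost e).+1
  | ExecRSet a i e s :
      exec (RSet a i e) s
        (State (narr s) (upd (rarr s) a (nval s i) (rval s e)))
        (ncost i + rcost e).+1
  | ExecSeq c1 c2 s1 s2 s3 t1 t2 :
      exec c1 s1 s2 t1 -> exec c2 s2 s3 t2 ->
      exec (Seq c1 c2) s1 s3 (t1 + t2).+1
  | ExecIf b c1 c2 s s' t :
      exec (if bval s b then c1 else c2) s s' t ->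
      exec (If b c1 c2) s s' (bcost b + t).+1
  | ExecWhileF b c s :
      ~~ bval s b -> exec (While b c) s s (bcost b).+1
  | ExecWhileT b c s1 s2 s3 t1 t2 :
      bval s1 b -> exec c s1 s2 t1 -> exec (While b c) s2 s3 t2 ->
      exec (While b c) s1 s3 (bcost b + t1 + t2).+1.

(** Input encoding: the nodes of all trees are listed in preorder, tree after
    tree, and refer to each other by their position in that list. *)

Record cell (R : Type) : Type := Cell {
  ckind : nat;   (* 0 for a leaf, 1 for an internal node *)
  cfeat : nat;   (* feature, counted from 0 *)
  cleft : nat;
  cright : nat;
  creal : R      (* threshold, or prediction value of a leaf *)
}.

(* [b] is the position of the root of T. *)
Fixpoint tree_cells (R : Type) (d : nat) (b : nat) (T : dtree R d) :
    seq (cell R) :=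
  match T with
  | Leaf v => [:: Cell 0 0 0 0 v]
  | Node t eta l r =>
      let bl := b.+1 in
      let br := (bl + nnodes l)%N in
      Cell 1 t bl br eta :: tree_cells bl l ++ tree_cells br r
  end.

Fixpoint forest_cells (R : Type) (d : nat) (b : nat) (E : seq (dtree R d)) :
    seq (cell R) :=
  if E is T :: E' then tree_cells b T ++ forest_cells (b + nnodes T) E'
  else [::].

Fixpoint forest_roots (R : Type) (d : nat) (b : nat) (E : seq (dtree R d)) :
    seq nat :=
  if E is T :: E' then b :: forest_roots (b + nnodes T) E' else [::].

(* All arrays and cells that are not mentioned are initially 0. *)
Definition encode (R : realType) (d K : nat) (E : K.-tuple (dtree R d))
    (x : 'rV[R]_d) (eps : R) : state R :=
  let cs := forest_cells 0 E in
  let ns := [:: [:: d; K]; forest_roots 0 E; map (@ckind R) cs;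
                map (@cfeat R) cs; map (@cleft R) cs; map (@cright R) cs] in
  let rs := [:: map (@creal R) cs; [seq x ord0 j | j <- enum 'I_d]; [:: eps]] in
  State (fun a i => nth 0%N (nth [::] ns a) i)
        (fun a i => nth 0 (nth [::] rs a) i).

(* The output is cell 0 of the first natural-number array left free by the
   input encoding. *)
Definition accepts (R : realType) (s : state R) : bool := narr s 6 0 == 1%N.

(* Main.v *)
Require Import Defs.
From mathcomp Require Import all_boot all_order all_algebra.
From mathcomp Require Import reals topology normedtype.
From mathcomp Require Import zify ring lra.
Set Implicit Arguments.
Unset Strict Implicit.
Unset Printing Implicit Defensive.
Import Order.TTheory GRing.Theory Num.Theory.
Import numFieldNormedType.Exports.
Local Open Scope ring_scope.

(** Three procedures are combined.

    A depth-first search over tuples of leaves continues from each leaf of a tree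
    at the root of the next tree, keeping the box of the branch up to date by
    undoing every change on the way back.  It makes
    S = n_1 + n_1 n_2 + ... + n_1 ... n_K visits, each in constant time, where n_k
    is the number of leaves of tree k, and S <= 2 n^K for n > 1.

    Rounding each coordinate of an attack up to the next threshold inside the
    ball, or to the upper end of the ball, does not change any comparison.  So it
    suffices to try, in each coordinate, at most one candidate per cell of the
    input, and there are N <= 2 K n cells.  Going through all points costs too
    much for a complete evaluation at each of them; instead all points on a line
    in direction 0 are evaluated together in time O(N).  For this the candidates
    for coordinate 0 are ranked in advance; on the line, each leaf is reached by
    an interval of ranks, and these intervals are recorded in a difference array
    whose prefix sums are the scores.  The N^(d-1) lines take time O(N^d), and the
    ranking takes time O(N^2), which is affordable for d > 1.

    For d = 1 the leaves of a tree that the ball meets come in increasing order.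
    Merging these lists for two trees yields the values of one tree at the right
    ends of the intervals of the other, and all pairs take time O(K^2 N).

    For d > 1 the first two procedures are chosen by comparing S with N^d, unless
    d >= K, when n^K is the smaller bound; both numbers are computed as reals,
    where multiplication is available. *)

(** * Time-bounded execution *)

Section Execution.
Variable R : realType.
Implicit Types (s : state R) (c : com) (b : bexp) (Q : state R -> Prop).

Fixpoint loop_free c : bool :=
  match c with
  | Seq c1 c2 | If _ c1 c2 => loop_free c1 && loop_free c2
  | While _ _ => false
  | _ => true
  end.

Fixpoint ev c s : state R :=
  match c with
  | Skip | While _ _ => s
  | NSet a i e => State (upd (narr s) a (nval s i) (nval s e)) (rarr s)
  | RSet a i e => State (narr s) (upd (rarr s) a (nval s i) (rval s e))
  | Seq c1 c2 => ev c2 (ev c1 s)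
  | If b c1 c2 => if bval s b then ev c1 s else ev c2 s
  end.

Lemma ev_seq c1 c2 s : ev (Seq c1 c2) s = ev c2 (ev c1 s).
Proof. by []. Qed.

Lemma ev_if b c1 c2 s : ev (If b c1 c2) s = ev (if bval s b then c1 else c2) s.
Proof. by rewrite /=; case: bval. Qed.

Fixpoint max_cost c : nat :=
  match c with
  | Skip => 1
  | NSet _ i e => (ncost i + ncost e).+1
  | RSet _ i e => (ncost i + rcost e).+1
  | Seq c1 c2 => (max_cost c1 + max_cost c2).+1
  | If b c1 c2 => (bcost b + (max_cost c1 + max_cost c2)).+1
  | While _ _ => 0
  end%N.

Lemma exec_ev c s :
  loop_free c -> exists2 t, exec c s (ev c s) t & (t <= max_cost c)%N.
Proof.
elim: c s => [|a i e|a i e|c1 IH1 c2 IH2|b c1 IH1 c2 IH2|b c IH] s //=.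
- by move=> _; exists 1%N => //; constructor.
- by move=> _; eexists; first by constructor.
- by move=> _; eexists; first by constructor.
- move=> /andP[/(IH1 s) [t1 e1 l1] /(IH2 (ev c1 s)) [t2 e2 l2]].
  by exists (t1 + t2).+1; [econstructor; eassumption | rewrite ltnS leq_add].
move=> /andP[/(IH1 s) [t1 e1 l1] /(IH2 s) [t2 e2 l2]].
exists (bcost b + (if bval s b then t1 else t2)).+1.
  by constructor; case: ifP.
by case: ifP => _; lia.
Qed.

Fixpoint nwritten (a : nat) c : bool :=
  match c with
  | NSet a' _ _ => a == a'
  | Seq c1 c2 | If _ c1 c2 => nwritten a c1 || nwritten a c2
  | While _ c1 => nwritten a c1
  | _ => false
  end.

Fixpoint rwritten (a : nat) c : bool :=
  match c with
  | RSet a' _ _ => a == a'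
  | Seq c1 c2 | If _ c1 c2 => rwritten a c1 || rwritten a c2
  | While _ c1 => rwritten a c1
  | _ => false
  end.

Definition frame c s s' :=
  (forall a, ~~ nwritten a c -> forall i, narr s' a i = narr s a i) /\
  (forall a, ~~ rwritten a c -> forall i, rarr s' a i = rarr s a i).

Lemma frame_trans c s1 s2 s3 :
  frame c s1 s2 -> frame c s2 s3 -> frame c s1 s3.
Proof.
move=> [n1 r1] [n2 r2]; split=> a ha i; first by rewrite n2 ?n1.
by rewrite r2 ?r1.
Qed.

Lemma exec_frame c s s' t : exec c s s' t -> frame c s s'.
Proof.
elim=> {c s s' t} //=.
- move=> a i e s; split=> //= a' ha' i'.
  by rewrite /upd (negbTE ha').
- move=> a i e s; split=> //= a' ha' i'.
  by rewrite /upd (negbTE ha').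
- move=> c1 c2 s1 s2 s3 t1 t2 _ [n1 r1] _ [n2 r2]; split=> a /=.
    by rewrite negb_or => /andP[h1 h2] i; rewrite n2 ?n1.
  by rewrite negb_or => /andP[h1 h2] i; rewrite r2 ?r1.
- move=> b c1 c2 s s' t; case: ifP => _ _ [n1 r1]; split=> a /=;
  by rewrite negb_or => /andP[h1 h2] i; rewrite ?n1 ?r1.
- by move=> b c s1 s2 s3 t1 t2 _ _ F1 _ F2; apply: frame_trans F1 F2.
Qed.

Lemma ev_frame c s : loop_free c -> frame c s (ev c s).
Proof. by move=> /(exec_ev s) [t /exec_frame]. Qed.

Definition term c s Q (m : nat) : Prop :=
  exists s' t, [/\ exec c s s' t, Q s' & (t <= m)%N].

Lemma term_weaken c s Q Q' m m' :
  term c s Q m -> (forall s', frame c s s' -> Q s' -> Q' s') ->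
  (m <= m')%N -> term c s Q' m'.
Proof.
move=> [s' [t [e q l]]] QQ' mm'; exists s', t; split=> //.
  exact: QQ' (exec_frame e) q.
exact: leq_trans l mm'.
Qed.

Lemma term_cost c s Q m m' : term c s Q m -> (m <= m')%N -> term c s Q m'.
Proof. by move=> h; apply: term_weaken h _. Qed.

Lemma term_ev c s Q : loop_free c -> Q (ev c s) -> term c s Q (max_cost c).
Proof. by move=> /(exec_ev s) [t e l] q; exists (ev c s), t. Qed.

Lemma term_seq c1 c2 s Q1 Q m1 m2 :
  term c1 s Q1 m1 ->
  (forall s', frame c1 s s' -> Q1 s' -> term c2 s' Q m2) ->
  term (Seq c1 c2) s Q (m1 + m2).+1.
Proof.
move=> [s1 [t1 [e1 q1 l1]]] /(_ _ (exec_frame e1) q1) [s2 [t2 [e2 q2 l2]]].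
exists s2, (t1 + t2).+1; split=> //; first by econstructor; eassumption.
by rewrite ltnS leq_add.
Qed.

Lemma term_if b c1 c2 s Q m :
  term (if bval s b then c1 else c2) s Q m ->
  term (If b c1 c2) s Q (bcost b + m).+1.
Proof.
move=> [s1 [t1 [e1 q1 l1]]]; exists s1, (bcost b + t1).+1; split=> //.
  by constructor.
by rewrite ltnS leq_add2l.
Qed.

Definition while_cost b (m v : nat) := (v * (bcost b + m).+1 + (bcost b).+1)%N.

Lemma leq_while_cost b m v v' :
  (v <= v')%N -> (while_cost b m v <= while_cost b m v')%N.
Proof. by move=> h; rewrite leq_add2r leq_mul2r h orbT. Qed.

Lemma term_while b c (I : nat -> state R -> Prop) m v s :
  (forall v s, I v s -> bval s b ->
     term c s (fun s' => exists2 v', (v' < v)%N & I v' s') m) ->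
  I v s ->
  term (While b c) s (fun s' => (exists v', I v' s') /\ ~~ bval s' b)
    (while_cost b m v).
Proof.
move=> step; rewrite /while_cost.
elim/ltn_ind: v s => v IH s Is.
have [hb|hb] := boolP (bval s b); last first.
  exists s, (bcost b).+1; split; [by constructor | | by rewrite leq_addl].
  by split=> //; exists v.
have [s1 [t1 [e1 [v' lt_v I1] l1]]] := step _ _ Is hb.
have [s2 [t2 [e2 q2 l2]]] := IH _ lt_v _ I1.
exists s2, (bcost b + t1 + t2).+1; split=> //; first exact: ExecWhileT e1 e2.
suff : (v' * (bcost b + m).+1 + (bcost b + m).+1 <= v * (bcost b + m).+1)%N.
  by lia.
by rewrite -mulSnr leq_mul2r lt_v orbT.
Qed.

Lemma term_for b c (I : nat -> state R -> Prop) m n s :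
  (forall j s, (j < n)%N -> I j s -> bval s b /\ term c s (I j.+1) m) ->
  (forall s, I n s -> ~~ bval s b) ->
  I 0%N s -> term (While b c) s (I n) (while_cost b m n).
Proof.
move=> step stop I0.
pose J v s := (v <= n)%N /\ I (n - v)%N s.
have J0 : J n s by split=> //; rewrite subnn.
apply: term_weaken (term_while (m := m) _ J0) _ (leqnn _) => [v s' [vn Is] hb|].
  case: v vn Is => [|v] vn Is.
    by move: (stop s'); rewrite hb subn0 in Is * => /(_ Is).
  have [|_ [s2 [t [e Q l]]]] := step _ _ _ Is; first lia.
  exists s2, t; split=> //; exists v => //; split; first lia.
  by have -> : (n - v = (n - v.+1).+1)%N by lia.
move=> s' _ [[[|v] [vn Is]] hb]; first by rewrite subn0 in Is.
by have [|hb' _] := step _ _ _ Is; [lia | rewrite hb' in hb].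
Qed.

Definition iterates b c s Q (v : nat) : Prop :=
  exists k, [/\ (k <= v)%N, forall j, (j < k)%N -> bval (iter j (ev c) s) b
    & Q (iter k (ev c) s)].

Lemma iterates0 b c s Q v : Q s -> iterates b c s Q v.
Proof. by move=> Qs; exists 0%N. Qed.

Lemma iterates_step b c s Q v :
  bval s b -> iterates b c (ev c s) Q v -> iterates b c s Q v.+1.
Proof.
move=> hb [k [kv hk Qk]]; exists k.+1; split=> //; last by rewrite iterSr.
by case=> [|j] // /hk; rewrite -iterSr.
Qed.

Lemma iterates_bind b c s Q1 Q v1 v2 :
  iterates b c s Q1 v1 -> (forall s', Q1 s' -> iterates b c s' Q v2) ->
  iterates b c s Q (v1 + v2).
Proof.
move=> [k1 [l1 h1 q1]] /(_ _ q1) [k2 [l2 h2 q2]].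
exists (k2 + k1)%N; split; [by lia | | by rewrite iterD].
move=> j jk; have [/h1 //|kj] := ltnP j k1.
by rewrite -(subnK kj) iterD; apply: h2; lia.
Qed.

Lemma iterates_weaken b c s Q Q' v v' :
  iterates b c s Q v -> (forall s', Q s' -> Q' s') -> (v <= v')%N ->
  iterates b c s Q' v'.
Proof.
move=> [k [kv hk Qk]] QQ' vv'; exists k; split=> //; last exact: QQ'.
exact: leq_trans kv vv'.
Qed.

Lemma iterates_frame b c s Q v :
  loop_free c -> iterates b c s Q v ->
  iterates b c s (fun s' => frame c s s' /\ Q s') v.
Proof.
move=> lf [k [kv hk Qk]]; exists k; split=> //; split=> //.
elim: k {kv hk Qk} => [|k IH] //=.
exact: frame_trans IH (ev_frame _ lf).
Qed.

Lemma term_iterates b c s Q v :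
  loop_free c -> iterates b c s (fun s' => ~~ bval s' b /\ Q s') v ->
  term (While b c) s Q (while_cost b (max_cost c) v).
Proof.
move=> lf [k [kv hk [hb Qk]]].
have := @term_for b c (fun j s' => s' = iter j (ev c) s) (max_cost c) k s.
case=> [j _ jk ->|_ ->|//|s' [t [e s'E l]]] //.
  by split; [exact: hk | exact: term_ev].
rewrite {}s'E in e.
exists (iter k (ev c) s), t; split=> //; apply: leq_trans l _.
exact: leq_while_cost.
Qed.

End Execution.

Definition var (a : nat) : nexp := NGet a (NLit 0).
Definition rvar (a : nat) : rexp := RGet a (NLit 0).
Definition setn (a : nat) (e : nexp) : com := NSet a (NLit 0) e.
Definition setr (a : nat) (e : rexp) : com := RSet a (NLit 0) e.
Definition incr (a : nat) : com := setn a (NAdd (var a) (NLit 1)).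
Definition nlt (e1 e2 : nexp) : bexp := BNle (NAdd e1 (NLit 1)) e2.
Definition rlt (e1 e2 : rexp) : bexp := BNot (BRle e2 e1).
Arguments var /.
Arguments rvar /.
Arguments setn /.
Arguments setr /.
Arguments incr /.
Arguments nlt /.
Arguments rlt /.

(** * The encoded ensemble *)

Lemma nleaves_gt0 (R : Type) d (T : dtree R d) : (0 < nleaves T)%N.
Proof. by elim: T => //= _ _ l hl r _; rewrite addn_gt0 hl. Qed.

Lemma nnodes_nleaves (R : Type) d (T : dtree R d) :
  ((nnodes T).+1 = 2 * nleaves T)%N.
Proof. by elim: T => //= _ _ l hl r hr; lia. Qed.

Lemma nnodes_gt0 (R : Type) d (T : dtree R d) : (0 < nnodes T)%N.
Proof. by case: T. Qed.

Section Input.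
Variables (R : realType) (d : nat).
Implicit Types (s : state R) (T : dtree R d) (Es : seq (dtree R d)).

Fixpoint stored s (b : nat) T : Prop :=
  match T with
  | Leaf v => narr s 2 b = 0%N /\ rarr s 0 b = v
  | Node t eta l r =>
      [/\ narr s 2 b = 1%N, narr s 3 b = t, narr s 4 b = b.+1,
          narr s 5 b = (b.+1 + nnodes l)%N & rarr s 0 b = eta] /\
      (stored s b.+1 l /\ stored s (b.+1 + nnodes l) r)
  end.

Lemma stored_frame c s s' b T :
  frame c s s' -> ~~ [|| nwritten 2 c, nwritten 3 c, nwritten 4 c,
    nwritten 5 c | rwritten 0 c] -> stored s b T -> stored s' b T.
Proof.
rewrite !negb_or => -[fn fr] /and5P[h2 h3 h4 h5 h0].
elim: T b => [v|t eta l IHl r IHr] b /=; rewrite !fn ?fr //.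
by move=> [hh [/IHl hl /IHr hr]].
Qed.

Lemma size_tree_cells b T : size (tree_cells b T) = nnodes T.
Proof. by elim: T b => //= t eta l IHl r IHr b; rewrite size_cat IHl IHr. Qed.

Lemma tree_cells_stored c0 s (cs : seq (cell R)) b T :
  (forall i, (i < nnodes T)%N ->
     nth c0 (tree_cells b T) i = nth c0 cs (b + i)) ->
  (forall i, (b <= i < b + nnodes T)%N ->
     let c := nth c0 cs i in
     [/\ narr s 2 i = ckind c, narr s 3 i = cfeat c, narr s 4 i = cleft c,
         narr s 5 i = cright c & rarr s 0 i = creal c]) ->
  stored s b T.
Proof.
elim: T b => [v|t eta l IHl r IHr] b /= hc hs.
  have [|-> _ _ _ ->] := hs b; first lia.
  by have := hc 0%N isT; rewrite addn0 => <-.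
split; first (have [|-> -> -> -> ->] := hs b; first lia).
  by have := hc 0%N isT; rewrite addn0 => <-.
split; [apply: IHl | apply: IHr] => i hi.
- have /= := hc i.+1; rewrite nth_cat size_tree_cells hi addSnnS; apply.
  by rewrite ltnS; lia.
- by apply: hs; lia.
- have /= := hc (nnodes l + i).+1; rewrite nth_cat size_tree_cells.
  have -> : (nnodes l + i < nnodes l)%N = false by lia.
  rewrite addKn => ->; first by congr (nth _ _ _); lia.
  by rewrite ltnS ltn_add2l.
- by apply: hs; lia.
Qed.

Definition offset Es k : nat := sumn [seq nnodes T | T <- take k Es].
Definition tree Es k := nth (Leaf 0) Es k.

Lemma offset0 Es : offset Es 0 = 0%N.
Proof. by rewrite /offset take0. Qed.

Lemma offsetS Es k : (k < size Es)%N ->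
  offset Es k.+1 = (offset Es k + nnodes (tree Es k))%N.
Proof.
move=> hk; rewrite /offset /tree (take_nth (Leaf 0)) // map_rcons.
by rewrite -cats1 sumn_cat /= addn0.
Qed.

Lemma leq_offset Es k k' : (k <= k')%N -> (offset Es k <= offset Es k')%N.
Proof.
move=> /subnKC <-; elim: {k'}(k' - k)%N => [|m IH]; first by rewrite addn0.
rewrite addnS; have [h|h] := ltnP (k + m) (size Es).
  by rewrite offsetS // (leq_trans IH) ?leq_addr.
by rewrite (leq_trans IH) // /offset !take_oversize // leqW.
Qed.

Lemma nth_forest_roots b Es k : (k < size Es)%N ->
  nth 0%N (forest_roots b Es) k = (b + offset Es k)%N.
Proof.
elim: Es b k => [|T Es IH] b [|k] //=; first by rewrite addn0.
by rewrite ltnS => /IH ->; rewrite /offset /= addnA.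
Qed.

Lemma nth_forest_cells c0 b Es k i :
  (k < size Es)%N -> (i < nnodes (tree Es k))%N ->
  nth c0 (forest_cells b Es) (offset Es k + i) =
  nth c0 (tree_cells (b + offset Es k) (tree Es k)) i.
Proof.
elim: Es b k => [|T Es IH] b [|k] //=; rewrite nth_cat size_tree_cells.
  by move=> _ hi; rewrite offset0 hi addn0.
move=> hk hi; rewrite /offset /= -/(offset Es k) -addnA ltnNge leq_addr /=.
by rewrite addKn IH // addnA.
Qed.

Lemma size_forest_cells b Es : size (forest_cells b Es) = offset Es (size Es).
Proof.
elim: Es b => //= T Es IH b; rewrite size_cat size_tree_cells IH.
by rewrite /offset.
Qed.

Variables (Es : seq (dtree R d)) (x : 'rV[R]_d) (eps : R).

Definition input s :=
  [/\ narr s 0 0 = d, narr s 0 1 = size Es,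
      (forall k, (k < size Es)%N -> narr s 1 k = offset Es k),
      (forall k, (k < size Es)%N -> stored s (offset Es k) (tree Es k)) &
      (forall j : 'I_d, rarr s 1 j = x ord0 j) /\ rarr s 2 0 = eps].

Definition input_sized s :=
  [/\ input s, narr s 1 (size Es) = offset Es (size Es)
    & narr s 7 0 = offset Es (size Es)].

Definition keeps_input c :=
  ~~ has (fun a => nwritten a c) [:: 0; 1; 2; 3; 4; 5; 7]%N &&
  ~~ has (fun a => rwritten a c) [:: 0; 1; 2]%N.

Lemma input_frame c s s' :
  frame c s s' -> keeps_input c -> input s -> input s'.
Proof.
move=> fc /andP[/= hn hr] [h1 h2 h3 h4 [h5 h6]].
move: (fc) hn hr => [fn fr]; rewrite !negb_or !andbT.
move=> /and5P[w0 w1 w2 w3 /and3P[w4 w5 w7]] /and3P[r0 r1 r2].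
split; rewrite ?fn ?fr //.
- by move=> k hk; rewrite fn ?h3.
- move=> k hk; apply: stored_frame fc _ (h4 _ hk).
  by rewrite !negb_or; apply/and5P; split.
- by split=> // j; rewrite fr.
Qed.

Lemma input_sized_frame c s s' :
  frame c s s' -> keeps_input c -> input_sized s -> input_sized s'.
Proof.
move=> fc hc [h1 h2 h3]; split; first exact: input_frame fc hc h1.
  by case: fc => fn _; rewrite fn //; case/andP: hc; rewrite /= !negb_or =>
    /and5P[].
case: fc => fn _; rewrite fn //; case/andP: hc; rewrite /= !negb_or !andbT.
by move=> /and5P[_ _ _ _ /and3P[]].
Qed.

(* The arrays that the encoding and the preprocessing leave empty. *)
Definition fresh s :=
  (forall a i, ((a == 6) || (8 < a))%N -> narr s a i = 0%N) /\
  (forall a i, (4 < a)%N -> rarr s a i = 0).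

End Input.

Lemma encode_input (R : realType) d K (E : K.-tuple (dtree R d)) x eps :
  input E x eps (encode E x eps).
Proof.
split=> //=; first by rewrite size_tuple.
- by move=> k hk; rewrite nth_forest_roots.
- move=> k hk; pose c0 := Cell 0 0 0 0 (0 : R).
  apply: (@tree_cells_stored _ _ c0 _ (forest_cells 0 E)) => [i hi|i hi].
    by rewrite nth_forest_cells.
  have hs : (i < size (forest_cells 0 E))%N.
    rewrite size_forest_cells.
    have := leq_offset E hk; rewrite offsetS //; case/andP: hi => _; exact: leq_trans.
  by rewrite /= !(nth_map c0).
split=> // j; rewrite (nth_map j) ?size_enum_ord //.
by rewrite nth_ord_enum.
Qed.

Lemma encode_fresh (R : realType) d K (E : K.-tuple (dtree R d)) x eps :
  (forall a i, ((a == 6) || (8 < a))%N -> narr (encode E x eps) a i = 0%N) /\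
  (forall a i, (2 < a)%N -> rarr (encode E x eps) a i = 0).
Proof.
split=> [[|[|[|[|[|[|a]]]]]] i // _|[|[|[|a]]] i // _] /=;
  by rewrite ?nth_nil // (nth_default [::]) ?nth_nil //=; lia.
Qed.

Definition in_ball (R : realType) d (x : 'rV[R]_d) (eps : R) (y : 'rV[R]_d) :=
  forall j : 'I_d, x ord0 j - eps <= y ord0 j <= x ord0 j + eps.

Definition total_score (R : realType) d (Es : seq (dtree R d)) (y : 'rV[R]_d) :=
  \sum_(T <- Es) predict T y.

Lemma inBallP (R : realType) d (x : 'rV[R]_d) (eps : R) (y : 'rV[R]_d) :
  0 <= eps -> inBall x eps y <-> in_ball x eps y.
Proof.
move=> eps0; rewrite /inBall [`|_|]mx_normrE; split=> [h j|h].
  have /Order.TotalTheory.bigmax_leP[_ /(_ (ord0, j) isT)] := h.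
  by rewrite /= !mxE ler_distlC => /andP[h1 h2]; apply/andP; split; lra.
apply/Order.TotalTheory.bigmax_leP; split=> // -[i j] _ /=.
rewrite !mxE ler_distlC (ord1 i); have /andP[h1 h2] := h j.
by apply/andP; split; lra.
Qed.

Lemma attackableE (R : realType) d K (E : K.-tuple (dtree R d)) x eps :
  0 <= eps -> attackable E x eps <->
  exists y, in_ball x eps y /\ 0 < total_score E y.
Proof.
move=> eps0; split=> -[y [/(inBallP x y eps0) hy hp]]; exists y; split=> //.
  by rewrite /total_score big_tuple.
by move: hp; rewrite /total_score big_tuple.
Qed.

(** * Preprocessing *)

Notation aRoot := 1%N (only parsing).
Notation aKind := 2%N (only parsing).
Notation aFeat := 3%N (only parsing).
Notation aLeft := 4%N (only parsing).
Notation aRight := 5%N (only parsing).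
Notation aOut := 6%N (only parsing).
Notation aTotal := 7%N (only parsing).
Notation aIdx := 8%N (only parsing).
Notation rVal := 0%N (only parsing).
Notation rX := 1%N (only parsing).
Notation rEps := 2%N (only parsing).
Notation rVisits := 3%N (only parsing).
Notation rPow := 4%N (only parsing).
Notation dimE := (NGet 0 (NLit 0)) (only parsing).
Notation numE := (NGet 0 (NLit 1)) (only parsing).

(* The number of leaves of the tree in which the leaves of each member of the
   ensemble are replaced by copies of the next member, counted with the leaves
   at intermediate levels. *)
Fixpoint visits (R : Type) d (Es : seq (dtree R d)) : nat :=
  if Es is T :: Es' then (nleaves T * (visits Es').+1)%N else 0%N.

Section Visits.
Variables (R : Type) (d : nat).
Implicit Type Es : seq (dtree R d).

Lemma sumn_nnodes_visits Es :
  (sumn [seq nnodes T | T <- Es] <= 2 * visits Es)%N.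
Proof. by elim: Es => //= T Es IH; have := nnodes_nleaves T; nia. Qed.

Lemma size_visits Es : (size Es <= visits Es)%N.
Proof. by elim: Es => //= T Es IH; have := nleaves_gt0 T; nia. Qed.

Lemma size_sumn_nnodes Es : (size Es <= sumn [seq nnodes T | T <- Es])%N.
Proof. by elim: Es => //= T Es IH; have := nnodes_gt0 T; lia. Qed.

Lemma sumn_nnodes_leq n Es :
  all (fun T => nleaves T <= n)%N Es ->
  (sumn [seq nnodes T | T <- Es] <= 2 * size Es * n)%N.
Proof.
elim: Es => //= T Es IH /andP[hT /IH].
by have := nnodes_nleaves T; nia.
Qed.

Lemma visits_leq n Es :
  all (fun T => nleaves T <= n)%N Es -> (visits Es <= size Es * n ^ size Es)%N.
Proof.
elim: Es => //= T Es IH /andP[hT /IH {}IH].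
have n0 : (0 < n)%N by apply: leq_trans hT; apply: nleaves_gt0.
have p0 : (0 < n ^ size Es)%N by rewrite expn_gt0 n0.
apply: leq_trans (_ : n * (visits Es).+1 <= _)%N.
  by rewrite leq_mul2r hT orbT.
by rewrite expnS mulnCA leq_mul2l mulSn; lia.
Qed.

Lemma visits_leq2 n Es :
  (1 < n)%N -> all (fun T => nleaves T <= n)%N Es ->
  ((visits Es).+2 <= 2 * n ^ size Es)%N.
Proof.
move=> n1; elim: Es => //= T Es IH /andP[hT /IH {}IH].
have : (nleaves T * (visits Es).+1 <= n * (visits Es).+1)%N.
  by rewrite leq_mul2r hT orbT.
by rewrite expnS; nia.
Qed.

End Visits.

Definition find_total : com :=
  Seq (setn aIdx (NGet aRoot (NSub numE (NLit 1))))
  (Seq (While (BNle (NLit 1) (NGet aKind (var aIdx)))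
          (setn aIdx (NGet aRight (var aIdx))))
  (Seq (setn aTotal (NAdd (var aIdx) (NLit 1)))
       (NSet aRoot numE (var aTotal)))).

Definition count_visits : com :=
  Seq (setn aIdx numE)
  (While (BNle (NLit 1) (var aIdx))
    (Seq (setn aIdx (NSub (var aIdx) (NLit 1)))
      (setr rVisits
        (RMul
          (RDiv (RNat (NAdd (NSub (NGet aRoot (NAdd (var aIdx) (NLit 1)))
                                  (NGet aRoot (var aIdx))) (NLit 1)))
                (RNat (NLit 2)))
          (RAdd (RNat (NLit 1)) (rvar rVisits)))))).

Definition total_power : com :=
  Seq (setr rPow (RNat (NLit 1)))
  (Seq (setn aIdx (NLit 0))
  (If (nlt dimE numE)
    (While (nlt (var aIdx) dimE)
       (Seq (setr rPow (RMul (rvar rPow) (RNat (var aTotal)))) (incr aIdx)))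
    Skip)).

Definition preprocess : com := Seq find_total (Seq count_visits total_power).

Section Preprocess.
Variables (R : realType) (d : nat) (Es : seq (dtree R d)).
Variables (x : 'rV[R]_d) (eps : R).
Implicit Type s : state R.

Hypothesis Es0 : (0 < size Es)%N.

Local Notation N := (offset Es (size Es)).

Lemma size_leq_offset : (size Es <= N)%N.
Proof. by rewrite /offset take_size size_sumn_nnodes. Qed.

Lemma rightmost_leaf (T : dtree R d) b s v :
  stored s b T -> narr s aIdx 0 = b -> (nnodes T <= v)%N ->
  iterates (BNle (NLit 1) (NGet aKind (var aIdx)))
    (setn aIdx (NGet aRight (var aIdx))) s
    (fun s' => ~~ bval s' (BNle (NLit 1) (NGet aKind (var aIdx))) /\
       (narr s' aIdx 0).+1 = (b + nnodes T)%N) v.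
Proof.
elim: T b s v => [w|t eta l IHl r IHr] b s v /= st hb hv.
  by apply: iterates0; rewrite /= hb st.1 addn1.
have [[h2 _ _ h5 _] [_ hr]] := st.
case: v hv => // v hv; apply: iterates_step; first by rewrite /= hb h2.
apply: iterates_weaken (IHr (b.+1 + nnodes l)%N _ v _ _ _) _ (leqnn _).
- exact: (stored_frame (ev_frame _ _) _ hr).
- by rewrite /= /upd /= hb h5.
- by lia.
by move=> s' [h ->]; split=> //; lia.
Qed.

Lemma find_totalP s : input Es x eps s ->
  term find_total s (input_sized Es x eps) (100 * N).
Proof.
move=> inp; have [h0 h1 h2 h3 [h4 h5]] := inp.
have N0 : (0 < N)%N by apply: leq_trans size_leq_offset.
have lt_last : ((size Es).-1 < size Es)%N by rewrite prednK.
have NE : N = (offset Es (size Es).-1 + nnodes (tree Es (size Es).-1))%N.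
  by rewrite -offsetS ?prednK.
apply: term_cost.
  apply: term_seq.
    apply: (term_ev (Q := fun s' => narr s' aIdx 0 = offset Es (size Es).-1)) => //.
    by rewrite /= /upd /= h1 subn1 h2.
  move=> s1 f1 q1; apply: term_seq.
    apply: (@term_iterates _ _ _ _ (fun s' => (narr s' aIdx 0).+1 = N) N) => //.
    apply: iterates_weaken.
    + apply: (@rightmost_leaf _ _ s1 _ _ q1) (leqnn _).
      exact: stored_frame f1 _ (h3 _ lt_last).
    + by rewrite -NE.
    + by rewrite [leqRHS]NE leq_addl.
  move=> s2 f2 q2; apply: term_ev => //.
  have [g0 g1 g2 g3 [g4 g5]] : input Es x eps s2.
    by apply: input_frame f2 _ (input_frame f1 _ inp).
  have F := ev_frame s2 (isT : loop_free (Seq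
    (setn aTotal (NAdd (var aIdx) (NLit 1))) (NSet aRoot numE (var aTotal)))).
  rewrite /= /upd /= g1 addn1 q2 in F *; split; rewrite /= ?eqxx //.
  split=> //=.
  - by move=> k hk; rewrite ltn_eqF // g2.
  - by move=> k hk; apply: stored_frame F _ (g3 k hk).
by rewrite /while_cost /=; lia.
Qed.

Lemma count_visitsP s : input_sized Es x eps s ->
  rarr s rVisits 0 = 0 ->
  term count_visits s (fun s' => rarr s' rVisits 0 = (visits Es)%:R) (100 * N).
Proof.
move=> inp r0; have [[_ h1 _ _ _] _ _] := inp.
pose I j s' := [/\ input_sized Es x eps s', narr s' aIdx 0 = (size Es - j)%N &
  rarr s' rVisits 0 = (visits (drop (size Es - j) Es))%:R].
apply: term_cost.
  apply: term_seq.
    apply: (term_ev (Q := I 0%N)) => //; split.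
    - exact: (input_sized_frame (ev_frame _ _) _ inp).
    - by rewrite /= /upd /= h1 subn0.
    - by rewrite /= r0 subn0 drop_size.
  move=> s1 f1 q1.
  apply: (@term_weaken _ _ _ (I (size Es))).
  - apply: (@term_for _ _ _ _ _ (size Es)) q1.
      move=> j s2 hj [inp2 hi hv]; split; first by rewrite /= hi; lia.
      apply: term_ev => //.
      have [[_ g1 g2 _ _] g6 g7] := inp2.
      have lt_i : (size Es - j.+1 < size Es)%N by lia.
      have iE : ((size Es - j.+1).+1 = size Es - j)%N by lia.
      split; first exact: (input_sized_frame (ev_frame _ _) _ inp2).
        by rewrite /= /upd /= hi; lia.
      rewrite /= /upd /= hi -subnDA !addn1 iE (drop_nth (Leaf 0)) //=.
      rewrite iE hv.
      have -> : narr s2 1 (size Es - j) = offset Es (size Es - j)%N.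
        have [lt|ge] := ltnP (size Es - j) (size Es); first exact: g2.
        by have -> : (size Es - j = size Es)%N by lia.
      rewrite g2 // -iE offsetS // addKn -addn1 addn1 nnodes_nleaves.
      rewrite [X in X / _]natrM [X in X / _]mulrC mulfK ?pnatr_eq0 //.
      by rewrite natrM -[X in _ = _ * X]natr1 [in RHS]addrC.
    by move=> s2 [_ hi _]; rewrite /= hi; lia.
  - by move=> s2 _ [_ _]; rewrite subnn drop0.
  - exact: leqnn.
by rewrite /while_cost /=; have := size_leq_offset; lia.
Qed.

Lemma total_powerP s : input_sized Es x eps s ->
  term total_power s
    (fun s' => (d < size Es)%N -> rarr s' rPow 0 = (N ^ d)%:R) (100 * N).
Proof.
move=> inp; have [[h0 h1 _ _ _] _ h7] := inp.
pose I j s' := [/\ narr s' 0 0 = d, narr s' aTotal 0 = N,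
  narr s' aIdx 0 = j & rarr s' rPow 0 = (N ^ j)%:R].
apply: term_cost.
  apply: term_seq; first exact: (term_ev (Q := eq (ev _ s))).
  move=> s1 f1 q1; apply: term_seq.
    apply: (term_ev (Q := fun s' => input_sized Es x eps s' /\ I 0%N s')) => //.
    split; rewrite -q1.
      exact: input_sized_frame (ev_frame _ _) _
        (input_sized_frame (ev_frame _ _) _ inp).
    by split; rewrite /= /upd.
  move=> s2 f2 [inp2 I2]; have [[g0 g1 _ _ _] _ g7] := inp2.
  apply: (@term_if _ _ _ _ _ _ (while_cost _ _ N)).
  rewrite /= g0 g1 addn1; case: leqP => [_|lt].
    by exists s2, 1%N; split; [constructor | | rewrite /while_cost; lia].
  apply: (@term_weaken _ _ _ (I d) _ (while_cost _ _ d)).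
  - apply: term_for I2 => [j s3 hj [k0 k7 ki kp]|s3 [k0 k7 ki kp]].
      split; first by rewrite /= k0 ki addn1.
      apply: term_ev => //; split; rewrite /= /upd //= ?ki ?addn1 //.
      by rewrite k7 kp -natrM expnSr.
    by rewrite /= k0 ki addn1 ltnn.
  - by move=> s3 _ [].
  - by apply: leq_while_cost; apply: leq_trans size_leq_offset; apply: ltnW.
by rewrite /while_cost /=; have := size_leq_offset; lia.
Qed.

Definition preprocessed s :=
  [/\ input_sized Es x eps s, fresh s, rarr s rVisits 0 = (visits Es)%:R &
      (d < size Es)%N -> rarr s rPow 0 = (N ^ d)%:R].

Lemma preprocessP s : input Es x eps s ->
  (forall a i, ((a == 6) || (8 < a))%N -> narr s a i = 0%N) ->
  (forall a i, (2 < a)%N -> rarr s a i = 0) ->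
  term preprocess s preprocessed (400 * N).
Proof.
move=> inp hn hr; apply: term_weaken.
- apply: term_seq; first exact: find_totalP.
  move=> s1 f1 q1; apply: term_seq.
    by apply: count_visitsP => //; rewrite (proj2 f1) ?hr.
  move=> s2 f2 q2.
  have inp2 := input_sized_frame f2 isT q1.
  apply: (@term_weaken _ _ _ _ (fun s' => [/\ input_sized Es x eps s',
    rarr s' rVisits 0 = (visits Es)%:R &
    (d < size Es)%N -> rarr s' rPow 0 = (N ^ d)%:R])).
  + exact: total_powerP.
  + move=> s3 f3 q3; split=> //; first exact: input_sized_frame f3 isT inp2.
    by rewrite (proj2 f3).
  + exact: leqnn.
- move=> s' [fn fr] [q1 q2 q3]; split=> //; split=> a i ha.
    rewrite fn ?hn // /=; lia.
  by rewrite fr ?hr // /=; lia.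
have := size_leq_offset; lia.
Qed.

End Preprocess.

(** * Search over tuples of leaves *)

Notation aCur := 10%N (only parsing).
Notation aPar := 11%N (only parsing).
Notation aMode := 12%N (only parsing).
Notation aLev := 13%N (only parsing).
Notation aBad := 14%N (only parsing).
Notation aPhase := 15%N (only parsing).
Notation aSavedBad := 16%N (only parsing).
Notation rSum := 6%N (only parsing).
Notation rSaved := 7%N (only parsing).
Notation rH := 8%N (only parsing).
Notation rL := 9%N (only parsing).

Section DfsProgram.

Let cur := var aCur.
Let feat := NGet aFeat cur.
Let top := RAdd (RGet rX feat) (rvar rEps).
Let bottom := RSub (RGet rX feat) (rvar rEps).
Let below := RSub bottom (RNat (NLit 1)).

(* The current box constrains coordinate t to the values y such that
   x_t - eps - 1 + L_t < y <= x_t + eps - H_t and x_t - eps <= y.  With these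
   offsets the arrays L and H, which are initially zero, describe the ball
   without an initialization that would take time d. *)
Definition dfs_check : com :=
  If (BAnd (rlt (RAdd below (RGet rL feat)) (RSub top (RGet rH feat)))
           (BRle bottom (RSub top (RGet rH feat))))
    Skip (setn aBad (NLit 1)).

Definition dfs_enter_leaf : com :=
  Seq (setr rSum (RAdd (rvar rSum) (RGet rVal cur)))
  (Seq (incr aLev)
  (If (BNle numE (var aLev))
    (Seq (If (BAnd (BNle (var aBad) (NLit 0)) (rlt (RNat (NLit 0)) (rvar rSum)))
            (setn aOut (NLit 1)) Skip)
         (setn aMode (NLit 1)))
    (Seq (NSet aPar (NGet aRoot (var aLev)) cur)
         (setn aCur (NGet aRoot (var aLev)))))).

Definition dfs_descend (a : nat) (e : rexp) (phase child : nat) : com :=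
  Seq (Seq (RSet rSaved cur (RGet a feat)) (NSet aPhase cur (NLit phase)))
  (Seq (If (rlt (RGet a feat) e) (RSet a feat e) Skip)
  (Seq dfs_check
  (Seq (setn aMode (NLit 0))
  (Seq (NSet aPar (NGet child cur) cur)
       (setn aCur (NGet child cur)))))).

Definition dfs_enter_node : com :=
  Seq (NSet aSavedBad cur (var aBad))
      (dfs_descend rH (RSub top (RGet rVal cur)) 0 aLeft).

Definition dfs_leave_leaf : com :=
  Seq (setr rSum (RSub (rvar rSum) (RGet rVal cur)))
  (Seq (setn aLev (NSub (var aLev) (NLit 1)))
       (setn aCur (NGet aPar cur))).

Definition dfs_leave_left : com :=
  Seq (Seq (RSet rH feat (RGet rSaved cur))
           (setn aBad (NGet aSavedBad cur)))
      (dfs_descend rL (RSub (RGet rVal cur) below) 1 aRight).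

Definition dfs_leave_right : com :=
  Seq (RSet rL feat (RGet rSaved cur))
  (Seq (setn aBad (NGet aSavedBad cur))
       (setn aCur (NGet aPar cur))).

Definition dfs_step : com :=
  If (BNle (var aMode) (NLit 0))
    (If (BNle (NGet aKind cur) (NLit 0)) dfs_enter_leaf dfs_enter_node)
    (If (BNle (NGet aKind cur) (NLit 0)) dfs_leave_leaf
      (If (BNle (NGet aPhase cur) (NLit 0)) dfs_leave_left dfs_leave_right)).

Definition dfs_guard : bexp := nlt cur (var aTotal).

Definition dfs_search : com :=
  Seq (NSet aPar (NLit 0) (var aTotal)) (While dfs_guard dfs_step).

End DfsProgram.

Definition dfs_cost : nat :=
  (5 * (bcost dfs_guard + max_cost dfs_step).+1 + 100)%N.

Section Dfs.
Variables (R : realType) (d : nat) (Es : seq (dtree R d)).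
Variables (x : 'rV[R]_d) (eps : R).
Implicit Types (s : state R) (y : 'rV[R]_d).

Definition in_box s y : Prop := forall j : 'I_d,
  [/\ x ord0 j - eps <= y ord0 j,
      x ord0 j - eps - 1 + rarr s rL j < y ord0 j &
      y ord0 j <= x ord0 j + eps - rarr s rH j].

Definition bad_correct s : Prop := narr s aBad 0 = 0%N <-> exists y, in_box s y.

Lemma ev_check s (t : 'I_d) :
  input Es x eps s -> narr s aFeat (narr s aCur 0) = t ->
  ev dfs_check s =
  if (x ord0 t - eps - 1 + rarr s rL t < x ord0 t + eps - rarr s rH t) &&
     (x ord0 t - eps <= x ord0 t + eps - rarr s rH t)
  then s else State (upd (narr s) aBad 0 1) (rarr s).
Proof.
by move=> [_ _ _ _ [hx he]] ht; rewrite /= ht hx he -ltNge.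
Qed.

(* Replacing coordinate t of a point of the old box by the new upper bound
   yields a point of the new box, provided the bounds for t are consistent. *)
Lemma shrink_box s s' (t : 'I_d) (C : R -> bool) :
  (forall j : 'I_d, j != t ->
     rarr s' rL j = rarr s rL j /\ rarr s' rH j = rarr s rH j) ->
  (forall v, (x ord0 t - eps - 1 + rarr s' rL t < v) &&
     (v <= x ord0 t + eps - rarr s' rH t) =
     [&& C v, x ord0 t - eps - 1 + rarr s rL t < v &
      v <= x ord0 t + eps - rarr s rH t]) ->
  bad_correct s ->
  narr s' aBad 0 =
    (if (x ord0 t - eps - 1 + rarr s' rL t < x ord0 t + eps - rarr s' rH t) &&
        (x ord0 t - eps <= x ord0 t + eps - rarr s' rH t)
     then narr s aBad 0 else 1%N) ->
  bad_correct s' /\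
  (forall y, in_box s' y <-> in_box s y /\ C (y ord0 t)).
Proof.
move=> hj ht bc bE.
have boxE y : in_box s' y <-> in_box s y /\ C (y ord0 t).
  split=> [h|[h c] j].
    have [h1 h2 h3] := h t.
    move: (ht (y ord0 t)); rewrite h2 h3 => /esym/and3P[c g2 g3].
    split=> // j; have [->|/hj[e1 e2]] := eqVneq j t; first by split.
    by have := h j; rewrite e1 e2.
  have [->|/hj[e1 e2]] := eqVneq j t; last by rewrite e1 e2; exact: h.
  have [h1 h2 h3] := h t; split=> //.
    by have := ht (y ord0 t); rewrite c h2 h3 => /andP[].
  by have := ht (y ord0 t); rewrite c h2 h3 => /andP[].
split=> //; rewrite /bad_correct bE; split.
  case: ifP => // /andP[h1 h2] /bc[y hy].
  pose v := x ord0 t + eps - rarr s' rH t.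
  exists (\row_j if j == t then v else y ord0 j); apply/boxE; split.
    move=> j; rewrite mxE; have [->|ne] := eqVneq j t; last exact: hy.
    by have := ht v; rewrite h1 lexx => /esym/and3P[].
  by rewrite mxE eqxx; have := ht v; rewrite h1 lexx => /esym/and3P[].
move=> [y hy]; have [h1 h2 h3] := hy t.
rewrite (lt_le_trans h2 h3) (le_trans h1 h3) /=.
by apply/bc; exists y; case/boxE: hy.
Qed.

Lemma ev_dfs_step s :
  ev dfs_step s =
  ev (if narr s aMode 0 == 0%N
      then (if narr s aKind (narr s aCur 0) == 0%N
            then dfs_enter_leaf else dfs_enter_node)
      else (if narr s aKind (narr s aCur 0) == 0%N then dfs_leave_leaf
            else if narr s aPhase (narr s aCur 0) == 0%N then dfs_leave_left
            else dfs_leave_right)) s.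
Proof.
rewrite /dfs_step ev_if /= leqn0; case: eqP => _; rewrite ev_if /= leqn0 //.
by case: eqP => _ //; rewrite ev_if /= leqn0.
Qed.

Lemma ev_raise s (t : 'I_d) a e v :
  narr s aFeat (narr s aCur 0) = t -> rval s e = v ->
  exists2 s', ev (If (rlt (RGet a (NGet aFeat (var aCur))) e)
                     (RSet a (NGet aFeat (var aCur)) e) Skip) s = s' &
    narr s' = narr s /\
    forall a' i, rarr s' a' i = if (a' == a) && (i == t)
      then (if rarr s a t < v then v else rarr s a t) else rarr s a' i.
Proof.
move=> ht hv; eexists; first by [].
rewrite ev_if /= ht hv -ltNge; case: ifP => h /=; split=> // a' i.
  by rewrite /upd /= ht hv.
by case: andP => // -[/eqP -> /eqP ->].
Qed.

Lemma dfs_descendP s b (t : 'I_d) a e v phase child bc (C : R -> bool) :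
  let m := if rarr s a t < v then v else rarr s a t in
  input Es x eps s -> narr s aCur 0 = b -> narr s aFeat b = t ->
  narr s child b = bc -> child \in [:: aLeft; aRight] -> a \in [:: rH; rL] ->
  rval s e = v ->
  (forall s', frame (Seq (RSet rSaved (NLit 0) (RNat (NLit 0)))
    (NSet aPhase (NLit 0) (NLit 0))) s s' -> rval s' e = rval s e) ->
  (forall w, (x ord0 t - eps - 1 + (if a == rL then m else rarr s rL t) < w) &&
     (w <= x ord0 t + eps - (if a == rH then m else rarr s rH t)) =
     [&& C w, x ord0 t - eps - 1 + rarr s rL t < w &
      w <= x ord0 t + eps - rarr s rH t]) ->
  bad_correct s ->
  let s' := ev (dfs_descend a e phase child) s in
  [/\ [/\ narr s' aCur 0 = bc, narr s' aMode 0 = 0%N & bad_correct s'],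
      (forall y, in_box s' y <-> in_box s y /\ C (y ord0 t)),
      (forall j : nat, (j == t) = false -> rarr s' a j = rarr s a j),
      [/\ rarr s' rSaved b = rarr s a t, narr s' aPhase b = phase
        & narr s' aPar bc = b] &
      (forall i : nat, (i == b) = false ->
          rarr s' rSaved i = rarr s rSaved i /\
          narr s' aPhase i = narr s aPhase i) /\
      (forall i : nat, (i == bc) = false -> narr s' aPar i = narr s aPar i)].
Proof.
move=> m inp hb ht hc child_in a_in hv he hC bcs s'.
rewrite /s' {s'} /dfs_descend ev_seq.
set s3 := ev _ s.
have F3 : frame (Seq (RSet rSaved (NLit 0) (RNat (NLit 0)))
    (NSet aPhase (NLit 0) (NLit 0))) s s3.
  by split=> k; rewrite /= ?orbF => /negbTE hk i; rewrite /upd hk.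
have n3 k i : narr s3 k i =
    if (k == aPhase) && (i == b) then phase else narr s k i.
  by rewrite /= /upd /= hb.
have r3 k i : rarr s3 k i =
    if (k == rSaved) && (i == b) then rarr s a t else rarr s k i.
  by rewrite /= /upd /= hb ht.
have i3 : input Es x eps s3 by apply: input_frame F3 _ inp.
have e3 : rval s3 e = v by rewrite he.
have fr3 : forall k i, k != rSaved -> rarr s3 k i = rarr s k i.
  by move=> k i /negbTE; rewrite r3 => ->.
have aS : a != rSaved by move: a_in; rewrite !inE => /orP[] /eqP ->.
have bc3 : bad_correct s3.
  by rewrite /bad_correct n3 /in_box; setoid_rewrite fr3.
have cur3 : narr s3 aCur 0 = b by rewrite n3.
have feat3 : narr s3 aFeat (narr s3 aCur 0) = t by rewrite cur3 n3.
move: s3 n3 r3 i3 e3 fr3 bc3 cur3 feat3 {F3} => s3 n3 r3 i3 e3 fr3 bc3 cur3 feat3.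
rewrite ev_seq; have [s4 -> [n4 r4]] := ev_raise a feat3 e3.
have i4 : input Es x eps s4.
  apply: (@input_frame _ _ _ _ _ (RSet a (NLit 0) (RNat (NLit 0)))) i3.
    by split=> k /= => [_|/negbTE hk] i; rewrite ?n4 ?r4 ?hk.
  by move: a_in; rewrite !inE => /orP[] /eqP ->.
have n4' k i : narr s4 k i = narr s3 k i by rewrite n4.
rewrite ev_seq (@ev_check s4 t i4); last by rewrite n4.
set s5 := if _ then _ else _.
have n5 k i : k != aBad -> narr s5 k i = narr s3 k i.
  by move=> /negbTE hk; rewrite /s5; case: ifP => _ //=; rewrite /upd ?hk n4'.
have r5 k i : rarr s5 k i = rarr s4 k i by rewrite /s5; case: ifP.
have L3 j : rarr s3 rL j = rarr s rL j by rewrite fr3.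
have H3 j : rarr s3 rH j = rarr s rH j by rewrite fr3.
have a3 j : rarr s3 a j = rarr s a j by rewrite fr3.
have [|w|||bc5 box5] := @shrink_box s3 s5 t C.
- by move=> j; rewrite -val_eqE /= => /negbTE hj; rewrite !r5 !r4 hj !andbF.
- by rewrite !r5 !r4 !eqxx !andbT L3 H3 a3 -hC !(eq_sym a).
- exact: bc3.
- by rewrite /s5 !r5; case: ifP => _ /=; rewrite ?n4'.
have box35 y : in_box s3 y <-> in_box s y.
  by split=> h j; move: (h j); rewrite !fr3.
move: s5 n5 r5 bc5 box5 => s5 n5 r5 bc5 box5.
have [cB cM cP cQ] : [/\ child != aBad, (child == aMode) = false,
    (child == aPar) = false & (child == aPhase) = false].
  by move: child_in; rewrite !inE => /orP[] /eqP ->.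
have child5 : narr s5 child b = bc by rewrite n5 // n3 cQ.
have cur5 : narr s5 aCur 0 = b by rewrite n5 ?cur3.
set s6 := ev _ s5.
have n6 k i : narr s6 k i =
    if (k == aCur) && (i == 0)%N then bc
    else if (k == aPar) && (i == bc) then b
    else if (k == aMode) && (i == 0)%N then 0%N else narr s5 k i.
  by rewrite /= /upd /= !cM !cP /= cur5 child5.
have r6 k i : rarr s6 k i = rarr s5 k i by [].
move: s6 n6 r6 => s6 n6 r6.
have box6 y : in_box s6 y <-> in_box s5 y.
  by split=> h j; move: (h j); rewrite !r6.
split.
- split; rewrite ?n6 //.
  by rewrite /bad_correct n6 /=; setoid_rewrite box6.
- by move=> y; rewrite box6 -box35 -box5.
- by move=> j hj; rewrite r6 r5 r4 hj andbF.
- split; rewrite ?n6 ?r6 /= ?eqxx // ?n5 ?n3 ?r5 ?r4 ?eqxx ?r3 ?eqxx //.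
  by rewrite eq_sym (negbTE aS).
- split=> i hi; last by rewrite n6 /= hi n5 // n3.
  rewrite r6 n6 r5 r4 n5 // n3 r3 eq_sym (negbTE aS) /= hi.
  by rewrite r3 /= hi.
Qed.

Definition unwound s s' :=
  [/\ (forall j, rarr s' rH j = rarr s rH j),
      (forall j, rarr s' rL j = rarr s rL j), narr s' aBad 0 = narr s aBad 0,
      rarr s' rSum 0 = rarr s rSum 0 & narr s' aLev 0 = narr s aLev 0].

Definition stack_kept b s s' :=
  (forall i, (i < b)%N -> [/\ rarr s' rSaved i = rarr s rSaved i,
     narr s' aSavedBad i = narr s aSavedBad i &
     narr s' aPhase i = narr s aPhase i]) /\
  (forall i, (i <= b)%N -> narr s' aPar i = narr s aPar i).

Lemma tighten_upper (c h v w : R) :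
  (w <= c - (if h < c - v then c - v else h)) = (w <= v) && (w <= c - h).
Proof.
by case: ltrP => hv; (apply/idP/andP => [a|[a b]]; [split|]); lra.
Qed.

Lemma tighten_lower (c l v w : R) :
  (c + (if l < v - c then v - c else l) < w) = (v < w) && (c + l < w).
Proof.
by case: (ltrP l) => hv; (apply/idP/andP => [a|[a b]]; [split|]); lra.
Qed.

Lemma dfs_enterP s b (t : 'I_d) bl eta :
  input Es x eps s -> narr s aCur 0 = b -> narr s aFeat b = t ->
  narr s aLeft b = bl -> rarr s rVal b = eta -> bad_correct s ->
  let s' := ev dfs_enter_node s in
  [/\ [/\ narr s' aCur 0 = bl, narr s' aMode 0 = 0%N & bad_correct s'],
      (forall y, in_box s' y <-> in_box s y /\ y ord0 t <= eta),
      (forall j : nat, (j == t) = false -> rarr s' rH j = rarr s rH j),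
      [/\ rarr s' rSaved b = rarr s rH t, narr s' aSavedBad b = narr s aBad 0,
          narr s' aPhase b = 0%N & narr s' aPar bl = b] &
      (forall i : nat, (i == b) = false ->
          [/\ rarr s' rSaved i = rarr s rSaved i,
              narr s' aSavedBad i = narr s aSavedBad i &
              narr s' aPhase i = narr s aPhase i]) /\
      (forall i : nat, (i == bl) = false -> narr s' aPar i = narr s aPar i)].
Proof.
move=> inp hb ht hl hv bc s'.
have [_ _ _ _ [hx he]] := inp.
rewrite /s' {s'} /dfs_enter_node ev_seq.
set s1 := ev _ s.
have n1 k i : narr s1 k i =
    if (k == aSavedBad) && (i == b) then narr s aBad 0 else narr s k i.
  by rewrite /= /upd /= hb.
have r1 k i : rarr s1 k i = rarr s k i by [].
have i1 : input Es x eps s1 by apply: input_frame (ev_frame _ _) _ inp.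
have bc1 : bad_correct s1 by [].
move: s1 n1 r1 i1 bc1 => s1 n1 r1 i1 bc1.
have [||||||s2 fr2|w||q1 q2 q3 q4 [q5 q6]] := @dfs_descendP s1 b t rH
  (RSub (RAdd (RGet rX (NGet aFeat (var aCur))) (rvar rEps)) (RGet rVal (var aCur)))
  (x ord0 t + eps - eta) 0%N aLeft bl (fun w => w <= eta) i1.
- by rewrite n1.
- by rewrite n1.
- by rewrite n1.
- by [].
- by [].
- by rewrite /= !n1 /= !r1 hb ht hx he hv.
- by case: fr2 => n2 r2 /=; rewrite !n2 // !r2.
- by rewrite /= tighten_upper andbCA.
- exact: bc1.
have F := ev_frame s1 (isT : loop_free (dfs_descend rH
  (RSub (RAdd (RGet rX (NGet aFeat (var aCur))) (rvar rEps)) (RGet rVal (var aCur)))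
  0%N aLeft)).
set s2 := ev _ s1 in q1 q2 q3 q4 q5 q6 F *; move: s2 q1 q2 q3 q4 q5 q6 F.
move=> s2 q1 q2 q3 [q41 q42 q43] q5 q6 [nF rF]; split=> //.
- by move=> y; rewrite q2; split=> -[g ?]; split=> // j; move: (g j); rewrite !r1.
- by move=> j hj; rewrite q3.
- by split=> //; rewrite ?q41 ?nF // n1 !eqxx.
- split=> i hi; last by rewrite q6 // n1.
  by have [-> ->] := q5 _ hi; rewrite n1 /= nF // n1 hi.
Qed.

Lemma dfs_leave_leftP s b (t : 'I_d) br eta bd :
  input Es x eps s -> narr s aCur 0 = b -> narr s aFeat b = t ->
  narr s aRight b = br -> rarr s rVal b = eta -> 
  narr s aSavedBad b = bd ->
  let h j := if j == t :> nat then rarr s rSaved b else rarr s rH j in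
  let box y := forall j : 'I_d, [/\ x ord0 j - eps <= y ord0 j,
      x ord0 j - eps - 1 + rarr s rL j < y ord0 j &
      y ord0 j <= x ord0 j + eps - h j] in
  (bd = 0%N <-> exists y, box y) ->
  let s' := ev dfs_leave_left s in
  [/\ [/\ narr s' aCur 0 = br, narr s' aMode 0 = 0%N & bad_correct s'],
      (forall y, in_box s' y <-> box y /\ eta < y ord0 t),
      (forall j, rarr s' rH j = h j) /\
      (forall j : nat, (j == t) = false -> rarr s' rL j = rarr s rL j),
      [/\ rarr s' rSaved b = rarr s rL t, narr s' aSavedBad b = bd,
          narr s' aPhase b = 1%N & narr s' aPar br = b] &
      (forall i : nat, (i == b) = false ->
          [/\ rarr s' rSaved i = rarr s rSaved i,
              narr s' aSavedBad i = narr s aSavedBad i &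
              narr s' aPhase i = narr s aPhase i]) /\
      (forall i : nat, (i == br) = false -> narr s' aPar i = narr s aPar i)].
Proof.
move=> inp hb ht hr hv hbd h box bc s'.
have [_ _ _ _ [hx he]] := inp.
rewrite /s' {s'} /dfs_leave_left ev_seq.
set s1 := ev _ s.
have n1 k i : narr s1 k i = if (k == aBad) && (i == 0)%N then bd else narr s k i.
  by rewrite /= /upd /= hb hbd.
have r1 k i : rarr s1 k i =
    if (k == rH) && (i == t) then rarr s rSaved b else rarr s k i.
  by rewrite /= /upd /= hb ht.
have i1 : input Es x eps s1 by apply: input_frame (ev_frame _ _) _ inp.
have box1 y : in_box s1 y <-> box y.
  by split=> g j; move: (g j); rewrite !r1 /= /h.
have bc1 : bad_correct s1.
  by rewrite /bad_correct n1 /=; setoid_rewrite box1.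
move: s1 n1 r1 i1 box1 bc1 => s1 n1 r1 i1 box1 bc1.
pose e := RSub (RGet rVal (var aCur))
  (RSub (RSub (RGet rX (NGet aFeat (var aCur))) (rvar rEps)) (RNat (NLit 1))).
have [||||||s2 fr2|w||q1 q2 q3 q4 [q5 q6]] := @dfs_descendP s1 b t rL e
  (eta - (x ord0 t - eps - 1)) 1%N aRight br (fun w => eta < w) i1.
- by rewrite n1.
- by rewrite n1.
- by rewrite n1.
- by [].
- by [].
- by rewrite /= !n1 /= !r1 /= hb ht hx he hv.
- by case: fr2 => n2 r2 /=; rewrite !n2 // !r2.
- by rewrite /= tighten_lower andbA.
- exact: bc1.
have F := ev_frame s1 (isT : loop_free (dfs_descend rL e 1%N aRight)).
set s2 := ev _ s1 in q1 q2 q3 q4 q5 q6 F; rewrite -/s2.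
move: s2 q1 q2 q3 q4 q5 q6 F.
move=> s2 q1 q2 q3 [q41 q42 q43] q5 q6 [nF rF]; split=> //.
- by move=> y; rewrite q2 box1.
- split=> j; first by rewrite rF // r1.
  by move=> hj; rewrite q3 // r1.
- by split=> //; rewrite ?nF // ?n1 // q41 r1.
- split=> i hi; last by rewrite q6 // n1.
  by have [-> ->] := q5 _ hi; rewrite n1 /= nF // n1 r1.
Qed.

Definition rest_score l y : R := \sum_(T <- drop l.+1 Es) predict T y.

Definition dfs_done s l (T : dtree R d) b s' : Prop :=
  [/\ narr s' aCur 0 = narr s aPar b /\ narr s' aMode 0 = 1%N,
      unwound s s', stack_kept b s s' &
      (narr s' aOut 0 = 1%N <-> narr s aOut 0 = 1%N \/
        exists y, in_box s y /\
          0 < rarr s rSum 0 + predict T y + rest_score l y)].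

Lemma dfs_guardE s b (T : dtree R d) k :
  (k <= size Es)%N -> input_sized Es x eps s ->
  (b + nnodes T <= offset Es k)%N -> narr s aCur 0 = b -> bval s dfs_guard.
Proof.
move=> hk [_ _ h7] hb hc; rewrite /= hc h7.
by apply: leq_trans (leq_offset Es hk); have := nnodes_gt0 T; lia.
Qed.

Lemma dfs_enter_last_leaf s b v :
  narr s aCur 0 = b -> rarr s rVal b = v -> narr s 0 1 = size Es ->
  (size Es <= (narr s aLev 0).+1)%N ->
  let s' := ev dfs_enter_leaf s in
  (forall k i, narr s' k i =
     if (k == aMode) && (i == 0)%N then 1%N
     else if [&& k == aOut, i == 0%N, narr s aBad 0 == 0%N &
                 0 < rarr s rSum 0 + v] then 1%N
     else if (k == aLev) && (i == 0)%N then (narr s aLev 0).+1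
     else narr s k i) /\
  (forall k i, rarr s' k i =
     if (k == rSum) && (i == 0)%N then rarr s rSum 0 + v else rarr s k i).
Proof.
move=> hc hv hK hlev s'; rewrite /s' {s'} /dfs_enter_leaf !ev_seq.
set s2 := ev _ (ev _ s).
have n2 k i : narr s2 k i =
    if (k == aLev) && (i == 0)%N then (narr s aLev 0).+1 else narr s k i.
  by rewrite /= /upd /= addn1.
have r2 k i : rarr s2 k i =
    if (k == rSum) && (i == 0)%N then rarr s rSum 0 + v else rarr s k i.
  by rewrite /= /upd /= hc hv.
move: s2 n2 r2 => s2 n2 r2; rewrite ev_if.
have -> : bval s2 (BNle numE (var aLev)) by rewrite /= !n2 /= hK.
rewrite ev_seq ev_if /= !n2 !r2 /= leqn0 -ltNge.
case: ifP => h /=; split=> k i //; rewrite /upd.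
  by rewrite n2 andbT.
by rewrite n2 !andbF.
Qed.

Lemma dfs_enter_inner_leaf s b v :
  narr s aCur 0 = b -> rarr s rVal b = v -> narr s 0 1 = size Es ->
  ((narr s aLev 0).+1 < size Es)%N ->
  narr s aRoot (narr s aLev 0).+1 = offset Es (narr s aLev 0).+1 ->
  let s' := ev dfs_enter_leaf s in
  (forall k i, narr s' k i =
     if (k == aCur) && (i == 0)%N then offset Es (narr s aLev 0).+1
     else if (k == aPar) && (i == offset Es (narr s aLev 0).+1) then b
     else if (k == aLev) && (i == 0)%N then (narr s aLev 0).+1
     else narr s k i) /\
  (forall k i, rarr s' k i =
     if (k == rSum) && (i == 0)%N then rarr s rSum 0 + v else rarr s k i).
Proof.
move=> hc hv hK hlev hr s'; rewrite /s' {s'} /dfs_enter_leaf !ev_seq.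
set s2 := ev _ (ev _ s).
have n2 k i : narr s2 k i =
    if (k == aLev) && (i == 0)%N then (narr s aLev 0).+1 else narr s k i.
  by rewrite /= /upd /= addn1.
have r2 k i : rarr s2 k i =
    if (k == rSum) && (i == 0)%N then rarr s rSum 0 + v else rarr s k i.
  by rewrite /= /upd /= hc hv.
move: s2 n2 r2 => s2 n2 r2; rewrite ev_if.
have -> : bval s2 (BNle numE (var aLev)) = false.
  by rewrite /= !n2 /= hK leqNgt hlev.
by rewrite ev_seq /=; split=> k i //; rewrite /upd /= !n2 /= ?n2 /= ?hc ?hr.
Qed.

Lemma dfs_leave_leafP s b v :
  narr s aCur 0 = b -> rarr s rVal b = v ->
  let s' := ev dfs_leave_leaf s in
  (forall k i, narr s' k i =
     if (k == aCur) && (i == 0)%N then narr s aPar b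
     else if (k == aLev) && (i == 0)%N then (narr s aLev 0).-1
     else narr s k i) /\
  (forall k i, rarr s' k i =
     if (k == rSum) && (i == 0)%N then rarr s rSum 0 - v else rarr s k i).
Proof.
by move=> hc hv s'; split=> k i; rewrite /s' /= /upd /= ?subn1 hc ?hv.
Qed.

Lemma dfs_leave_rightP s b (t : nat) :
  narr s aCur 0 = b -> narr s aFeat b = t ->
  let s' := ev dfs_leave_right s in
  (forall k i, narr s' k i =
     if (k == aCur) && (i == 0)%N then narr s aPar b
     else if (k == aBad) && (i == 0)%N then narr s aSavedBad b
     else narr s k i) /\
  (forall k i, rarr s' k i =
     if (k == rL) && (i == t) then rarr s rSaved b else rarr s k i).
Proof. by move=> hc ht s'; split=> k i; rewrite /s' /= /upd /= hc ?ht. Qed.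

Lemma dfs_subtree l (T : dtree R d) b s :
  (l < size Es)%N -> input_sized Es x eps s -> stored s b T ->
  (b + nnodes T <= offset Es l.+1)%N ->
  narr s aCur 0 = b -> narr s aMode 0 = 0%N -> narr s aLev 0 = l ->
  bad_correct s ->
  iterates dfs_guard dfs_step s (dfs_done s l T b)
    (nleaves T * (5 * (visits (drop l.+1 Es)).+1) - 3).
Proof.
have [n] := ubnPleq (size Es - l); elim: n l T b s => [|n IHn] l T b s hn hl.
  by lia.
elim: T b s => [v|t eta L IHL Rt IHR] b s inp st hbT hc hm hlev bc.
  have g := dfs_guardE hl inp hbT hc.
  have [k2 v2] := st.
  have s1E : ev dfs_step s = ev dfs_enter_leaf s by rewrite ev_dfs_step hm hc k2.
  have [[_ nK hroot hst _] _ _] := inp.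
  have inp1 : input_sized Es x eps (ev dfs_step s).
    by apply: input_sized_frame (ev_frame _ _) _ inp.
  have [last|inner] := leqP (size Es) l.+1.
  - have e3 : (1 * (5 * (visits (drop l.+1 Es)).+1) - 3 =
       (5 * visits (drop l.+1 Es)).+2)%N by lia.
    rewrite /= e3; apply: iterates_step => //; rewrite s1E in inp1 *.
    rewrite -hlev in last.
    have [n1 r1] := dfs_enter_last_leaf hc v2 nK last.
    move: (ev _ s) inp1 n1 r1 => s1 inp1 n1 r1.
    apply: iterates_step.
      by apply: dfs_guardE hl inp1 hbT _; rewrite n1 /=.
    apply: iterates0.
    have -> : ev dfs_step s1 = ev dfs_leave_leaf s1.
      by rewrite ev_dfs_step !n1 /= hc k2.
    have [||n2 r2] := @dfs_leave_leafP s1 b v; rewrite ?n1 ?r1 //.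
    split.
    + by rewrite !n2 !n1.
    + split; [move=> j|move=> j| | |]; rewrite ?r2 ?n2 ?r1 ?n1 //=.
      by rewrite addrK.
    + by split=> i hi; rewrite ?r2 !n2 ?r1 !n1.
    + have rest0 y : rest_score l y = 0.
        by rewrite /rest_score drop_oversize -?hlev // big_nil.
      rewrite n2 /= n1 /=; split.
        case: ifP => [/andP[/eqP/bc[y hy] hp] _|_ ->]; last by left.
        by right; exists y; rewrite rest0 addr0.
      move=> [->|[y []]]; first by rewrite if_same.
      rewrite rest0 addr0 => hy ->.
      by have /bc -> : exists y, in_box s y by exists y.
  have dE : drop l.+1 Es = tree Es l.+1 :: drop l.+2 Es by rewrite (drop_nth (Leaf 0)).
  apply: (@iterates_weaken _ _ _ _ (dfs_done s l (Leaf v) b) _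
     (1 + (nleaves (tree Es l.+1) * (5 * (visits (drop l.+2 Es)).+1) - 3) + 1)%N).
  2: by [].
  2: by rewrite dE /=; have := nleaves_gt0 (tree Es l.+1); nia.
  rewrite -addnA add1n; apply: iterates_step => //; rewrite s1E in inp1 *.
  rewrite -hlev in inner hroot.
  have [n1 r1] := dfs_enter_inner_leaf hc v2 nK inner (hroot _ inner).
  rewrite hlev in inner n1 hroot.
  have F1 := ev_frame s (isT : loop_free dfs_enter_leaf).
  move: (ev _ s) inp1 n1 r1 F1 => s1 inp1 n1 r1 F1.
  have box1 y : in_box s1 y <-> in_box s y.
    by split=> h j; move: (h j); rewrite !r1.
  apply: iterates_bind.
    apply: iterates_frame; first by [].
    apply: (IHn l.+1 (tree Es l.+1) (offset Es l.+1)) => //; rewrite ?n1 //.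
    + by lia.
    + by case: inp1 => -[_ _ _ h _] _ _; apply: h.
    + by rewrite -offsetS.
    + by rewrite /bad_correct n1 /=; setoid_rewrite box1.
  move=> s2 [F2 [[hc2 hm2] u2 [k2a k2b] out2]].
  have inp2 := input_sized_frame F2 isT inp1.
  have [kd2 vl2] := stored_frame F2 isT (stored_frame F1 isT st).
  have cur2 : narr s2 aCur 0 = b by rewrite hc2 n1 /= eqxx.
  apply: iterates_step; first exact: dfs_guardE hl inp2 hbT cur2.
  apply: iterates0.
  have -> : ev dfs_step s2 = ev dfs_leave_leaf s2.
    by rewrite ev_dfs_step hm2 cur2 kd2.
  have [n3 r3] := dfs_leave_leafP cur2 vl2.
  move: (ev _ s2) n3 r3 => s3 n3 r3.
  have [u2H u2L u2B u2S u2V] := u2.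
  have lt_b : (b < offset Es l.+1)%N by move: hbT; rewrite /= addn1.
  split.
  - rewrite !n3 /= hm2 k2b ?n1 /= 1?ltnW //.
    by rewrite ltn_eqF.
  - split; [move=> j|move=> j| | |]; rewrite ?r3 ?n3 /=;
      rewrite ?u2H ?u2L ?u2B ?u2S ?u2V ?r1 ?n1 //=.
    by rewrite addrK.
  - split=> i hi.
      have [|e1 e2 e3] := k2a i; first by apply: ltn_trans lt_b.
      by rewrite r3 !n3 /= e1 e2 e3 r1 !n1.
    rewrite n3 /= k2b; last by apply: leq_trans (ltnW lt_b).
    by rewrite n1 /= ltn_eqF // (leq_ltn_trans hi).
  - rewrite n3 /= out2 n1 /= r1 /=; split.
      case=> [|[y [/box1 hy hp]]]; first by left.
      right; exists y; split=> //; move: hp.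
      by rewrite {2}/rest_score dE big_cons addrA.
    case=> [|[y [/box1 hy hp]]]; first by left.
    right; exists y; split=> //; move: hp.
    by rewrite {1}/rest_score dE big_cons addrA.
have g := dfs_guardE hl inp hbT hc.
have [[k2 f3 l4 r5 v0] [stL stR]] := st.
apply: (@iterates_weaken _ _ _ _ (dfs_done s l (Node t eta L Rt) b) _
  (1 + (nleaves L * (5 * (visits (drop l.+1 Es)).+1) - 3) +
   (1 + (nleaves Rt * (5 * (visits (drop l.+1 Es)).+1) - 3 + 1)))%N).
2: by [].
2: by rewrite /=; have := nleaves_gt0 L; have := nleaves_gt0 Rt; nia.
rewrite -addnA add1n; apply: iterates_step => //.
have F1 := ev_frame s (isT : loop_free dfs_step).
have -> : ev dfs_step s = ev dfs_enter_node s by rewrite ev_dfs_step hm hc k2.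
have inp1 : input_sized Es x eps (ev dfs_enter_node s).
  by apply: input_sized_frame (ev_frame _ _) _ inp.
have {}F1 := ev_frame s (isT : loop_free dfs_enter_node).
have [inp0 _ _] := inp.
have [[c1 m1 bc1] box1 H1 [sv1 sb1 ph1 pr1] [oth1 par1]] :=
  dfs_enterP inp0 hc f3 l4 v0 bc.
move: (ev _ s) F1 inp1 c1 m1 bc1 box1 H1 sv1 sb1 ph1 pr1 oth1 par1 =>
  s1 [F1n F1r] inp1 c1 m1 bc1 box1 H1 sv1 sb1 ph1 pr1 oth1 par1.
apply: iterates_bind.
  apply: iterates_frame; first by [].
  apply: (IHL b.+1) => //.
  - by apply: stored_frame stL; first by split; [exact: F1n | exact: F1r].
  - by move: hbT => /=; lia.
  - by rewrite F1n.
move=> s2 [F2 [[c2 m2] u2 [k2a k2b] out2]].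
have inp2 := input_sized_frame F2 isT inp1.
have cur2 : narr s2 aCur 0 = b by rewrite c2.
have st2 : stored s2 b (Node t eta L Rt).
  by apply: stored_frame F2 _ (stored_frame (conj F1n F1r) _ st).
rewrite add1n; apply: iterates_step; first exact: dfs_guardE hl inp2 hbT cur2.
have [sv2 sb2 ph2] := k2a b (ltnSn b).
have [[kd2 ft2 _ rt2 vl2] [_ stR2]] := st2.
have -> : ev dfs_step s2 = ev dfs_leave_left s2.
  by rewrite ev_dfs_step m2 cur2 kd2 ph2 ph1.
have inp3 : input_sized Es x eps (ev dfs_leave_left s2).
  by apply: input_sized_frame (ev_frame _ _) _ inp2.
have F3 := ev_frame s2 (isT : loop_free dfs_leave_left).
have [inp20 _ _] := inp2.
have [u2H u2L u2B u2S u2V] := u2.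
have hE j : (if j == t :> nat then rarr s2 rSaved b else rarr s2 rH j) = rarr s rH j.
  rewrite sv2 sv1 u2H; case: eqP => [->//|/eqP/negbTE]; exact: H1.
have LE j : rarr s2 rL j = rarr s rL j by rewrite u2L F1r.
have boxE y : (forall j : 'I_d, [/\ x ord0 j - eps <= y ord0 j,
      x ord0 j - eps - 1 + rarr s2 rL j < y ord0 j &
      y ord0 j <= x ord0 j + eps -
        (if j == t :> nat then rarr s2 rSaved b else rarr s2 rH j)]) <-> in_box s y.
  by split=> h j; move: (h j); rewrite hE LE.
have [|[c3 m3 bc3] box3 [H3 L3] [sv3 sb3 ph3 pr3] [oth3 par3]] :=
  dfs_leave_leftP inp20 cur2 ft2 rt2 vl2 sb2.
  by rewrite sb1; setoid_rewrite boxE.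
have stR3 := stored_frame F3 isT stR2.
have st3 := stored_frame F3 isT st2.
have {}box3 y : in_box (ev dfs_leave_left s2) y <-> in_box s y /\ eta < y ord0 t.
  by rewrite box3 boxE.
have {}H3 j : rarr (ev dfs_leave_left s2) rH j = rarr s rH j by rewrite H3 hE.
move: (ev _ s2) F3 inp3 c3 m3 bc3 box3 H3 L3 sv3 sb3 ph3 pr3 oth3 par3 stR3 st3 =>
  s3 [F3n F3r] inp3 c3 m3 bc3 box3 H3 L3 sv3 sb3 ph3 pr3 oth3 par3 stR3 st3.
have S3 : rarr s3 rSum 0 = rarr s rSum 0 by rewrite F3r // u2S F1r.
have V3 : narr s3 aLev 0 = l by rewrite F3n // u2V F1n.
apply: iterates_bind.
  apply: iterates_frame; first by [].
  apply: (IHR (b.+1 + nnodes L)%N) => //.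
  by move: hbT => /=; lia.
move=> s4 [F4 [[c4 m4] u4 [k4a k4b] out4]].
have inp4 := input_sized_frame F4 isT inp3.
have cur4 : narr s4 aCur 0 = b by rewrite c4.
have [[kd4 ft4 _ _ _] _] := stored_frame F4 isT st3.
apply: iterates_step; first exact: dfs_guardE hl inp4 hbT cur4.
apply: iterates0.
have [|sv4 sb4 ph4] := k4a b; first by lia.
have -> : ev dfs_step s4 = ev dfs_leave_right s4.
  by rewrite ev_dfs_step m4 cur4 kd4 ph4 ph3.
have [n5 r5'] := dfs_leave_rightP cur4 ft4.
move: (ev _ s4) n5 r5' => s5 n5 r5'.
have [u4H u4L u4B u4S u4V] := u4.
have parE i : (i <= b)%N -> narr s4 aPar i = narr s aPar i.
  move=> hi; rewrite k4b; last by lia.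
  rewrite par3; last by lia.
  by rewrite k2b ?par1 //; lia.
split.
- by rewrite !n5 /= parE.
- split; [move=> j|move=> j| | |]; rewrite ?r5' ?n5 /= ?eqxx.
  + by rewrite u4H H3.
  + case: eqP => [->|/eqP/negbTE hj]; first by rewrite sv4 sv3 LE.
    by rewrite u4L L3 // LE.
  + by rewrite sb4 sb3 sb1.
  + by rewrite u4S S3.
  + by rewrite u4V V3.
- split=> i hi; last by rewrite n5 /= parE.
  have [|e1 e2 e3] := k4a i; first by lia.
  have [|g1 g2 g3] := oth3 i; first by rewrite ltn_eqF.
  have [|h1 h2 h3] := k2a i; first by rewrite ltnW.
  have [|f1 f2 f3'] := oth1 i; first by rewrite ltn_eqF.
  by rewrite r5' !n5 /= e1 e2 e3 g1 g2 g3 h1 h2 h3 f1 f2 f3'.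
rewrite n5 /= out4 F3n // out2 F1n // F1r //.
split=> [[[->|[y [/box1[hy hv] hp]]]|[y [/box3[hy hv] hp]]]|[->|[y [hy hp]]]].
- by left.
- by right; exists y; rewrite hv.
- by right; exists y; rewrite leNgt hv /= -S3.
- by left; left.
have [hv|hv] := lerP (y ord0 t) eta.
  by left; right; exists y; split; [apply/box1 | move: hp; rewrite hv].
right; exists y; split; first exact/box3.
by move: hp; rewrite leNgt hv /= S3.
Qed.

Lemma dfs_searchP s :
  (0 < size Es)%N -> 0 <= eps -> input_sized Es x eps s -> fresh s ->
  term dfs_search s
    (fun s' => narr s' aOut 0 = 1%N <->
       exists y, in_ball x eps y /\ 0 < total_score Es y) (dfs_cost * visits Es).
Proof.
move=> Es0 eps0 inp [fn fr].
have EsE : Es = tree Es 0 :: drop 1 Es by rewrite -{1}(drop0 Es) (drop_nth (Leaf 0)).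
have vE : (nleaves (tree Es 0) * (5 * (visits (drop 1 Es)).+1) - 3 <=
    5 * visits Es)%N.
  by rewrite [in leqRHS]EsE /=; nia.
apply: term_cost.
  apply: term_seq.
    apply: (term_ev (Q := eq (ev _ s))) => //.
  move=> s1 f1 s1E.
  have inp1 := input_sized_frame f1 isT inp.
  have n1 k i : narr s1 k i =
      if (k == aPar) && (i == 0)%N then offset Es (size Es) else narr s k i.
    by case: inp => _ _ h7; rewrite -s1E /= /upd /= h7.
  have r1 k i : rarr s1 k i = rarr s k i by rewrite -s1E.
  apply: term_iterates; first by [].
  have box1 y : in_box s1 y <-> in_ball x eps y.
    split=> h j; have := h j; rewrite !r1 !fr // ?subr0 ?addr0.
      by move=> [h1 _ h3]; rewrite h1.
    by move=> /andP[h1 h3]; split=> //; lra.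
  apply: iterates_weaken.
  - apply: iterates_frame; first by [].
    apply: (@dfs_subtree 0 (tree Es 0) 0%N s1) => //; rewrite ?n1 ?fn //.
    + by case: inp1 => -[_ _ _ h _] _ _; have := h 0%N Es0; rewrite offset0.
    + by rewrite offsetS // offset0.
    + split=> [_|_]; last by rewrite n1 fn.
      exists x; apply/(box1 x) => j; apply/andP; split; lra.
  - move=> s2 [F2 [[c2 _] _ _ out2]].
    have [_ _ h7] := input_sized_frame F2 isT inp1.
    split; first by rewrite /= c2 n1 h7 addn1 ltnn.
    have tsE y : total_score Es y = predict (tree Es 0) y + rest_score 0 y.
      by rewrite /total_score {1}EsE big_cons.
    rewrite out2 n1 /= fn // r1 fr //; split=> [[//|[y [/box1 hy hp]]]|].
      by exists y; rewrite tsE -[predict _ _]add0r.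
    by move=> [y [hy hp]]; right; exists y; rewrite add0r -tsE box1.
  - exact: vE.
rewrite /while_cost /dfs_cost.
set c := (_ + max_cost dfs_step)%N; rewrite [max_cost _]/=.
have : (bcost dfs_guard < 50)%N by [].
by have := size_visits Es; nia.
Qed.

End Dfs.

(** * Enumeration of lines of candidates *)

Notation aRank := 17%N (only parsing).
Notation aCandRank := 18%N (only parsing).
Notation aGood := 19%N (only parsing).
Notation aDigit := 20%N (only parsing).
Notation aLo := 21%N (only parsing).
Notation aHi := 22%N (only parsing).
Notation aPos := 23%N (only parsing).
Notation aSub := 24%N (only parsing).
Notation aOdo := 25%N (only parsing).
Notation aSplit := 26%N (only parsing).
Notation rCand := 10%N (only parsing).
Notation rDelta := 11%N (only parsing).
Notation rAcc := 12%N (only parsing).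
Notation rCoord := 13%N (only parsing).

Section GridProgram.

Let pos := var aPos.
Let sub := var aSub.
Let odo := var aOdo.
Let feat := NGet aFeat pos.
Let digit := NGet aDigit feat.

Definition is_cand (j q : nexp) : bexp :=
  BAnd (BNle (NLit 1) (NGet aKind q))
    (BAnd (BRle (RSub (RGet rX j) (rvar rEps)) (RGet rVal q))
          (BRle (RGet rVal q) (RAdd (RGet rX j) (rvar rEps)))).

Definition set_cand (a : nat) (i j q : nexp) : com :=
  If (is_cand j q) (RSet a i (RGet rVal q))
                   (RSet a i (RAdd (RGet rX j) (rvar rEps))).

Definition rank_step : com :=
  Seq (If (rlt (RGet rVal sub) (RGet rVal pos))
        (NSet aRank pos (NAdd (NGet aRank pos) (NLit 1))) Skip)
  (Seq (If (rlt (RGet rVal sub) (RGet rCand pos))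
        (NSet aCandRank pos (NAdd (NGet aCandRank pos) (NLit 1))) Skip)
       (incr aSub)).

Definition ranks : com :=
  Seq (setn aPos (NLit 0))
  (While (nlt pos (var aTotal))
    (Seq (Seq (set_cand rCand pos (NLit 0) pos) (setn aSub (NLit 0)))
    (Seq (While (nlt sub (var aTotal)) rank_step)
         (Seq (NSet aGood (NGet aCandRank pos) (NLit 1)) (incr aPos))))).

Definition init_roots : com :=
  Seq (setn aSub (NLit 0))
  (While (nlt sub numE)
    (Seq (NSet aLo (NGet aRoot sub) (NLit 0))
    (Seq (NSet aHi (NGet aRoot sub) (NAdd (var aTotal) (NLit 1)))
         (incr aSub)))).

Definition leaf_step : com :=
  If (nlt (NGet aLo pos) (NGet aHi pos))
    (Seq (RSet rDelta (NGet aLo pos)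
            (RAdd (RGet rDelta (NGet aLo pos)) (RGet rVal pos)))
         (RSet rDelta (NGet aHi pos)
            (RSub (RGet rDelta (NGet aHi pos)) (RGet rVal pos))))
    Skip.

(* The candidates whose rank is less than the split value go left. *)
Definition set_split : com :=
  If (BNle feat (NLit 0))
    (setn aSplit (NAdd (NGet aRank pos) (NLit 1)))
    (Seq (set_cand rCoord (NLit 0) feat digit)
      (If (BRle (rvar rCoord) (RGet rVal pos))
        (setn aSplit (NAdd (var aTotal) (NLit 1)))
        (setn aSplit (NLit 0)))).

(* With truncated subtraction, a - (a - b) is the minimum of a and b, and
   a + (b - a) is their maximum. *)
Definition node_step : com :=
  Seq set_split
  (Seq (NSet aLo (NGet aLeft pos) (NGet aLo pos))
  (Seq (NSet aHi (NGet aLeft pos)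
         (NSub (NGet aHi pos) (NSub (NGet aHi pos) (var aSplit))))
  (Seq (NSet aLo (NGet aRight pos)
         (NAdd (NGet aLo pos) (NSub (var aSplit) (NGet aLo pos))))
       (NSet aHi (NGet aRight pos) (NGet aHi pos))))).

Definition pass_step : com :=
  Seq (If (BNle (NGet aKind pos) (NLit 0)) leaf_step node_step) (incr aPos).

Definition pass_guard : bexp := nlt pos (var aTotal).

Definition sweep : com :=
  Seq (Seq (setr rAcc (RNat (NLit 0))) (setn aSub (NLit 0)))
  (While (nlt sub (NAdd (var aTotal) (NLit 1)))
    (Seq (setr rAcc (RAdd (rvar rAcc) (RGet rDelta sub)))
    (Seq (RSet rDelta sub (RNat (NLit 0)))
    (Seq (If (BAnd (BNle (NLit 1) (NGet aGood sub))
                   (rlt (RNat (NLit 0)) (rvar rAcc)))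
            (setn aOut (NLit 1)) Skip)
         (incr aSub))))).

Definition scan_line : com :=
  Seq init_roots
  (Seq (Seq (setn aPos (NLit 0)) (While pass_guard pass_step)) sweep).

Definition next_digits : com :=
  Seq (setn aOdo (NLit 1))
  (Seq (While (BAnd (nlt odo dimE)
                    (BNle (var aTotal) (NAdd (NGet aDigit odo) (NLit 1))))
         (Seq (NSet aDigit odo (NLit 0)) (incr aOdo)))
    (If (nlt odo dimE)
      (NSet aDigit odo (NAdd (NGet aDigit odo) (NLit 1))) Skip)).

Definition grid : com :=
  Seq ranks
  (Seq (setn aOdo (NLit 1))
    (While (nlt odo dimE) (Seq scan_line next_digits))).

End GridProgram.

Section Grid.
Variables (R : realType) (d : nat) (Es : seq (dtree R d)).
Variables (x : 'rV[R]_d) (eps : R) (s0 : state R).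
Implicit Types (s : state R) (y : 'rV[R]_d) (D : nat -> nat).

Local Notation N := (offset Es (size Es)).
Local Notation kind := (narr s0 aKind).
Local Notation feat := (narr s0 aFeat).
Local Notation val := (rarr s0 rVal).
Local Notation X := (rarr s0 rX).

Hypothesis inp0 : input_sized Es x eps s0.
Hypothesis Es0 : (0 < size Es)%N.

Lemma N_gt0 : (0 < N)%N.
Proof. exact: leq_trans Es0 (size_leq_offset _). Qed.

Definition same_input s :=
  [/\ input_sized Es x eps s, narr s aKind =1 kind, narr s aFeat =1 feat,
      rarr s rVal =1 val & rarr s rX =1 X].

Lemma same_input_frame c s s' :
  frame c s s' -> keeps_input c -> same_input s -> same_input s'.
Proof.
move=> F h [i1 i2 i3 i4 i5]; split; first exact: input_sized_frame F h i1.
all: move: F h => [fn fr] /andP[/= hn hr] i; rewrite ?fn ?fr //.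
all: move: hn hr; rewrite !negb_or => /and5P[_ _ ? ? _] /and4P[? ? _ _] //.
Qed.

Definition cand (j q : nat) : R :=
  if [&& (0 < kind q)%N, X j - eps <= val q & val q <= X j + eps] then val q
  else X j + eps.

Definition point D : 'rV[R]_d := \row_j cand j (D j).

Definition rank_of (v : R) : nat := \sum_(0 <= i < N) (val i < v)%R.

Lemma rank_leqN v : (rank_of v <= N)%N.
Proof.
rewrite /rank_of -[leqRHS]subn0 -[leqRHS]muln1 -sum_nat_const_nat.
by apply: leq_sum => i _; case: (_ < _)%R.
Qed.

Lemma rank_threshold v p :
  (p < N)%N -> (rank_of v <= rank_of (val p))%N = (v <= val p).
Proof.
move=> hp; case: (lerP v (val p)) => hv.
  apply: leq_sum => i _; case: ltP => // hi.
  by rewrite (lt_le_trans hi hv).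
apply/negbTE; rewrite -ltnNge /rank_of !(bigD1_seq p) ?iota_uniq ?mem_index_iota //=.
rewrite ltxx hv add0n add1n ltnS; apply: leq_sum => i _.
by case: ltP => // hi; rewrite (lt_trans hi hv).
Qed.

Lemma ev_set_cand s a i j q :
  same_input s ->
  ev (set_cand a i j q) s = State (narr s)
    (upd (rarr s) a (nval s i) (cand (nval s j) (nval s q))).
Proof.
move=> [[[_ _ _ _ [_ he]] _ _] hk _ hv hX].
have [[_ _ _ _ [_ he0]] _ _] := inp0.
rewrite /set_cand ev_if /= hk !hv !hX he /cand.
by case: ifP => _ /=; rewrite ?hv ?hX ?he.
Qed.

Definition ranked s (n : nat) :=
  [/\ (forall q, (q < n)%N -> narr s aRank q = rank_of (val q)),
      (forall q, (n <= q)%N -> narr s aRank q = 0%N /\ narr s aCandRank q = 0%N) &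
      (forall r, (0 < narr s aGood r)%N <->
         exists q, (q < n)%N /\ r = rank_of (cand 0 q))].

Lemma rank_loop s q :
  same_input s -> narr s aPos 0 = q -> narr s aSub 0 = 0%N ->
  rarr s rCand q = cand 0 q ->
  narr s aRank q = 0%N -> narr s aCandRank q = 0%N ->
  term (While (nlt (var aSub) (var aTotal)) rank_step) s
    (fun s' => [/\ narr s' aRank q = rank_of (val q),
       narr s' aCandRank q = rank_of (cand 0 q) &
       forall q', q' <> q -> narr s' aRank q' = narr s aRank q' /\
         narr s' aCandRank q' = narr s aCandRank q'])
    (while_cost (nlt (var aSub) (var aTotal)) (max_cost rank_step) N).
Proof.
move=> sm hq hj hc h1 h2.
pose I j s' := [/\ same_input s', narr s' aPos 0 = q /\ narr s' aSub 0 = j,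
  rarr s' rCand q = cand 0 q,
  narr s' aRank q = (\sum_(0 <= i < j) (val i < val q)%R)%N /\
  narr s' aCandRank q = (\sum_(0 <= i < j) (val i < cand 0 q)%R)%N &
  forall q', q' <> q -> narr s' aRank q' = narr s aRank q' /\
         narr s' aCandRank q' = narr s aCandRank q'].
have I0 : I 0%N s by split=> //; rewrite !big_geq.
apply: term_weaken (term_for (I := I) _ _ I0) _ (leqnn _).
- move=> j s1 hj1 [sm1 [hq1 hs1] hc1 [r1 c1] o1].
  have [[_ _ h7] _ _ hv _] := sm1.
  split; first by rewrite /= hs1 h7 addn1.
  apply: term_ev => //.
  rewrite /rank_step !ev_seq; set s2 := ev (If _ _ _) s1.
  have n2 k i : narr s2 k i = if (k == aRank) && (i == q) then
      (narr s1 aRank q + (val j < val q)%R)%N else narr s1 k i.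
    rewrite /s2 ev_if /= hq1 hs1 !hv -ltNge; case: ifP => h /=.
      by rewrite /upd /= hq1.
    by case: andP => // -[/eqP -> /eqP ->]; rewrite addn0.
  have v2 k i : rarr s2 k i = rarr s1 k i by rewrite /s2 ev_if; case: ifP.
  move: s2 n2 v2 => s2 n2 v2.
  set s3 := ev (If _ _ _) s2.
  have n3 k i : narr s3 k i = if (k == aCandRank) && (i == q) then
      (narr s1 aCandRank q + (val j < cand 0 q)%R)%N else narr s2 k i.
    rewrite /s3 ev_if /= !n2 /= !v2 hq1 hs1 hc1 hv -ltNge; case: ifP => h /=.
      by rewrite /upd /= !n2 /= hq1.
    by case: andP => // -[/eqP -> /eqP ->]; rewrite n2 addn0.
  have v3 k i : rarr s3 k i = rarr s1 k i by rewrite /s3 ev_if; case: ifP => _; exact: v2.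
  have F : frame rank_step s1 (ev (incr aSub) s3).
    split=> k /= h i; last by rewrite v3.
    move: h; rewrite !orbF !negb_or /upd => /and3P[/negbTE h17 /negbTE h18 /negbTE ->].
    by rewrite /= n3 h18 n2 h17.
  split.
  + exact: same_input_frame F isT sm1.
  + by rewrite /= /upd /= !n3 !n2 /= hq1 hs1 addn1.
  + by rewrite /= v3 hc1.
  + by rewrite /= /upd /= !n3 !n2 /= !eqxx r1 c1 !big_nat_recr.
  + move=> q' /eqP/negbTE hq'; rewrite /= /upd /= !n3 !n2 /= hq'.
    by apply: o1; apply/eqP; rewrite hq'.
- by move=> s1 [[[_ _ h7] _ _ _ _] [_ h] _ _ _]; rewrite /= h h7 addn1 ltnn.
by move=> s1 _ [_ _ _ [r1 c1] o1].
Qed.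

Lemma ranksP s :
  same_input s -> fresh s ->
  term ranks s (ranked^~ N) (1000 * N ^ 2).
Proof.
move=> sm [fn fr].
pose I j s' := [/\ same_input s', narr s' aPos 0 = j & ranked s' j].
apply: term_cost.
  apply: term_seq; first apply: (term_ev (Q := I 0%N)) => //.
    split; first exact: same_input_frame (ev_frame _ _) _ sm.
      by [].
    split=> [//|q _|r]; rewrite /= /upd /= ?fn //.
    by split=> // -[q []].
  move=> s1 _ I0.
  apply: (@term_weaken _ _ _ (I N)).
  - apply: term_for I0 => [j s2 hj [sm2 hp [rk1 rk2 gd]]|s2 [[[_ _ h7] _ _ _ _] h _]]; last first.
      by rewrite /= h h7 addn1 ltnn.
    have [[_ _ h7] _ _ hv _] := sm2.
    split; first by rewrite /= hp h7 addn1.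
    apply: term_seq; first exact: (term_ev (Q := eq (ev _ s2))).
    move=> s3 F3 /esym; rewrite ev_seq ev_set_cand // => s3E.
    have n3 k i : narr s3 k i = if (k == aSub) && (i == 0)%N then 0%N else narr s2 k i.
      by rewrite s3E.
    have c3 : rarr s3 rCand j = cand 0 j by rewrite s3E /= /upd /= hp eqxx.
    have sm3 := same_input_frame F3 isT sm2.
    have [r0 cr0] := rk2 _ (leqnn j).
    apply: term_seq.
      by apply: (@rank_loop s3 j); rewrite ?n3.
    move=> s4 F4 [r4 cr4 o4].
    have sm4 := same_input_frame F4 isT sm3.
    apply: term_ev => //.
    have p4 : narr s4 aPos 0 = j by rewrite (proj1 F4) // n3.
    have g4 r : narr s4 aGood r = narr s2 aGood r by rewrite (proj1 F4) // n3.
    split; first exact: same_input_frame (ev_frame _ _) _ sm4.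
      by rewrite /= /upd /= p4 addn1.
    split=> [q|q|r].
    + rewrite ltnS leq_eqVlt => /orP[/eqP ->|hq]; first by rewrite /= /upd.
      have [|o _] := o4 q; first by move=> qj; rewrite qj ltnn in hq.
      by rewrite /= /upd /= o n3 rk1.
    + move=> hq; have [|o o'] := o4 q; first by move=> qj; rewrite qj ltnn in hq.
      by rewrite /= /upd /= o o' !n3 /=; apply: rk2; apply: ltnW.
    rewrite /= /upd /= p4 cr4 g4; split.
      case: eqP => [-> _|_ /gd[q [hq ->]]]; first by exists j.
      by exists q; split=> //; apply: ltnW.
    move=> [q []]; rewrite ltnS leq_eqVlt => /orP[/eqP -> ->|hq rq].
      by rewrite eqxx.
    by case: eqP => // _; apply/gd; exists q.
  - by move=> s2 _ [].
  - exact: leqnn.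
by rewrite /while_cost /=; have := N_gt0; rewrite expnS expn1; nia.
Qed.

Definition split_value D p : nat :=
  if feat p == 0%N then (rank_of (val p)).+1
  else if cand (feat p) (D (feat p)) <= val p then N.+1 else 0%N.

Definition delta_sum s (r : nat) : R := \sum_(0 <= i < r.+1) rarr s rDelta i.

Definition line_ready D s :=
  [/\ same_input s, (forall q, (q < N)%N -> narr s aRank q = rank_of (val q)) &
      (forall j, narr s aDigit j = D j)].

(* On the scanned line, a point of rank r makes the same comparisons as y. *)
Definition represents D r y := forall p (t : 'I_d), (p < N)%N ->
  feat p = t -> (r < split_value D p)%N = (y ord0 t <= val p).

Lemma line_ready_frame c D s s' :
  frame c s s' -> keeps_input c -> ~~ nwritten aRank c -> ~~ nwritten aDigit c ->
  line_ready D s -> line_ready D s'.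
Proof.
move=> F kc w1 w2 [h1 h2 h3]; split; first exact: same_input_frame F kc h1.
  by move=> q hq; rewrite (proj1 F) ?h2.
by move=> j; rewrite (proj1 F) ?h3.
Qed.

Lemma sum_update (f g : nat -> R) a v r :
  (forall i, g i = if i == a then f i + v else f i) ->
  \sum_(0 <= i < r.+1) g i =
  \sum_(0 <= i < r.+1) f i + (if (a <= r)%N then v else 0).
Proof.
move=> gE; rewrite (eq_bigr (fun i => f i + (if i == a then v else 0))).
  rewrite big_split /= -big_mkcond /=; congr (_ + _).
  case: leqP => h; last first.
    rewrite big_nat_cond big_pred0 // => i; rewrite andbC.
    by case: eqP => //= ->; rewrite ltnS leqNgt h.
  rewrite -big_filter (_ : [seq _ <- _ | _] = [:: a]) ?big_seq1 //.
  by rewrite filter_pred1_uniq ?iota_uniq // mem_index_iota.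
by move=> i _; rewrite gE; case: eqP; rewrite ?addr0.
Qed.

Lemma ev_leaf_step s b v a b' :
  narr s aPos 0 = b -> rarr s rVal b = v -> narr s aLo b = a ->
  narr s aHi b = b' ->
  narr (ev leaf_step s) = narr s /\
  forall r, delta_sum (ev leaf_step s) r =
    delta_sum s r + (if (a <= r < b')%N then v else 0).
Proof.
move=> hp hv ha hb; rewrite /leaf_step ev_if /= hp ha hb addn1.
case: ltnP => h /=; rewrite ?hp ?hv ?ha ?hb; split=> // r; rewrite /delta_sum; last first.
  by case: andP => [[h1 h2]|]; rewrite ?addr0 //; lia.
rewrite (@sum_update (upd (rarr s) rDelta a (rarr s rDelta a + v) rDelta)
  _ b' (- v)); last first.
  move=> i; rewrite /= {1}/upd /= [upd _ _ _ _ 0%N b]/upd /= hv.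
  by have [->|] := eqVneq i b'.
rewrite (@sum_update (rarr s rDelta)
  (upd (rarr s) rDelta a (rarr s rDelta a + v) rDelta) a v); last first.
  by move=> i; rewrite /upd /=; case: eqP => // ->.
rewrite -addrA; congr (_ + _); case: (leqP a r) => h1; case: (leqP b' r) => h2 //=.
- by rewrite subrr.
- by rewrite addr0.
- by lia.
- by rewrite addr0.
Qed.

Lemma ev_set_split s D b :
  line_ready D s -> narr s aPos 0 = b -> (b < N)%N ->
  let s' := ev set_split s in
  (forall k i, narr s' k i =
     if (k == aSplit) && (i == 0)%N then split_value D b else narr s k i) /\
  (forall k i, k != rCoord -> rarr s' k i = rarr s k i).
Proof.
move=> [sm hr hd] hp hb s'.
have [[_ _ h7] _ hf hv _] := sm.
rewrite /s' /set_split ev_if /= hp hf leqn0 /split_value.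
case: eqP => h0; first by rewrite /= hp hr // addn1.
rewrite ev_seq ev_set_cand //; set s1 := State _ _; rewrite ev_if.
have -> : bval s1 (BRle (rvar rCoord) (RGet rVal (var aPos))) =
    (cand (feat b) (D (feat b)) <= val b) by rewrite /= /upd /= hp !hf hd hv.
by case: ifP => _ /=; split=> k i //; rewrite /upd /= ?h7 ?addn1 // => /negbTE ->.
Qed.

Lemma ev_node_step s D b bl br :
  line_ready D s -> narr s aPos 0 = b -> (b < N)%N ->
  narr s aLeft b = bl -> narr s aRight b = br ->
  b != bl ->
  let s' := ev node_step s in
  (forall i, narr s' aLo i =
     if i == br then maxn (narr s aLo b) (split_value D b)
     else if i == bl then narr s aLo b else narr s aLo i) /\
  (forall i, narr s' aHi i =
     if i == br then narr s aHi b
     else if i == bl then minn (narr s aHi b) (split_value D b)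
     else narr s aHi i).
Proof.
move=> rd hp hb hl hr /negbTE nl s'.
rewrite /s' /node_step ev_seq.
have [] := ev_set_split rd hp hb; move: (ev set_split s) => s1 n1 _.
have maxE m h : (m + (h - m) = maxn m h)%N by lia.
have minE m h : (m - (m - h) = minn m h)%N by lia.
by split=> i; rewrite /= /upd /= !n1 /= hp hl hr ?nl ?maxE ?minE.
Qed.

Lemma pass_guardE s b (T : dtree R d) :
  same_input s -> narr s aPos 0 = b -> (b + nnodes T <= N)%N ->
  bval s pass_guard.
Proof.
by move=> [[_ _ h7] _ _ _ _] hb; have := nnodes_gt0 T; rewrite /= hb h7; lia.
Qed.

Definition passed D s b m (f : nat -> 'rV[R]_d -> R) s' :=
  [/\ narr s' aPos 0 = (b + m)%N,
      (forall i, ~~ (b <= i < b + m)%N ->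
         narr s' aLo i = narr s aLo i /\ narr s' aHi i = narr s aHi i) &
      (forall r y, represents D r y -> delta_sum s' r = delta_sum s r + f r y)].

Lemma pass_subtree D (T : dtree R d) b s :
  line_ready D s -> stored s b T -> (b + nnodes T <= N)%N ->
  narr s aPos 0 = b ->
  iterates pass_guard pass_step s
    (passed D s b (nnodes T) (fun r y =>
       if (narr s aLo b <= r < narr s aHi b)%N then predict T y else 0))
    (nnodes T).
Proof.
elim: T b s => [v|t eta L IHL Rt IHR] b s rd st hb hp;
  have [sm _ _] := rd; have g := pass_guardE sm hp hb;
  have [inp hk hf hv _] := sm.
  have [k2 v2] := st.
  apply: iterates_step => //; apply: iterates0.
  have [n1 p1] := ev_leaf_step hp v2 erefl erefl.
  rewrite /pass_step ev_seq ev_if /= hp k2 /=.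
  split=> //=; first by rewrite /upd /= n1 hp.
    by move=> i _; rewrite /upd /= n1.
  by move=> r y _; rewrite -p1.
have [[k2 f3 l4 r5 v0] [stL stR]] := st.
have lt_b : (b < N)%N by apply: leq_trans hb; have := nnodes_gt0 (Node t eta L Rt); lia.
have hL := nnodes_gt0 L; have hR := nnodes_gt0 Rt.
apply: (@iterates_weaken _ _ _ _
  (passed D s b (nnodes (Node t eta L Rt)) (fun r y =>
       if (narr s aLo b <= r < narr s aHi b)%N
       then predict (Node t eta L Rt) y else 0)) _
  ((nnodes L).+1 + nnodes Rt)%N); [|by []|by rewrite addSn].
rewrite addSn; apply: iterates_step => //.
have F1 := ev_frame s (isT : loop_free pass_step).
have rd1 := line_ready_frame F1 isT isT isT rd.
have st1 := stored_frame F1 isT st.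
have E1 : [/\ narr (ev pass_step s) aPos 0 = b.+1,
   narr (ev pass_step s) aLo = narr (ev node_step s) aLo,
   narr (ev pass_step s) aHi = narr (ev node_step s) aHi &
   rarr (ev pass_step s) rDelta =1 rarr s rDelta].
  have F := ev_frame s (isT : loop_free node_step).
  rewrite /pass_step ev_seq ev_if.
  have -> : bval s (BNle (NGet aKind (var aPos)) (NLit 0)) = false.
    by rewrite /= hp k2.
  move: (ev node_step s) F => s2 [F Fr]; split=> //=.
    by rewrite /upd /= F // hp addn1.
  by move=> i; rewrite Fr.
have := ev_node_step rd hp lt_b l4 r5.
case=> [|lo1 hi1]; first by lia.
move: (ev pass_step s) F1 rd1 st1 E1 => s1 F1 rd1 [_ [stL1 stR1]] [c1 loE hiE dE].
rewrite -{}loE -{}hiE in lo1 hi1.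
have [sm1 _ _] := rd1.
apply: iterates_bind.
  apply: iterates_frame; first by [].
  by apply: (IHL b.+1) => //; move: hb => /=; lia.
move=> s2 [F2 [c2 out2 p2]].
have rd2 := line_ready_frame F2 isT isT isT rd1.
have stR2 := stored_frame F2 isT stR1.
apply: iterates_weaken.
  apply: (IHR _ s2 rd2 stR2) => //.
  by move: hb => /=; lia.
- move=> s3 [c3 out3 p3]; split.
  + by rewrite c3 /=; lia.
  + move=> i hi.
    have [|e1 e2] := out3 i; first by move: hi => /=; lia.
    have [|g1 g2] := out2 i; first by move: hi => /=; lia.
    rewrite e1 e2 g1 g2 lo1 hi1; split.
      by rewrite !ifN //; move: hi => /=; lia.
    by rewrite !ifN //; move: hi => /=; lia.
  + move=> r y hr; rewrite (p3 _ _ hr) (p2 _ _ hr).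
    have -> : delta_sum s1 r = delta_sum s r by apply: eq_bigr => i _; rewrite dE.
    have [|-> ->] := out2 (b.+1 + nnodes L)%N; first by lia.
    have ne : b.+1 != (b.+1 + nnodes L)%N by lia.
    rewrite !lo1 !hi1 !eqxx !(negbTE ne).
    rewrite -addrA; congr (_ + _) => /=.
    have := hr b t lt_b; rewrite -hf -hv f3 v0 => /(_ erefl).
    set h := split_value D b; case: (lerP _ eta) => _ hr1.
      have -> : (maxn (narr s aLo b) h <= r < narr s aHi b)%N = false by lia.
      rewrite addr0.
      by have -> : (narr s aLo b <= r < minn (narr s aHi b) h)%N =
        (narr s aLo b <= r < narr s aHi b)%N by lia.
    have -> : (narr s aLo b <= r < minn (narr s aHi b) h)%N = false by lia.
    rewrite add0r.
    by have -> : (maxn (narr s aLo b) h <= r < narr s aHi b)%N =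
        (narr s aLo b <= r < narr s aHi b)%N by lia.
- by [].
Qed.

Definition rooted s := forall k, (k < size Es)%N ->
  narr s aLo (offset Es k) = 0%N /\ narr s aHi (offset Es k) = N.+1.

Lemma init_rootsP s : same_input s -> term init_roots s rooted (100 * N).
Proof.
move=> sm.
pose I j s' := [/\ same_input s', narr s' aSub 0 = j & forall k, (k < j)%N ->
  narr s' aLo (offset Es k) = 0%N /\ narr s' aHi (offset Es k) = N.+1].
apply: term_cost.
  apply: term_seq; first apply: (term_ev (Q := I 0%N)) => //.
    by split=> //; exact: same_input_frame (ev_frame _ _) _ sm.
  move=> s1 _ I0.
  apply: (@term_weaken _ _ _ (I (size Es)) _
    (while_cost _ _ (size Es)) (while_cost _ _ N)).
  - apply: term_for I0 => [j s2 hj [sm2 hp r2]|s2 [[[[_ h1 _ _ _] _ _] _ _ _ _] h _]]; last first.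
      by rewrite /= h h1 addn1 ltnn.
    have [[[_ h1 h2 _ _] _ h7] _ _ _ _] := sm2.
    split; first by rewrite /= hp h1 addn1.
    apply: term_ev => //; split.
    + exact: same_input_frame (ev_frame _ _) _ sm2.
    + by rewrite /= /upd /= hp addn1.
    + move=> k; rewrite ltnS leq_eqVlt /= /upd /= hp h2 // h7 addn1.
      by case/orP => [/eqP ->|/r2 [-> ->]]; rewrite ?eqxx ?if_same.
  - by move=> s2 _ [].
  - exact: leq_while_cost (size_leq_offset _).
by rewrite /while_cost /=; have := N_gt0; lia.
Qed.

Lemma pass_forest D s k :
  (k <= size Es)%N -> line_ready D s -> rooted s -> narr s aPos 0 = 0%N ->
  iterates pass_guard pass_step s (fun s' => [/\ frame pass_step s s',
    narr s' aPos 0 = offset Es k,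
    (forall i, (offset Es k <= i)%N ->
       narr s' aLo i = narr s aLo i /\ narr s' aHi i = narr s aHi i) &
    (forall r y, (r <= N)%N -> represents D r y -> delta_sum s' r =
       delta_sum s r + \sum_(0 <= i < k) predict (tree Es i) y)]) (offset Es k).
Proof.
move=> hk rd rt hp; elim: k hk => [|k IH] hk.
  by apply: iterates0; split=> // [|r y _ _]; rewrite ?offset0 // big_geq ?addr0.
rewrite (offsetS hk); apply: iterates_bind; first exact: IH (ltnW hk).
move=> s1 [F1 p1 o1 x1].
have rd1 := line_ready_frame F1 isT isT isT rd.
have [[[[_ _ _ hst _] _ _] _ _ _ _] _ _] := rd1.
have [lo1 hi1] := o1 _ (leqnn (offset Es k)).
have [lo hi] := rt _ hk.
apply: iterates_weaken.
- apply: iterates_frame; first by [].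
  apply: (pass_subtree rd1 (hst _ hk)); last exact: p1.
  by rewrite -offsetS // leq_offset.
- move=> s2 [F2 [p2 o2 x2]]; split.
  + exact: frame_trans F1 F2.
  + by rewrite p2.
  + move=> i hi'; have [|-> ->] := o2 i; first by rewrite (ltnNge i) hi' andbF.
    by apply: o1; apply: leq_trans hi'; apply: leq_addr.
  + move=> r y hr rp; rewrite (x2 _ _ rp) (x1 _ _ hr rp) lo1 hi1 lo hi.
    by rewrite ltnS hr big_nat_recr //= addrA.
- by [].
Qed.

Lemma sweepP s : same_input s ->
  term sweep s (fun s' => (forall i, (i <= N)%N -> rarr s' rDelta i = 0) /\
    (narr s' aOut 0 = 1%N <-> narr s aOut 0 = 1%N \/
       exists r, [/\ (r <= N)%N, (0 < narr s aGood r)%N & 0 < delta_sum s r]))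
    (200 * N).
Proof.
move=> sm.
pose I j s' := [/\ same_input s', narr s' aSub 0 = j /\ narr s' aGood =1 narr s aGood,
  rarr s' rAcc 0 = \sum_(0 <= i < j) rarr s rDelta i,
  (forall i, rarr s' rDelta i = if (i < j)%N then 0 else rarr s rDelta i) &
  (narr s' aOut 0 = 1%N <-> narr s aOut 0 = 1%N \/
       exists r, [/\ (r < j)%N, (0 < narr s aGood r)%N & 0 < delta_sum s r])].
apply: term_cost.
  apply: term_seq; first apply: (term_ev (Q := I 0%N)) => //.
    split=> //; first exact: same_input_frame (ev_frame _ _) _ sm.
      by rewrite /= /upd /= big_geq.
    by split=> [|[//|[r []]]]; first by left.
  move=> s1 _ I0.
  apply: (@term_weaken _ _ _ (I N.+1)).
  - apply: term_for I0 => [j s2 hj [sm2 [hp hg] ac dl ou]|s2 [[[_ _ h7] _ _ _ _] [h _] _ _ _]]; last first.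
      by rewrite /= h h7 !addn1 ltnn.
    have [[_ _ h7] _ _ _ _] := sm2.
    split; first by rewrite /= hp h7 !addn1.
    apply: term_ev => //; rewrite !ev_seq.
    set s3 := ev _ (ev _ s2).
    have n3 k i : narr s3 k i = narr s2 k i by [].
    have a3 : rarr s3 rAcc 0 = delta_sum s j.
      by rewrite /= /upd /= hp ac dl ltnn /delta_sum big_nat_recr.
    have d3 i : rarr s3 rDelta i = if (i == j)%N then 0 else rarr s2 rDelta i.
      by rewrite /= /upd /= hp.
    have sm3 : same_input s3.
      exact: same_input_frame (ev_frame _ _) _ (same_input_frame (ev_frame _ _) _ sm2).
    move: s3 n3 a3 d3 sm3 => s3 n3 a3 d3 sm3.
    set s4 := ev _ s3.
    have F4 : frame (setn aOut (NLit 1)) s3 s4.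
      rewrite /s4 ev_if; case: ifP => _; first exact: ev_frame.
      by split.
    have o4 : narr s4 aOut 0 = if (0 < narr s aGood j)%N && (0 < delta_sum s j)
        then 1%N else narr s2 aOut 0.
      rewrite /s4 ev_if /= !n3 a3 hp hg -ltNge; case: ifP => _ //=.
    have [F4n F4r] := F4.
    have sm4 := same_input_frame F4 isT sm3.
    move: s4 F4 o4 F4n F4r sm4 => s4 F4 o4 F4n F4r sm4.
    split.
    + exact: same_input_frame (ev_frame _ _) _ sm4.
    + by split=> [|i]; rewrite /= /upd /= F4n // n3 ?hp ?addn1 // hg.
    + by rewrite /= F4r // a3.
    + move=> i; rewrite /= F4r // d3 dl ltnS [(i <= j)%N]leq_eqVlt.
      by case: eqP.
    + rewrite /= /upd /= o4; split.
        case: ifP => [/andP[g1 g2] _|_ /ou[|[r [r1 r2 r3]]]].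
        * by right; exists j.
        * by left.
        * by right; exists r; split=> //; apply: ltnW.
      move=> h; case: ifP => // gd; apply/ou.
      case: h => [|[r []]]; first by left.
      rewrite ltnS leq_eqVlt => /orP[/eqP ->|r1] r2 r3; first by rewrite r2 r3 in gd.
      by right; exists r.
  - move=> s2 _ [_ _ _ dl ou]; split=> [i hi|]; first by rewrite dl ltnS hi.
    exact: ou.
  - exact: leqnn.
by rewrite /while_cost /=; have := N_gt0; lia.
Qed.

Definition set_first q D : nat -> nat := fun j => if j == 0%N then q else D j.

Lemma represents_point D q : represents D (rank_of (cand 0 q)) (point (set_first q D)).
Proof.
move=> p t hp ht; rewrite /split_value mxE /set_first ht.
case: eqP => [t0|_]; first by rewrite ltnS rank_threshold // t0.
by case: ifP => _ //; rewrite ltnS rank_leqN.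
Qed.

Definition good_ranks s := forall r, (0 < narr s aGood r)%N <->
  exists q, (q < N)%N /\ r = rank_of (cand 0 q).

Definition delta_clear s := forall i, (i <= N)%N -> rarr s rDelta i = 0.

Definition pass_cost := (bcost pass_guard + max_cost pass_step + 1000)%N.

Lemma scan_lineP D s :
  line_ready D s -> good_ranks s -> delta_clear s ->
  term scan_line s (fun s' => delta_clear s' /\
    (narr s' aOut 0 = 1%N <-> narr s aOut 0 = 1%N \/
      exists q, (q < N)%N /\ 0 < total_score Es (point (set_first q D))))
    (pass_cost * N).
Proof.
move=> rd gd dl; have [sm _ _] := rd.
apply: term_cost.
  apply: term_seq; first exact: init_rootsP.
  move=> s1 F1 rt1.
  have rd1 := line_ready_frame F1 isT isT isT rd.
  apply: term_seq.
    apply: (@term_seq _ _ _ _ (eq (ev (setn aPos (NLit 0)) s1))).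
      exact: term_ev.
    move=> s2 F2 s2E.
    have rd2 := line_ready_frame F2 isT isT isT rd1.
    have rt2 : rooted s2 by move=> k hk; rewrite -s2E; exact: rt1.
    apply: (@term_iterates _ _ _ _ (fun s' => forall r y, (r <= N)%N ->
      represents D r y -> delta_sum s' r = total_score Es y) N) => //.
    apply: iterates_weaken.
    + by apply: (pass_forest (leqnn _) rd2 rt2); rewrite -s2E.
    + move=> s3 [F3 p3 _ x3].
      have [[[_ _ h7] _ _ _ _] _ _] := line_ready_frame F3 isT isT isT rd2.
      split; first by rewrite /= p3 h7 addn1 ltnn.
      move=> r y hr rp; rewrite (x3 _ _ hr rp) /total_score (big_nth (Leaf 0)).
      have -> : delta_sum s2 r = 0; last by rewrite add0r.
      rewrite /delta_sum big_nat_cond big1 // => i /andP[/andP[_]].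
      rewrite ltnS => hi _.
      by rewrite (proj2 F2) // (proj2 F1) // dl // (leq_trans hi).
    + exact: leqnn.
  move=> s2 F2 x2.
  have rd2 := line_ready_frame F2 isT isT isT rd1.
  have [sm2 _ _] := rd2.
  apply: (@term_weaken _ _ _ _ _ _ _ (sweepP sm2)) (leqnn _).
  move=> s3 F3 [dl3 ou3]; split=> //.
  rewrite ou3 (proj1 F2) // (proj1 F1) //.
  split=> -[|h]; try (by left); right.
    move: h => [r [hr]]; rewrite (proj1 F2) // (proj1 F1) // => /gd[q [hq rE]] hp.
    exists q; split=> //; rewrite -(x2 r) //.
    by rewrite rE; exact: represents_point.
  move: h => [q [hq hp]]; exists (rank_of (cand 0 q)); split.
  - exact: rank_leqN.
  - by rewrite (proj1 F2) // (proj1 F1) //; apply/gd; exists q.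
  - rewrite (x2 _ (point (set_first q D))) //; first exact: rank_leqN.
    exact: represents_point.
rewrite /while_cost /pass_cost.
set c := (_ + max_cost pass_step)%N.
rewrite [X in (X + _ < _)%N]/=.
have : (bcost pass_guard < 50)%N by [].
have := N_gt0; rewrite [max_cost _]/=; nia.
Qed.

Definition odo_value m D : nat := \sum_(0 <= k < m) D k.+1 * N ^ k.

Lemma odo_valueS m D : odo_value m.+1 D = (odo_value m D + D m.+1 * N ^ m)%N.
Proof. by rewrite /odo_value big_nat_recr. Qed.

Lemma odo_value_lt m D :
  (forall k, (k < m)%N -> (D k.+1 < N)%N) -> (odo_value m D < N ^ m)%N.
Proof.
elim: m => [|m IH] h; first by rewrite /odo_value big_geq.
rewrite odo_valueS expnS.
have {}IH : (odo_value m D < N ^ m)%N by apply: IH => k hk; apply: h; apply: ltnW.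
have : ((D m.+1).+1 * N ^ m <= N * N ^ m)%N by rewrite leq_mul2r h ?orbT.
by rewrite mulSn; lia.
Qed.

Lemma odo_value_inj m D D' :
  (forall k, (k < m)%N -> (D k.+1 < N)%N) ->
  (forall k, (k < m)%N -> (D' k.+1 < N)%N) ->
  odo_value m D = odo_value m D' -> forall k, (k < m)%N -> D k.+1 = D' k.+1.
Proof.
elim: m => [|m IH] h h' //; rewrite !odo_valueS => e.
have g : forall k, (k < m)%N -> (D k.+1 < N)%N by move=> k /ltnW; apply: h.
have g' : forall k, (k < m)%N -> (D' k.+1 < N)%N by move=> k /ltnW; apply: h'.
have l := odo_value_lt g; have l' := odo_value_lt g'.
have p0 : (0 < N ^ m)%N by apply: leq_ltn_trans l.
have eD : D m.+1 = D' m.+1.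
  have := congr1 (divn^~ (N ^ m)%N) e.
  by rewrite /= !divnDMl // !divn_small // !add0n.
move=> k; rewrite ltnS leq_eqVlt => /orP[/eqP -> //|hk].
by apply: IH => //; move: e; rewrite eD => /addIn.
Qed.

Lemma odo_value_carry c D :
  (forall k, (k < c)%N -> (D k.+1).+1 = N) -> (odo_value c D).+1 = (N ^ c)%N.
Proof.
elim: c => [|c IH] h; first by rewrite /odo_value big_geq.
rewrite odo_valueS -addSn IH; last by move=> k hk; apply: h; apply: ltnW.
by rewrite -mulSn h // expnS.
Qed.

Lemma odo_value_next m c D D' :
  (c < m)%N -> (forall k, (k < c)%N -> (D k.+1).+1 = N) ->
  (forall k, (k < c)%N -> D' k.+1 = 0%N) -> D' c.+1 = (D c.+1).+1 ->
  (forall k, (c < k)%N -> D' k.+1 = D k.+1) ->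
  odo_value m D' = (odo_value m D).+1.
Proof.
move=> + h h0 h1 h2; elim: m => [|m IH] //.
rewrite ltnS leq_eqVlt !odo_valueS => /orP[/eqP <-|hc].
  rewrite h1 mulSn addnA -addSn odo_value_carry //; congr (_ + _)%N.
  rewrite /odo_value big_nat_cond big1 ?add0n // => k.
  by move=> /andP[/andP[_ hk] _]; rewrite h0.
by rewrite IH // h2 // addSn.
Qed.

Lemma leaf_exists (T : dtree R d) b : stored s0 b T ->
  exists q, (b <= q < b + nnodes T)%N /\ kind q = 0%N.
Proof.
elim: T b => [v|t eta L IHL Rt IHR] b /=.
  by move=> [h _]; exists b; split=> //; lia.
move=> [_ [/IHL[q [hq kq]] _]]; exists q; split=> //; lia.
Qed.

Lemma predict_eq (T : dtree R d) b y (z : 'rV[R]_d) :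
  stored s0 b T -> (b + nnodes T <= N)%N ->
  (forall p (t : 'I_d), (p < N)%N -> (0 < kind p)%N -> feat p = t ->
     (z ord0 t <= val p) = (y ord0 t <= val p)) ->
  predict T z = predict T y.
Proof.
move=> + + h; elim: T b => [v|t eta L IHL Rt IHR] b //=.
move=> [[k2 f3 _ _ v0] [stL stR]] hb.
have := h b t; rewrite k2 f3 v0 => -> //; last by lia.
rewrite (IHL b.+1) //; last by lia.
by rewrite (IHR (b.+1 + nnodes L)%N) //; lia.
Qed.

Lemma XE (j : 'I_d) : X j = x ord0 j.
Proof. by have [[_ _ _ _ [-> _]] _ _] := inp0. Qed.

Lemma cand_exists y (j : 'I_d) : in_ball x eps y ->
  exists q : 'I_N, forall p, (p < N)%N -> (0 < kind p)%N -> feat p = j ->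
    (cand j q <= val p) = (y ord0 j <= val p).
Proof.
move=> /(_ j) /andP[y1 y2].
pose P (p : 'I_N) := [&& (0 < kind p)%N, y ord0 j <= val p & val p <= x ord0 j + eps].
have [p0 Pp0|noP] := pickP P.
  exists [arg min_(p < p0 | P p) val p]%O.
  case: arg_minP => // q /and3P[q1 q2 q3] qmin p hp kp fp.
  rewrite /cand XE q1 q3 (le_trans y1 q2) /=.
  apply/idP/idP => [|yp]; first exact: le_trans.
  have [hp'|] := lerP (val p) (x ord0 j + eps); last by move/ltW; apply: le_trans.
  by apply: (qmin (Ordinal hp)); rewrite /P kp yp hp'.
have [[_ _ _ hst _] _ _] := inp0.
have [q [hq kq]] := leaf_exists (hst _ Es0).
have hqN : (q < N)%N.
  have := leq_offset Es Es0; rewrite offsetS // => /(leq_trans _); apply.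
  by case/andP: hq.
exists (Ordinal hqN) => p hp kp fp; rewrite /cand /= kq XE /=.
apply/idP/idP => [|yp]; first exact: le_trans.
have := noP (Ordinal hp); rewrite /P /= kp yp /= => /negbT.
by rewrite -ltNge => /ltW.
Qed.

Definition valid_digits D := forall k, (k < d.-1)%N -> (D k.+1 < N)%N.

Lemma grid_complete : 0 <= eps ->
  (exists D q, [/\ valid_digits D, (q < N)%N &
     0 < total_score Es (point (set_first q D))]) <->
  (exists y, in_ball x eps y /\ 0 < total_score Es y).
Proof.
move=> eps0; split=> [[D [q [_ _ hp]]]|[y [yb hp]]].
  exists (point (set_first q D)); split=> // j.
  rewrite mxE /cand XE; case: ifP => [/and3P[_ -> ->] //|_].
  by apply/andP; split; lra.
have [f hf] := fin_all_exists (fun j => cand_exists j yb).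
pose D j := if insub j is Some i then f i : nat else 0%N.
have DE (j : 'I_d) : D j = f j by rewrite /D valK.
exists D, (D 0%N); split.
- by move=> k hk; rewrite /D; case: insub => [i|]; [exact: ltn_ord | exact: N_gt0].
- by rewrite /D; case: insub => [i|]; [exact: ltn_ord | exact: N_gt0].
move: hp; congr (_ < _); rewrite /total_score !(big_nth (Leaf 0)).
rewrite !big_nat; apply: eq_bigr => k /= hk; apply/esym.
have [[_ _ _ hst _] _ _] := inp0.
apply: (predict_eq (hst _ hk)).
  by rewrite -offsetS // leq_offset.
move=> p t hpN kp fp; rewrite mxE /set_first.
have -> : (if t == 0%N :> nat then D 0%N else D t) = f t.
  by rewrite -DE; case: eqP => // ->.
exact: hf.
Qed.

Definition next_post D s' c :=
  [/\ (c <= d.-1)%N, narr s' aOdo 0 = c.+1,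
      (forall k, (k < c)%N -> (D k.+1).+1 = N) &
      (c < d.-1)%N ->
        [/\ ((D c.+1).+1 < N)%N, (forall k, (k < c)%N -> narr s' aDigit k.+1 = 0%N),
            narr s' aDigit c.+1 = (D c.+1).+1 &
            forall k, (c < k)%N -> narr s' aDigit k.+1 = D k.+1]].

Lemma next_digitsP D s :
  (0 < d <= N)%N ->
  same_input s -> (forall j, narr s aDigit j = D j) -> valid_digits D ->
  term next_digits s (fun s' => exists c, next_post D s' c) (200 * N).
Proof.
move=> /andP[d0 dN] sm dg vd.
pose I v s' := exists c, [/\ same_input s', narr s' aOdo 0 = c.+1,
  (c + v = d.-1)%N, (forall k, (k < c)%N -> (D k.+1).+1 = N) &
  forall j, narr s' aDigit j = if (0 < j <= c)%N then 0%N else D j].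
apply: term_cost.
  apply: term_seq; first apply: (term_ev (Q := I d.-1)) => //.
    exists 0%N; split=> //; first exact: same_input_frame (ev_frame _ _) _ sm.
    by move=> j; rewrite -dg; case: j.
  move=> s1 _ I1; apply: term_seq.
    apply: term_while I1 => v s2 [c [sm2 ho cv hD hd]].
    have [[[h0 _ _ _ _] _ h7] _ _ _ _] := sm2.
    move=> /= /andP[]; rewrite h0 h7 ho hd !addn1 ltnn andbF => cd Nc.
    have hcd : (c < d.-1)%N by lia.
    apply: term_ev => //; exists v.-1; first by lia.
    exists c.+1; split.
    - exact: same_input_frame (ev_frame _ _) _ sm2.
    - by rewrite /= /upd /= ho addn1.
    - by lia.
    - move=> k; rewrite ltnS leq_eqVlt => /orP[/eqP ->|/hD //].
      by apply/eqP; rewrite eqn_leq Nc vd.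
    - move=> j; rewrite /= /upd /= ho hd.
      have [->|ne] := eqVneq j c.+1; first by rewrite ltnSn.
      by congr (if _ then _ else _); lia.
  move=> s2 _ [[v [c [sm2 ho cv hD hd]]] stop].
  have [[[h0 _ _ _ _] _ h7] _ _ _ _] := sm2.
  apply: term_ev => //; exists c.
  rewrite ev_if /= h0 ho addn1.
  move: stop; rewrite /= h0 h7 ho hd !addn1 ltnn andbF negb_and -!ltnNge => stop.
  case: leqP => hcd; split; rewrite ?ev_if /= /upd /= ?ho //; try lia.
  move=> hc; split; first by lia.
  - by move=> k hk; rewrite eqSS (ltn_eqF hk) /= hd /= hk.
  - by rewrite eqxx /= hd ltnn andbF addn1.
  - by move=> k hk; rewrite eqSS (gtn_eqF hk) /= hd /= ltnNge (ltnW hk).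
by rewrite /while_cost /=; have := N_gt0; lia.
Qed.

Lemma same_input0 : same_input s0.
Proof. by split. Qed.

Definition grid_inv j s :=
  [/\ same_input s,
      ((j < N ^ d.-1)%N -> exists D,
        [/\ [/\ line_ready D s, good_ranks s & delta_clear s], valid_digits D,
            (narr s aOdo 0 < d)%N & odo_value d.-1 D = j]),
      ((N ^ d.-1 <= j)%N -> (d <= narr s aOdo 0)%N) &
      (narr s aOut 0 = 1%N <-> exists D' q,
        [/\ valid_digits D', (q < N)%N, (odo_value d.-1 D' < j)%N &
           0 < total_score Es (point (set_first q D'))])].

Lemma grid_body j s :
  (0 < d <= N)%N -> (j < N ^ d.-1)%N -> grid_inv j s ->
  term (Seq scan_line next_digits) s (grid_inv j.+1) ((pass_cost + 300) * N).
Proof.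
move=> hd hj [sm /(_ hj)[D [[rd gd dl] vd od vj]] _ ou].
apply: term_cost.
  apply: term_seq; first exact: scan_lineP rd gd dl.
  move=> s1 F1 [dl1 ou1].
  have sm1 := same_input_frame F1 isT sm.
  have dg1 i : narr s1 aDigit i = D i.
    by case: rd => _ _ h; rewrite (proj1 F1).
  apply: (@term_weaken _ _ _ _ (grid_inv j.+1) _ _ (next_digitsP hd sm1 dg1 vd)) (leqnn _).
  move=> s2 F2 [c [hc oc carry next]].
  have outE : narr s2 aOut 0 = 1%N <-> exists D' q,
      [/\ valid_digits D', (q < N)%N, (odo_value d.-1 D' < j.+1)%N &
           0 < total_score Es (point (set_first q D'))].
    rewrite (proj1 F2) // ou1 ou; split=> [[|[q [hq hp]]]|[D' [q [h1 h2]]]].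
    - by move=> [D' [q [h1 h2 h3 h4]]]; exists D', q; split=> //; apply: ltnW.
    - by exists D, q; rewrite vj.
    rewrite ltnS leq_eqVlt => /orP[/eqP e|h3] h4; last by left; exists D', q.
    right; exists q; split=> //; move: h4; congr (_ < total_score _ _).
    apply/rowP => -[[|k] hk]; rewrite !mxE //= /set_first /=.
    rewrite (odo_value_inj h1 vd) ?vj //; lia.
  have sm2 := same_input_frame F2 isT sm1.
  have gd2 : good_ranks s2.
    by move=> r; rewrite (proj1 F2) // (proj1 F1).
  have dl2 : delta_clear s2 by move=> i hi; rewrite (proj2 F2) // dl1.
  have rk2 q : (q < N)%N -> narr s2 aRank q = rank_of (val q).
    by case: rd => _ h _ hq; rewrite (proj1 F2) // (proj1 F1) // h.
  have [hc'|hc'] := ltnP c d.-1.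
    have [g1 g2 g3 g4] := next hc'.
    have vd2 : valid_digits (narr s2 aDigit).
      move=> k hk; have [lt|gt|->] := ltngtP k c.
      - by rewrite g2 // N_gt0.
      - by rewrite g4 // vd.
      - by rewrite g3.
    have v2 : odo_value d.-1 (narr s2 aDigit) = j.+1.
      by rewrite -vj; apply: odo_value_next hc' _ _ _ _.
    split=> //; last by rewrite leqNgt -v2 odo_value_lt.
    by move=> _; exists (narr s2 aDigit); split=> //; rewrite oc; lia.
  have cE : c = d.-1 by lia.
  have jE : j.+1 = (N ^ d.-1)%N by rewrite -vj odo_value_carry // -cE.
  by split=> //; [rewrite jE ltnn | rewrite oc; lia].
rewrite mulnDl; have := N_gt0; lia.
Qed.

Definition grid_cost : nat := (1000 + 2 * (pass_cost + 1000))%N.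

Lemma gridP :
  (1 < d)%N -> (d <= N)%N -> 0 <= eps -> fresh s0 ->
  term grid s0 (fun s' => narr s' aOut 0 = 1%N <->
       exists y, in_ball x eps y /\ 0 < total_score Es y) (grid_cost * N ^ d).
Proof.
move=> d1 dN eps0 fr0; have [fn fr] := fr0.
apply: term_cost.
  apply: term_seq; first exact: ranksP same_input0 fr0.
  move=> s1 F1 [rk1 _ gd1]; apply: term_seq.
    apply: (term_ev (Q := grid_inv 0)) => //.
    have sm1 := same_input_frame F1 isT same_input0.
    have sm2 : same_input (ev (setn aOdo (NLit 1)) s1).
      exact: same_input_frame (ev_frame _ _) _ sm1.
    split=> //.
    - move=> _; exists (fun=> 0%N); split=> //.
      + split=> //; last by move=> i _; rewrite /= (proj2 F1) // fr.
        by split=> // j; rewrite /= /upd /= (proj1 F1) // fn.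
      + by move=> k _; exact: N_gt0.
      + by rewrite /odo_value big1.
    - by rewrite leqn0 expn_eq0 eqn0Ngt N_gt0.
    - rewrite /= /upd /= (proj1 F1) // fn //; split=> // -[D' [q []]].
      by rewrite ltn0.
  move=> s2 _ I0.
  apply: (@term_weaken _ _ _ (grid_inv (N ^ d.-1))).
  - apply: term_for I0 => [j s3 hj I3|s3 [[[[h0 _ _ _ _] _ _] _ _ _ _] _ stop _]].
      split; last by apply: grid_body hj I3; rewrite dN ltnW.
      have [[[[h0 _ _ _ _] _ _] _ _ _ _] /(_ hj)[D [_ _ od _]] _ _] := I3.
      by rewrite /= h0 addn1.
    by rewrite /= h0 addn1 -leqNgt stop.
  - move=> s3 _ [_ _ _ ->]; rewrite -grid_complete //; split.
      by move=> [D [q [h1 h2 _ h3]]]; exists D, q.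
    move=> [D [q [h1 h2 h3]]]; exists D, q; split=> //.
    exact: odo_value_lt h1.
  - exact: leqnn.
have Nd : (N ^ d = N * N ^ d.-1)%N by rewrite -expnS prednK // ltnW.
have N2 : (N ^ 2 <= N ^ d)%N by rewrite leq_pexp2l ?N_gt0.
have := N_gt0; rewrite /while_cost /grid_cost.
have p0 : (0 < N ^ d.-1)%N by rewrite expn_gt0 N_gt0.
rewrite [max_cost _]/= [bcost _]/=; move: N2; rewrite Nd.
move: (N ^ d.-1)%N (pass_cost) p0 => M c; nia.
Qed.

End Grid.

(** * Dimension one *)

Notation aLive := 27%N (only parsing).
Notation aTree := 28%N (only parsing).
Notation aTree' := 29%N (only parsing).
Notation aLeaf := 30%N (only parsing).
Notation aLeaf' := 31%N (only parsing).
Notation rLo := 14%N (only parsing).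
Notation rHi := 15%N (only parsing).
Notation rSumAt := 16%N (only parsing).

Section MergeProgram.

Let k := var aTree.
Let k' := var aTree'.
Let p := var aLeaf.
Let q := var aLeaf'.
Let x0 := RGet rX (NLit 0).

(* Intervals are open on the left, so that the closed ball is entered through a
   lower end below x_0 - eps. *)
Definition init_intervals : com :=
  Seq (setn aTree (NLit 0))
  (While (nlt k numE)
    (Seq (RSet rLo (NGet aRoot k)
            (RSub (RSub x0 (rvar rEps)) (RNat (NLit 1))))
    (Seq (RSet rHi (NGet aRoot k) (RAdd x0 (rvar rEps)))
         (incr aTree)))).

Definition interval_leaf : com :=
  If (BAnd (rlt (RGet rLo p) (RGet rHi p))
           (BRle (RSub x0 (rvar rEps)) (RGet rHi p)))
    (NSet aLive p (NLit 1)) Skip.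

Definition interval_node : com :=
  Seq (Seq (RSet rLo (NGet aLeft p) (RGet rLo p))
           (RSet rHi (NGet aRight p) (RGet rHi p)))
  (Seq (If (rlt (RGet rVal p) (RGet rHi p))
          (RSet rHi (NGet aLeft p) (RGet rVal p))
          (RSet rHi (NGet aLeft p) (RGet rHi p)))
       (If (rlt (RGet rLo p) (RGet rVal p))
          (RSet rLo (NGet aRight p) (RGet rVal p))
          (RSet rLo (NGet aRight p) (RGet rLo p)))).

Definition interval_step : com :=
  Seq (If (BNle (NGet aKind p) (NLit 0)) interval_leaf interval_node)
      (incr aLeaf).

Definition interval_guard : bexp := nlt p (var aTotal).

Definition intervals : com :=
  Seq init_intervals
    (Seq (setn aLeaf (NLit 0)) (While interval_guard interval_step)).

Definition merge_step : com :=
  If (BNle (NGet aLive p) (NLit 0)) (incr aLeaf)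
    (If (BAnd (BNle (NLit 1) (NGet aLive q)) (BRle (RGet rHi p) (RGet rHi q)))
      (Seq (RSet rSumAt p (RAdd (RGet rSumAt p) (RGet rVal q))) (incr aLeaf))
      (incr aLeaf')).

Definition merge_guard : bexp := nlt p (NGet aRoot (NAdd k (NLit 1))).

Definition merge_trees : com :=
  Seq (setn aTree (NLit 0))
  (While (nlt k numE)
    (Seq (setn aTree' (NLit 0))
    (Seq (While (nlt k' numE)
           (Seq (Seq (setn aLeaf (NGet aRoot k)) (setn aLeaf' (NGet aRoot k')))
           (Seq (While merge_guard merge_step)
                (incr aTree'))))
         (incr aTree)))).

Definition check_sums : com :=
  Seq (setn aLeaf (NLit 0))
  (While interval_guard
    (Seq (If (BAnd (BNle (NLit 1) (NGet aLive p))
                   (rlt (RNat (NLit 0)) (RGet rSumAt p)))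
            (setn aOut (NLit 1)) Skip)
         (incr aLeaf))).

Definition sweep_line : com := Seq intervals (Seq merge_trees check_sums).

End MergeProgram.

Section Line.
Variables (R : realType) (Es : seq (dtree R 1)).
Variables (x : 'rV[R]_1) (eps : R).
Implicit Types (s : state R) (y : 'rV[R]_1) (T : dtree R 1).

Local Notation N := (offset Es (size Es)).
Local Notation x0 := (x ord0 ord0).

Hypothesis Es0 : (0 < size Es)%N.

Let Ngt0 : (0 < N)%N.
Proof. exact: leq_trans Es0 (size_leq_offset _). Qed.

(* The coordinates that reach node b are those in the half-open interval
   ]lo, hi]; a leaf is live if it is reached from the ball. *)
Fixpoint interval_tree s b T (lo hi : R) : Prop :=
  [/\ rarr s rLo b = lo, rarr s rHi b = hi &
  match T with
  | Leaf _ => narr s aLive b = ((lo < hi) && (x0 - eps <= hi))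
  | Node _ eta L Rt => [/\ narr s aLive b = 0%N,
      interval_tree s b.+1 L lo (Num.min hi eta) &
      interval_tree s (b.+1 + nnodes L) Rt (Num.max lo eta) hi]
  end].

Fixpoint leaf_pos (b : nat) T (c : R) : nat :=
  match T with
  | Leaf _ => b
  | Node _ eta L Rt => if c <= eta then leaf_pos b.+1 L c
                       else leaf_pos (b.+1 + nnodes L) Rt c
  end.

Lemma leaf_pos_range b T c : (b <= leaf_pos b T c < b + nnodes T)%N.
Proof.
elim: T b => [v|t eta L IHL Rt IHR] b /=; first by lia.
by case: ifP => _; [have := IHL b.+1 | have := IHR (b.+1 + nnodes L)%N]; lia.
Qed.

Lemma interval_tree_ext s s' b T lo hi :
  (forall i, (b <= i < b + nnodes T)%N ->
    [/\ rarr s' rLo i = rarr s rLo i, rarr s' rHi i = rarr s rHi i &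
        narr s' aLive i = narr s aLive i]) ->
  interval_tree s b T lo hi -> interval_tree s' b T lo hi.
Proof.
elim: T b lo hi => [v|t eta L IHL Rt IHR] b lo hi h /=.
  by have [|-> -> ->] := h b; first by rewrite /=; lia.
have [|-> -> ->] := h b; first by rewrite /=; lia.
move=> [h1 h2 [h3 hl hr]]; split=> //; split=> //.
  by apply: IHL hl => i hi'; apply: h => /=; lia.
by apply: IHR hr => i hi'; apply: h => /=; lia.
Qed.

Lemma interval_bounds s b T lo hi q :
  interval_tree s b T lo hi -> (b <= q < b + nnodes T)%N ->
  lo <= rarr s rLo q /\ rarr s rHi q <= hi.
Proof.
elim: T b lo hi => [v|t eta L IHL Rt IHR] b lo hi /=.
  move=> [h1 h2 _] hq; have -> : q = b by lia.
  by rewrite h1 h2.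
move=> [h1 h2 [_ hl hr]] hq.
have [->|ne] := eqVneq q b; first by rewrite h1 h2.
have [lt|ge] := ltnP q (b.+1 + nnodes L).
  have [|g1 g2] := IHL _ _ _ hl; first by lia.
  by split=> //; apply: le_trans g2 _; rewrite ge_min lexx.
have [|g1 g2] := IHR _ _ _ hr; first by lia.
by split=> //; apply: le_trans g1; rewrite le_max lexx.
Qed.

Lemma live_bounds s b T lo hi q :
  interval_tree s b T lo hi -> (b <= q < b + nnodes T)%N ->
  (0 < narr s aLive q)%N ->
  rarr s rLo q < rarr s rHi q /\ x0 - eps <= rarr s rHi q.
Proof.
elim: T b lo hi => [v|t eta L IHL Rt IHR] b lo hi /=.
  move=> [h1 h2 h3] hq; have -> : q = b by lia.
  by rewrite h3 h1 h2; case: andP => // -[].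
move=> [h1 h2 [h3 hl hr]] hq.
have [->|ne] := eqVneq q b; first by rewrite h3.
have [lt|ge] := ltnP q (b.+1 + nnodes L).
  by apply: IHL hl _; lia.
by apply: IHR hr _; lia.
Qed.

Lemma leaf_posP s b T lo hi c :
  interval_tree s b T lo hi -> stored s b T -> lo < c -> c <= hi ->
  x0 - eps <= c ->
  [/\ (0 < narr s aLive (leaf_pos b T c))%N,
      c <= rarr s rHi (leaf_pos b T c) &
      rarr s rVal (leaf_pos b T c) = predict T (const_mx c)].
Proof.
elim: T b lo hi => [v|t eta L IHL Rt IHR] b lo hi /=.
  move=> [h1 h2 h3] [_ h4] lc ch xc.
  by rewrite h3 h2 (lt_le_trans lc ch) (le_trans xc ch).
move=> [_ _ [_ hl hr]] [_ [sl sr]] lc ch xc; rewrite mxE; case: (lerP c eta) => ce.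
  by apply: IHL hl sl lc _ xc; rewrite le_min ch ce.
by apply: IHR hr sr _ ch xc; rewrite gt_max lc ce.
Qed.

Lemma leaf_pos_order s b T lo hi c q :
  interval_tree s b T lo hi -> lo < c -> c <= hi ->
  (b <= q < b + nnodes T)%N -> (0 < narr s aLive q)%N ->
  (q < leaf_pos b T c)%N = (rarr s rHi q < c).
Proof.
elim: T b lo hi => [v|t eta L IHL Rt IHR] b lo hi /=.
  move=> [h1 h2 _] _ ch hq _; have -> : q = b by lia.
  by rewrite ltnn h2 ltNge ch.
move=> [_ _ [h3 hl hr]] lc ch hq lq.
have [qb|ne] := eqVneq q b; first by rewrite qb h3 in lq.
case: (lerP c eta) => ce; have [lt|ge] := ltnP q (b.+1 + nnodes L).
- by apply: IHL hl lc _ _ lq; [rewrite le_min ch ce | lia].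
- have hq' : (b.+1 + nnodes L <= q < b.+1 + nnodes L + nnodes Rt)%N by lia.
  have [g1 _] := interval_bounds hr hq'.
  have [g2 _] := live_bounds hr hq' lq.
  have := leaf_pos_range b.+1 L c.
  have -> : (rarr s rHi q < c) = false; last by lia.
  apply/negbTE; rewrite -leNgt ltW // (le_lt_trans _ g2) // (le_trans _ g1) //.
  by rewrite le_max ce orbT.
- have hq' : (b.+1 <= q < b.+1 + nnodes L)%N by lia.
  have [_ g1] := interval_bounds hl hq'.
  have := leaf_pos_range (b.+1 + nnodes L) Rt c.
  have -> : (rarr s rHi q < c) = true; last by lia.
  by rewrite (le_lt_trans g1) // gt_min ce orbT.
- by apply: IHR hr _ ch _ lq; [rewrite gt_max lc ce | lia].
Qed.

Lemma predict_const s b T lo hi c c' :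
  interval_tree s b T lo hi -> c <= c' -> c' <= rarr s rHi (leaf_pos b T c) ->
  predict T (const_mx c') = predict T (const_mx c : 'rV[R]_1).
Proof.
elim: T b lo hi => [v|t eta L IHL Rt IHR] b lo hi //=.
move=> [_ _ [_ hl hr]] cc'; rewrite !mxE; case: (lerP c eta) => ce h.
  rewrite (IHL _ _ _ hl) // ifT // (le_trans h) //.
  have [_ g] := interval_bounds hl (leaf_pos_range b.+1 L c).
  by apply: le_trans g _; rewrite ge_min lexx orbT.
by rewrite (IHR _ _ _ hr) // ifF // leNgt (lt_le_trans ce cc').
Qed.

Definition rooted_intervals s := forall k, (k < size Es)%N ->
  rarr s rLo (offset Es k) = x0 - eps - 1 /\
  rarr s rHi (offset Es k) = x0 + eps.

Lemma init_intervalsP s : input_sized Es x eps s ->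
  term init_intervals s rooted_intervals (100 * N).
Proof.
move=> inp.
pose I j s' := [/\ input_sized Es x eps s', narr s' aTree 0 = j &
  forall k, (k < j)%N -> rarr s' rLo (offset Es k) = x0 - eps - 1 /\
  rarr s' rHi (offset Es k) = x0 + eps].
apply: term_cost.
  apply: term_seq; first apply: (term_ev (Q := I 0%N)) => //.
    by split=> //; exact: input_sized_frame (ev_frame _ _) _ inp.
  move=> s1 _ I0.
  apply: (@term_weaken _ _ _ (I (size Es)) _
    (while_cost _ _ (size Es)) (while_cost _ _ N)).
  - apply: term_for I0 => [j s2 hj [inp2 hp r2]|s2 [[[_ h1 _ _ _] _ _] h _]]; last first.
      by rewrite /= h h1 addn1 ltnn.
    have [[_ h1 h2 _ [hx he]] _ h7] := inp2.
    split; first by rewrite /= hp h1 addn1.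
    apply: term_ev => //; split.
    + exact: input_sized_frame (ev_frame _ _) _ inp2.
    + by rewrite /= /upd /= hp addn1.
    + move=> k; rewrite ltnS leq_eqVlt /= /upd /= hp h2 // (hx ord0) he.
      by case/orP => [/eqP ->|/r2 [-> ->]]; rewrite ?eqxx ?if_same.
  - by move=> s2 _ [].
  - exact: leq_while_cost (size_leq_offset _).
by rewrite /while_cost /=; lia.
Qed.

Lemma ev_interval_node s b bl br eta :
  narr s aLeaf 0 = b -> rarr s rVal b = eta ->
  narr s aLeft b = bl -> narr s aRight b = br -> b != bl -> b != br -> bl != br ->
  let s' := ev interval_node s in
  (forall i, rarr s' rLo i =
     if i == br then Num.max (rarr s rLo b) eta
     else if i == bl then rarr s rLo b else rarr s rLo i) /\
  (forall i, rarr s' rHi i =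
     if i == br then rarr s rHi b
     else if i == bl then Num.min (rarr s rHi b) eta else rarr s rHi i).
Proof.
move=> hp hv hl hr /negbTE nl /negbTE nr /negbTE nlr s'.
rewrite /s' /interval_node !ev_seq; set s1 := ev _ (ev _ s).
have lo1 i : rarr s1 rLo i = if i == bl then rarr s rLo b else rarr s rLo i.
  by rewrite /= /upd /= hp hl.
have hi1 i : rarr s1 rHi i = if i == br then rarr s rHi b else rarr s rHi i.
  by rewrite /= /upd /= hp hr.
have n1 k i : narr s1 k i = narr s k i by [].
have v1 i : rarr s1 rVal i = rarr s rVal i by [].
move: s1 lo1 hi1 n1 v1 => s1 lo1 hi1 n1 v1.
set s2 := ev _ s1.
have lo2 i : rarr s2 rLo i = rarr s1 rLo i by rewrite /s2 ev_if; case: ifP.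
have hi2 i : rarr s2 rHi i =
    if i == bl then Num.min (rarr s rHi b) eta else rarr s1 rHi i.
  rewrite /s2 ev_if /= !n1 hp v1 hv hi1 nr -ltNge.
  by case: ltrP => h /=; rewrite /upd /= !n1 hp hl ?v1 ?hv ?hi1 ?nr.
have n2 k i : narr s2 k i = narr s k i.
  by rewrite /s2 ev_if; case: ifP => _ /=; rewrite n1.
have v2 i : rarr s2 rVal i = rarr s rVal i.
  by rewrite /s2 ev_if; case: ifP => _ /=; rewrite /upd /= v1.
move: s2 lo2 hi2 n2 v2 => s2 lo2 hi2 n2 v2.
rewrite ev_if /= !n2 hp v2 hv lo2 lo1 nl -ltNge.
split=> i; case: ltrP => h /=;
  rewrite /upd /= ?n2 ?hp ?hr ?v2 ?hv ?lo2 ?lo1 ?nl ?hi2 ?hi1 //.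
all: by have [->|] := eqVneq i bl; rewrite ?nlr.
Qed.

Lemma interval_guardE s b T :
  input_sized Es x eps s -> narr s aLeaf 0 = b -> (b + nnodes T <= N)%N ->
  bval s interval_guard.
Proof.
by move=> [_ _ h7] hb; have := nnodes_gt0 T; rewrite /= hb h7; lia.
Qed.

Definition same_intervals_outside (b m : nat) s s' := forall i : nat,
  ~~ (b <= i < b + m)%N ->
  [/\ rarr s' rLo i = rarr s rLo i, rarr s' rHi i = rarr s rHi i &
      narr s' aLive i = narr s aLive i].

Lemma interval_pass T b s :
  input_sized Es x eps s -> stored s b T -> (b + nnodes T <= N)%N ->
  narr s aLeaf 0 = b ->
  (forall i, (b <= i < b + nnodes T)%N -> narr s aLive i = 0%N) ->
  iterates interval_guard interval_step s (fun s' =>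
    [/\ narr s' aLeaf 0 = (b + nnodes T)%N,
        interval_tree s' b T (rarr s rLo b) (rarr s rHi b) &
        same_intervals_outside b (nnodes T) s s']) (nnodes T).
Proof.
elim: T b s => [v|t eta L IHL Rt IHR] b s inp st hb hp lv;
  have g := interval_guardE inp hp hb;
  have [[_ _ _ _ [hx he]] _ _] := inp.
  have [k2 _] := st.
  apply: iterates_step => //; apply: iterates0.
  rewrite /interval_step ev_seq ev_if.
  have -> : bval s (BNle (NGet aKind (var aLeaf)) (NLit 0)) by rewrite /= hp k2.
  have lb : narr s aLive b = 0%N by apply: lv; rewrite /=; lia.
  rewrite ev_if; set c := bval s _.
  have cE : c = (rarr s rLo b < rarr s rHi b) && (x0 - eps <= rarr s rHi b).
    by rewrite /c /= hp (hx ord0) he -ltNge.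
  case: ifP; rewrite cE => h; split=> /=; rewrite ?h /upd /= ?hp ?eqxx ?lb //.
  move=> i /= hi; rewrite /upd /= ?hp; have [ib|//] := eqVneq i b.
  by move: hi; rewrite ib; lia.
have [[k2 f3 l4 r5 v0] [stL stR]] := st.
have hL := nnodes_gt0 L; have hR := nnodes_gt0 Rt.
apply: (@iterates_weaken _ _ _ _ (fun s' =>
    [/\ narr s' aLeaf 0 = (b + nnodes (Node t eta L Rt))%N,
        interval_tree s' b (Node t eta L Rt) (rarr s rLo b) (rarr s rHi b) &
        same_intervals_outside b (nnodes (Node t eta L Rt)) s s']) _
  ((nnodes L).+1 + nnodes Rt)%N); [|by []|by rewrite addSn].
rewrite addSn; apply: iterates_step => //.
have F1 := ev_frame s (isT : loop_free interval_step).
have inp1 := input_sized_frame F1 isT inp.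
have st1 := stored_frame F1 isT st.
have E1 : [/\ narr (ev interval_step s) aLeaf 0 = b.+1,
   rarr (ev interval_step s) = rarr (ev interval_node s) &
   narr (ev interval_step s) aLive =1 narr s aLive].
  have F := ev_frame s (isT : loop_free interval_node).
  rewrite /interval_step ev_seq ev_if.
  have -> : bval s (BNle (NGet aKind (var aLeaf)) (NLit 0)) = false.
    by rewrite /= hp k2.
  move: (ev interval_node s) F => s2 [F Fr]; split=> //=.
    by rewrite /upd /= F // hp addn1.
  by move=> i; rewrite /upd /= F.
have := ev_interval_node hp v0 l4 r5.
case=> [|||lo1 hi1]; [lia|lia|lia|].
move: (ev interval_step s) F1 inp1 st1 E1 => s1 F1 inp1 [_ [stL1 stR1]] [c1 rE lv1].
rewrite -{}rE in lo1 hi1.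
have ne : (b.+1 == b.+1 + nnodes L)%N = false by lia.
have neb : (b == b.+1 + nnodes L)%N = false by lia.
have neb' : (b == b.+1)%N = false by lia.
apply: iterates_bind.
  apply: iterates_frame; first by [].
  apply: (IHL b.+1 s1) => //; first by move: hb => /=; lia.
  by move=> i hi; rewrite lv1 lv //=; lia.
move=> s2 [F2 [c2 t2 o2]].
have inp2 := input_sized_frame F2 isT inp1.
have stR2 := stored_frame F2 isT stR1.
have [|lo2 hi2 lv2] := o2 (b.+1 + nnodes L)%N; first by rewrite ltnn andbF.
apply: iterates_weaken.
  apply: (IHR _ s2 inp2 stR2) => //; first by move: hb => /=; lia.
  move=> i hi; have [|_ _ ->] := o2 i; first by lia.
  by rewrite lv1 lv //=; lia.
- move=> s3 [c3 t3 o3].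
  have out i : ~~ (b.+1 <= i < b.+1 + nnodes L + nnodes Rt)%N ->
      [/\ rarr s3 rLo i = rarr s1 rLo i, rarr s3 rHi i = rarr s1 rHi i &
          narr s3 aLive i = narr s1 aLive i].
    move=> hi; have [|-> -> ->] := o3 i; first by lia.
    by apply: o2; lia.
  split.
  + by rewrite c3 /=; lia.
  + have [|g1 g2 g3] := out b; first by lia.
    rewrite /= g1 g2 g3 lo1 hi1 lv1 neb neb' lv; last by rewrite /=; lia.
    split=> //; split=> //.
      move: t2; rewrite lo1 hi1 ne eqxx; apply: interval_tree_ext => i hi.
      by apply: o3; lia.
    by move: t3; rewrite lo2 hi2 lo1 hi1 eqxx.
  + move=> i /= hi; have [|-> -> ->] := out i; first by lia.
    by rewrite lo1 hi1 lv1 !ifN //; lia.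
- by [].
Qed.

Definition all_intervals s := forall k, (k < size Es)%N ->
  interval_tree s (offset Es k) (tree Es k) (x0 - eps - 1) (x0 + eps).

Lemma intervalsP s :
  input_sized Es x eps s -> (forall i, narr s aLive i = 0%N) ->
  term intervals s all_intervals
   ((200 + bcost interval_guard + max_cost interval_step) * N).
Proof.
move=> inp lv.
apply: term_cost.
  apply: term_seq; first exact: init_intervalsP.
  move=> s1 F1 rt1.
  have inp1 := input_sized_frame F1 isT inp.
  apply: (@term_seq _ _ _ _ (eq (ev (setn aLeaf (NLit 0)) s1))).
    exact: term_ev.
  move=> s2 F2 s2E.
  have inp2 := input_sized_frame F2 isT inp1.
  have rt2 : rooted_intervals s2 by move=> k hk; rewrite -s2E; exact: rt1.
  have lv2 i : narr s2 aLive i = 0%N by rewrite (proj1 F2) // (proj1 F1).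
  apply: (@term_iterates _ _ _ _ all_intervals N) => //.
  suff H k : (k <= size Es)%N -> iterates interval_guard interval_step s2
    (fun s' => [/\ frame interval_step s2 s', narr s' aLeaf 0 = offset Es k,
      (forall j, (j < k)%N -> interval_tree s' (offset Es j) (tree Es j)
         (x0 - eps - 1) (x0 + eps)) &
      (forall i, (offset Es k <= i)%N ->
       [/\ rarr s' rLo i = rarr s2 rLo i, rarr s' rHi i = rarr s2 rHi i &
        narr s' aLive i = narr s2 aLive i])]) (offset Es k).
    apply: iterates_weaken (H _ (leqnn _)) _ (leqnn _).
    move=> s3 [F3 c3 t3 _]; split; last by [].
    by have [_ _ h7] := input_sized_frame F3 isT inp2; rewrite /= c3 h7 addn1 ltnn.
  elim: k => [|k IH] hk.
    by apply: iterates0; split=> //; rewrite -s2E offset0.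
  rewrite (offsetS hk); apply: iterates_bind; first exact: IH (ltnW hk).
  move=> s3 [F3 p3 t3 o3].
  have inp3 := input_sized_frame F3 isT inp2.
  have [[_ _ _ hst _] _ _] := inp3.
  have [lo hi] := rt2 _ hk.
  apply: iterates_weaken.
  - apply: iterates_frame; first by [].
    apply: (interval_pass inp3 (hst _ hk)); last 2 first.
    + exact: p3.
    + by move=> i /andP[hi' _]; have [_ _ ->] := o3 _ hi'.
    by rewrite -offsetS // leq_offset.
  - move=> s4 [F4 [p4 t4 o4]]; split.
    + exact: frame_trans F3 F4.
    + by rewrite p4.
    + move=> j; rewrite ltnS leq_eqVlt => /orP[/eqP ->|hj].
        by have [e1 e2 _] := o3 _ (leqnn _); rewrite -lo -hi -e1 -e2.
      apply: interval_tree_ext (t3 _ hj) => i hi'; apply: o4.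
      have := leq_offset Es hj; rewrite offsetS; last exact: ltn_trans hj hk.
      case/andP: hi' => _ h1 h2.
      by rewrite leqNgt (leq_trans h1 h2).
    + move=> i hi'; have [|-> -> ->] := o4 i; first by rewrite (ltnNge i) hi' andbF.
      by apply: o3; apply: leq_trans hi'; apply: leq_addr.
  - by [].
rewrite /while_cost.
have hb : (bcost interval_guard < 50)%N by [].
move: (max_cost interval_step) (bcost interval_guard) hb => c g hb.
rewrite [max_cost _]/=; have := Ngt0; nia.
Qed.

Section Merge.
Variable s0 : state R.
Hypothesis inp0 : input_sized Es x eps s0.
Hypothesis ivs : all_intervals s0.

Local Notation hi := (rarr s0 rHi).
Local Notation live := (narr s0 aLive).

Definition same_line s :=
  [/\ input_sized Es x eps s, narr s aLive =1 live, rarr s rHi =1 hi &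
      rarr s rVal =1 rarr s0 rVal].

Lemma same_line_frame c s s' :
  frame c s s' -> keeps_input c -> ~~ nwritten aLive c -> ~~ rwritten rHi c ->
  same_line s -> same_line s'.
Proof.
move=> F kc w1 w2 [h1 h2 h3 h4]; split.
- exact: input_sized_frame F kc h1.
- by move=> i; rewrite (proj1 F).
- by move=> i; rewrite (proj2 F).
- move=> i; rewrite (proj2 F) //.
  by case/andP: kc => _ /=; rewrite !negb_or => /and4P[].
Qed.

Definition pos k c := leaf_pos (offset Es k) (tree Es k) c.
Definition in_tree k p := (offset Es k <= p < offset Es k.+1)%N.

Lemma in_treeE k p : (k < size Es)%N ->
  in_tree k p = (offset Es k <= p < offset Es k + nnodes (tree Es k))%N.
Proof. by move=> hk; rewrite /in_tree offsetS. Qed.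

Lemma in_tree_pos k c : (k < size Es)%N -> in_tree k (pos k c).
Proof. by move=> hk; rewrite in_treeE // leaf_pos_range. Qed.

Lemma live_in_ball k p : (k < size Es)%N -> in_tree k p -> (0 < live p)%N ->
  [/\ x0 - eps <= hi p, hi p <= x0 + eps & x0 - eps - 1 < hi p].
Proof.
move=> hk hp lp; rewrite in_treeE // in hp.
have [_ h1] := interval_bounds (ivs hk) hp.
have [_ h2] := live_bounds (ivs hk) hp lp.
by split=> //; apply: lt_le_trans h2; lra.
Qed.

Lemma posP k (c : R) : (k < size Es)%N -> x0 - eps <= c -> c <= x0 + eps ->
  [/\ (0 < live (pos k c))%N, c <= hi (pos k c) &
      rarr s0 rVal (pos k c) = predict (tree Es k) (const_mx c)].
Proof.
move=> hk h1 h2; have [[_ _ _ hst _] _ _] := inp0.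
by apply: (leaf_posP (ivs hk) (hst _ hk)) => //; lra.
Qed.

Lemma pos_order k (c : R) q : (k < size Es)%N -> x0 - eps <= c -> c <= x0 + eps ->
  in_tree k q -> (0 < live q)%N -> (q < pos k c)%N = (hi q < c).
Proof.
move=> hk h1 h2 hq lq; rewrite in_treeE // in hq.
by apply: (leaf_pos_order (ivs hk)) => //; lra.
Qed.

Lemma live_mono k p p' : (k < size Es)%N -> in_tree k p -> in_tree k p' ->
  (0 < live p)%N -> (0 < live p')%N -> (p <= p')%N -> hi p <= hi p'.
Proof.
move=> hk hp hp' lp lp' pp'.
have [h1 h2 _] := live_in_ball hk hp lp.
have := pos_order hk h1 h2 hp lp; rewrite ltxx => h.
rewrite leNgt -(pos_order hk h1 h2 hp' lp').
by rewrite -leqNgt (leq_trans _ pp') // leqNgt h.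
Qed.

Definition merge_cost v := while_cost merge_guard (max_cost merge_step) v.

Lemma merge_pair k k' s : (k < size Es)%N -> (k' < size Es)%N ->
  same_line s -> narr s aTree 0 = k ->
  narr s aLeaf 0 = offset Es k -> narr s aLeaf' 0 = offset Es k' ->
  term (While merge_guard merge_step) s (fun s' => forall p,
    rarr s' rSumAt p = rarr s rSumAt p +
      (if in_tree k p && (0 < live p)%N
       then predict (tree Es k') (const_mx (hi p)) else 0))
    (merge_cost (2 * N)).
Proof.
move=> hk hk' sm ht hp hq.
pose I v s' := exists p q,
  [/\ [/\ same_line s', narr s' aTree 0 = k, narr s' aLeaf 0 = p &
          narr s' aLeaf' 0 = q],
      (offset Es k <= p <= offset Es k.+1)%N /\
      (offset Es k' <= q <= offset Es k'.+1)%N,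
      v = (offset Es k.+1 - p + (offset Es k'.+1 - q))%N,
      (forall r, (p <= r)%N -> in_tree k r -> (0 < live r)%N ->
         (q <= pos k' (hi r))%N) &
      forall r, rarr s' rSumAt r = rarr s rSumAt r +
      (if [&& in_tree k r, (r < p)%N & (0 < live r)%N]
       then predict (tree Es k') (const_mx (hi r)) else 0)].
have I0 : I (offset Es k.+1 - offset Es k + (offset Es k'.+1 - offset Es k'))%N s.
  exists (offset Es k), (offset Es k'); split=> //.
  - by split; rewrite leqnn leq_offset.
  - by move=> r _ _ _; case/andP: (in_tree_pos (hi r) hk').
  - move=> r; rewrite /in_tree; case: and3P => [[/andP[h1 _] h2 _]|_].
      by move: h2; rewrite ltnNge h1.
    by rewrite addr0.
apply: (@term_weaken _ _ _ _ _ (merge_cost _) (merge_cost _) (term_while _ I0)).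
- move=> v s1 [p [q [[sm1 ht1 hp1 hq1] [pr qr] vE lead sums]]].
  have [[[_ hK hroot _ _] hlast _] hlv hhi hvl] := sm1.
  have rootE : narr s1 aRoot k.+1 = offset Es k.+1.
    have [lt|ge] := ltnP k.+1 (size Es); first exact: hroot.
    by have -> : k.+1 = size Es by lia.
  rewrite /= hp1 ht1 !addn1 rootE => pk.
  have pin : in_tree k p by rewrite /in_tree pk andbT; case/andP: pr.
  apply: term_ev => //.
  rewrite /merge_step ev_if /= hp1 hlv leqn0.
  case: eqP => lp.
    exists v.-1; first by lia.
    exists p.+1, q; split.
    - split=> //; first exact: same_line_frame (ev_frame _ _) _ _ _ sm1.
      by rewrite /= /upd /= hp1 addn1.
    - by split=> //; lia.
    - by lia.
    - by move=> r hr; apply: lead; apply: ltnW.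
    - move=> r; rewrite /= sums; congr (_ + _).
      rewrite ltnS [(r <= p)%N]leq_eqVlt; case: eqP => [->|//] /=.
      by rewrite lp ltnn !andbF.
  have lp0 : (0 < live p)%N by rewrite lt0n; apply/eqP.
  have [c1 c2 c3] := live_in_ball hk pin lp0.
  have [z1 z2 z3] := posP hk' c1 c2.
  have zin := in_tree_pos (hi p) hk'.
  have qz := lead _ (leqnn p) pin lp0.
  have qlt : (q < offset Es k'.+1)%N by case/andP: zin => _; apply: leq_ltn_trans.
  have qin : in_tree k' q by rewrite /in_tree qlt andbT; case/andP: qr.
  rewrite ev_if /= hp1 hq1 !hlv !hhi; case: ifP => [/andP[lq hpq]|nq].
    have qE : q = pos k' (hi p).
      apply/eqP; rewrite eqn_leq qz leqNgt (pos_order hk' c1 c2 qin lq).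
      by rewrite -leNgt.
    exists v.-1; first by lia.
    exists p.+1, q; split.
    - split=> //; first exact: same_line_frame (ev_frame _ _) _ _ _ sm1.
      by rewrite /= /upd /= hp1 addn1.
    - by split=> //; lia.
    - by lia.
    - by move=> r hr; apply: lead; apply: ltnW.
    - move=> r; rewrite /= /upd /= hp1 hq1 hvl !sums.
      have [->|ne] := eqVneq r p.
        by rewrite ltnn ltnSn pin lp0 /= addr0 qE z3.
      by rewrite ltnS [(r <= p)%N]leq_eqVlt (negbTE ne).
  have qlt' : (q < pos k' (hi p))%N.
    rewrite ltn_neqAle qz andbT; apply/eqP => qE.
    by move: nq; rewrite qE z1 z2.
  exists v.-1; first by lia.
  exists p, q.+1; split.
  - split=> //; first exact: same_line_frame (ev_frame _ _) _ _ _ sm1.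
    by rewrite /= /upd /= hq1 addn1.
  - by split=> //; lia.
  - by lia.
  - move=> r hr rin lr; rewrite ltnNge; apply/negP => hz.
    have [d1 d2 d3] := live_in_ball hk rin lr.
    have [y1 y2 y3] := posP hk' d1 d2.
    have yin := in_tree_pos (hi r) hk'.
    have := pos_order hk' c1 c2 yin y1.
    rewrite (leq_ltn_trans hz qlt') => /esym lt1.
    have := live_mono hk pin rin lp0 lr hr.
    by rewrite leNgt (le_lt_trans y2 lt1).
  - by move=> r; rewrite /= sums.
- move=> s1 _ [[v [p [q [[sm1 ht1 hp1 hq1] [pr _] _ _ sums]]]]].
  have [[[_ hK hroot _ _] hlast _] _ _ _] := sm1.
  have rootE : narr s1 aRoot k.+1 = offset Es k.+1.
    have [lt|ge] := ltnP k.+1 (size Es); first exact: hroot.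
    by have -> : k.+1 = size Es by lia.
  rewrite /= hp1 ht1 !addn1 rootE -leqNgt => kp r.
  rewrite sums; congr (_ + _); congr (if _ then _ else _).
  by rewrite andbA; congr (_ && _); rewrite /in_tree; lia.
- apply: leq_while_cost.
  have := leq_offset Es hk; have := leq_offset Es hk'; lia.
Qed.

Local Notation score_at p := (total_score Es (const_mx (hi p))).

Lemma total_scoreE y :
  total_score Es y = \sum_(0 <= i < size Es) predict (tree Es i) y.
Proof. by rewrite /total_score (big_nth (Leaf 0)). Qed.

Definition merge_bound :=
  (3 * (bcost merge_guard + max_cost merge_step) + 1000)%N.

Lemma merge_tree k s : (k < size Es)%N -> same_line s -> narr s aTree 0 = k ->
  narr s aTree' 0 = 0%N ->
  (forall p, rarr s rSumAt p =
     if (p < offset Es k)%N && (0 < live p)%N then score_at p else 0) ->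
  term (While (nlt (var aTree') numE)
     (Seq (Seq (setn aLeaf (NGet aRoot (var aTree)))
               (setn aLeaf' (NGet aRoot (var aTree'))))
     (Seq (While merge_guard merge_step) (incr aTree')))) s
    (fun s' => forall p, rarr s' rSumAt p =
     if (p < offset Es k.+1)%N && (0 < live p)%N then score_at p else 0)
    ((merge_bound + 100) * (size Es * N)).
Proof.
move=> hk sm ht ht' G0.
pose I j s' := [/\ same_line s', narr s' aTree 0 = k, narr s' aTree' 0 = j &
  forall p, rarr s' rSumAt p =
    if (p < offset Es k)%N && (0 < live p)%N then score_at p
    else if in_tree k p && (0 < live p)%N
    then \sum_(0 <= i < j) predict (tree Es i) (const_mx (hi p)) else 0].
have I0 : I 0%N s.
  by split=> // p; rewrite G0; case: ifP => // _; rewrite big_geq // if_same.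
apply: (@term_weaken _ _ _ (I (size Es)) _ (while_cost _ (merge_bound * N) (size Es))).
- apply: term_for I0 => [j s1 hj [sm1 ht1 hj1 G1]|s1 [[[[_ hK _ _ _] _ _] _ _ _] _ h _]]; last first.
    by rewrite /= h hK addn1 ltnn.
  have [[[_ hK hroot _ _] _ _] _ _ _] := sm1.
  split; first by rewrite /= hj1 hK addn1.
  apply: term_cost.
    apply: term_seq; first exact: (term_ev (Q := eq (ev _ s1))).
    move=> s2 F2 s2E.
    have sm2 := same_line_frame F2 isT isT isT sm1.
    apply: term_seq.
      apply: (@merge_pair k j) => //.
      - by rewrite (proj1 F2).
      - by rewrite -s2E /= /upd /= ht1 hroot.
      - by rewrite -s2E /= /upd /= hj1 hroot.
    move=> s3 F3 G3.
    have sm3 := same_line_frame F3 isT isT isT sm2.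
    apply: term_ev => //; split.
    - exact: same_line_frame (ev_frame _ _) _ _ _ sm3.
    - by rewrite /= /upd /= (proj1 F3) // (proj1 F2).
    - by rewrite /= /upd /= (proj1 F3) // (proj1 F2) // hj1 addn1.
    - move=> p; rewrite /= G3 (proj2 F2) // G1.
      have [lt|ge] := ltnP p (offset Es k).
        have -> : in_tree k p = false by rewrite /in_tree leqNgt lt.
        by rewrite addr0.
      rewrite /= big_nat_recr //=.
      by case: ifP => _ //; rewrite addr0.
  rewrite /merge_cost /while_cost /merge_bound.
  have hb : (bcost merge_guard < 50)%N by [].
  move: (max_cost merge_step) (bcost merge_guard) hb => c g hb.
  rewrite /=; have := Ngt0; nia.
- move=> s1 _ [_ _ _ G1] p; rewrite G1 -total_scoreE.
  have := leq_offset Es (leqnSn k); rewrite /in_tree.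
  case: ltnP => h1 h2 /=; last by [].
  by rewrite (leq_trans h1 h2) /=; case: ifP.
- rewrite /while_cost.
  have hb : (bcost (nlt (var aTree') numE) < 50)%N by [].
  move: (bcost _) hb merge_bound => g hb c.
  have := Ngt0; nia.
Qed.

Lemma mergeP s : same_line s -> (forall p, rarr s rSumAt p = 0) ->
  term merge_trees s (fun s' => forall p, (p < N)%N -> (0 < live p)%N ->
      rarr s' rSumAt p = score_at p)
    ((merge_bound + 300) * (size Es ^ 2 * N)).
Proof.
move=> sm G0.
pose I k s' := [/\ same_line s', narr s' aTree 0 = k & forall p,
  rarr s' rSumAt p =
     if (p < offset Es k)%N && (0 < live p)%N then score_at p else 0].
apply: term_cost.
  apply: term_seq; first apply: (term_ev (Q := I 0%N)) => //.
    split=> //; first exact: same_line_frame (ev_frame _ _) _ _ _ sm.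
    by move=> p; rewrite offset0 ltn0 /= G0.
  move=> s1 _ I0.
  apply: (@term_weaken _ _ _ (I (size Es))).
  - apply: term_for I0 => [j s2 hj [sm2 ht2 G2]|s2 [[[[_ hK _ _ _] _ _] _ _ _] h _]]; last first.
      by rewrite /= h hK addn1 ltnn.
    have [[[_ hK _ _ _] _ _] _ _ _] := sm2.
    split; first by rewrite /= ht2 hK addn1.
    apply: term_seq; first exact: (term_ev (Q := eq (ev _ s2))).
    move=> s3 F3 s3E.
    have sm3 := same_line_frame F3 isT isT isT sm2.
    apply: term_seq.
      apply: (@merge_tree j) => //.
      - by rewrite (proj1 F3).
      - by rewrite -s3E.
      - by move=> p; rewrite (proj2 F3).
    move=> s4 F4 G4; apply: term_ev => //; split.
    + exact: same_line_frame (ev_frame _ _) _ _ _ (same_line_frame F4 isT isT isT sm3).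
    + by rewrite /= /upd /= (proj1 F4) // (proj1 F3) // ht2 addn1.
    + by move=> p; rewrite /= G4.
  - by move=> s2 _ [_ _ G2] p hp lp; rewrite G2 hp lp.
  - exact: leqnn.
rewrite /while_cost; move: merge_bound => c; rewrite /= expnS expn1 -mulnA.
have P1 : (0 < size Es * N)%N by rewrite muln_gt0 Es0 Ngt0.
move: (size Es * N)%N P1 => P hP; move: (size Es) Es0 => K hK; nia.
Qed.

Lemma check_sumsP s : same_line s ->
  (forall p, (p < N)%N -> (0 < live p)%N -> rarr s rSumAt p = score_at p) ->
  term check_sums s (fun s' => narr s' aOut 0 = 1%N <->
     narr s aOut 0 = 1%N \/
     exists p, [/\ (p < N)%N, (0 < live p)%N & 0 < score_at p]) (100 * N).
Proof.
move=> sm G.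
pose I j s' := [/\ same_line s', narr s' aLeaf 0 = j,
  rarr s' rSumAt =1 rarr s rSumAt & (narr s' aOut 0 = 1%N <->
     narr s aOut 0 = 1%N \/
     exists p, [/\ (p < j)%N, (0 < live p)%N & 0 < score_at p])].
apply: term_cost.
  apply: term_seq; first apply: (term_ev (Q := I 0%N)) => //.
    split=> //; first exact: same_line_frame (ev_frame _ _) _ _ _ sm.
    by split=> [|[//|[p []]]]; first by left.
  move=> s1 _ I0.
  apply: (@term_weaken _ _ _ (I N)).
  - apply: term_for I0 => [j s2 hj [sm2 hp g2 ou]|s2 [[[_ _ h7] _ _ _] h _ _]]; last first.
      by rewrite /= h h7 !addn1 ltnn.
    have [[_ _ h7] hl _ _] := sm2.
    split; first by rewrite /= hp h7 addn1.
    apply: term_ev => //; rewrite ev_seq.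
    set s4 := ev _ s2.
    have F4 : frame (setn aOut (NLit 1)) s2 s4.
      rewrite /s4 ev_if; case: ifP => _; first exact: ev_frame.
      by split.
    have o4 : narr s4 aOut 0 = if (0 < live j)%N && (0 < rarr s rSumAt j)
        then 1%N else narr s2 aOut 0.
      by rewrite /s4 ev_if /= hp hl g2 -ltNge; case: ifP.
    have [F4n F4r] := F4.
    have sm4 := same_line_frame F4 isT isT isT sm2.
    move: s4 F4 o4 F4n F4r sm4 => s4 F4 o4 F4n F4r sm4.
    split.
    + exact: same_line_frame (ev_frame _ _) _ _ _ sm4.
    + by rewrite /= /upd /= F4n // hp addn1.
    + by move=> i; rewrite /= F4r.
    + rewrite /= /upd /= o4; split.
        case: ifP => [/andP[g3 g4] _|_ /ou[|[r [r1 r2 r3]]]].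
        * by right; exists j; split=> //; rewrite -G.
        * by left.
        * by right; exists r; split=> //; apply: ltnW.
      move=> h; case: ifP => // gd; apply/ou.
      case: h => [|[r []]]; first by left.
      rewrite ltnS leq_eqVlt => /orP[/eqP ->|r1] r2 r3.
        by rewrite r2 G // r3 in gd.
      by right; exists r.
  - by move=> s2 _ [_ _ _ ou]; exact: ou.
  - exact: leqnn.
by rewrite /while_cost /=; have := Ngt0; lia.
Qed.

Lemma in_tree_exists m p : (m <= size Es)%N -> (p < offset Es m)%N ->
  exists2 k, (k < m)%N & in_tree k p.
Proof.
elim: m => [|m IH] hm hp; first by rewrite offset0 in hp.
have [lt|ge] := ltnP p (offset Es m).
  by have [k km kp] := IH (ltnW hm) lt; exists k => //; apply: ltnW.
by exists m => //; rewrite /in_tree ge hp.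
Qed.

Lemma line_complete :
  (exists p, [/\ (p < N)%N, (0 < live p)%N & 0 < score_at p]) <->
  (exists y, in_ball x eps y /\ 0 < total_score Es y).
Proof.
split=> [[p [hp lp sp]]|[y [yb sy]]].
  have [k hk kp] := in_tree_exists (leqnn _) hp.
  have [h1 h2 _] := live_in_ball hk kp lp.
  exists (const_mx (hi p)); split=> // j.
  by rewrite mxE (ord1 j) h1 h2.
have /andP[y1 y2] := yb ord0.
set c := y ord0 ord0 in y1 y2.
have yE : y = const_mx c by apply/rowP => j; rewrite mxE (ord1 j).
have K1 : (0 < size Es)%N by [].
have [k _ kmin] := @arg_minP _ _ _ (Ordinal K1) predT
  (fun k : 'I_(size Es) => hi (pos k c)) isT.
have [z1 z2 z3] := posP (ltn_ord k) y1 y2.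
exists (pos k c); split=> //.
  have /andP[_ h] := in_tree_pos c (ltn_ord k).
  exact: leq_trans h (leq_offset _ (ltn_ord k)).
move: sy; rewrite yE !total_scoreE !big_nat; congr (_ < _).
apply: eq_bigr => i /= hi'; apply/esym.
by apply: predict_const (ivs hi') z2 _; apply: (kmin (Ordinal hi')).
Qed.

End Merge.

Definition line_cost : nat :=
  (merge_bound + 1000 + bcost interval_guard + max_cost interval_step)%N.

Lemma sweep_lineP s : input_sized Es x eps s -> fresh s ->
  term sweep_line s (fun s' => narr s' aOut 0 = 1%N <->
       exists y, in_ball x eps y /\ 0 < total_score Es y)
    (line_cost * (size Es ^ 2 * N)).
Proof.
move=> inp [fn fr].
apply: term_cost.
  apply: term_seq.
    by apply: intervalsP => // i; rewrite fn.
  move=> s1 F1 iv1.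
  have inp1 := input_sized_frame F1 isT inp.
  have sm1 : same_line s1 s1 by split.
  apply: term_seq.
    by apply: (mergeP inp1 iv1 sm1) => p; rewrite (proj2 F1) // fr.
  move=> s2 F2 G2.
  have sm2 := same_line_frame F2 isT isT isT sm1.
  apply: term_weaken (check_sumsP sm2 G2) _ (leqnn _).
  move=> s3 _ ->; rewrite (proj1 F2) // (proj1 F1) // fn //.
  by rewrite -(line_complete inp1 iv1); split=> [[]|]; [|by []|right].
rewrite /line_cost.
move: merge_bound (max_cost interval_step) (bcost interval_guard) => c1 c2 c3.
have h1 : (0 < size Es ^ 2)%N by rewrite expn_gt0 Es0.
by have := Ngt0; move: (size Es ^ 2)%N h1 => K hK; nia.
Qed.

End Line.

(** * Choice of the procedure *)

Definition use_line : bexp := BAnd (BNle dimE (NLit 1)) (BNle (NLit 1) dimE).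

Definition use_grid : bexp :=
  BAnd (BNle (NLit 2) dimE)
    (BAnd (nlt dimE numE) (rlt (rvar rPow) (rvar rVisits))).

Definition verifier : com :=
  Seq preprocess (If use_line sweep_line (If use_grid grid dfs_search)).

Definition verifier_cost : nat :=
  (line_cost + grid_cost + dfs_cost + 2000)%N.

Lemma nleaves_dim0 (R : Type) d (Es : seq (dtree R d)) :
  d = 0%N -> all (fun T => nleaves T <= 1)%N Es.
Proof.
by move=> d0; elim: Es => //= T Es ->; rewrite andbT; case: T => // -[]; rewrite d0.
Qed.

Lemma branchP (R : realType) (n d : nat) (Es : seq (dtree R d))
    (x : 'rV[R]_d) (eps : R) (s : state R) :
  let K := size Es in
  all (fun T => nleaves T <= n)%N Es -> (0 < K)%N -> 0 <= eps ->
  preprocessed Es x eps s ->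
  exists B : nat,
  [/\ term (If use_line sweep_line (If use_grid grid dfs_search)) s
        (fun s' => narr s' aOut 0 = 1%N <->
           exists y, in_ball x eps y /\ 0 < total_score Es y)
        (100 + (line_cost + grid_cost + dfs_cost) * B),
      (offset Es K <= 2 * B)%N,
      (1 < n)%N -> (1 < d)%N -> (B <= 2 * minn (n ^ K) ((2 * K * n) ^ d))%N &
      (B <= 2 * K ^ 3 * minn (n ^ K) ((2 * K * n) ^ d))%N].
Proof.
move=> K allE K0 eps0 [inp fr hS hP].
have [[h0 h1 _ _ _] _ _] := inp.
have n0 : (0 < n)%N.
  by move: allE K0; rewrite /K; case: Es {inp fr hS hP h1 K} => //= T Es' /andP[h _] _;
    apply: leq_trans h; apply: nleaves_gt0.
have N2 : (offset Es K <= 2 * K * n)%N by rewrite /offset take_size sumn_nnodes_leq.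
have NS : (offset Es K <= 2 * visits Es)%N.
  by rewrite /offset take_size sumn_nnodes_visits.
have KN : (K <= offset Es K)%N by exact: size_leq_offset.
have S1 : (visits Es <= K * n ^ K)%N by exact: visits_leq.
have S2 : (1 < n)%N -> (visits Es <= 2 * n ^ K)%N.
  by move=> n1; have := visits_leq2 n1 allE => /ltnW/ltnW.
have nK : (n <= n ^ K)%N by rewrite -{1}(expn1 n) leq_pexp2l.
have K3 : (K <= K ^ 3)%N by rewrite -{1}(expn1 K) leq_pexp2l.
have [d1|d1] := eqVneq d 1%N.
  clear h0 h1; subst d; have [[h0 _ _ _ _] _ _] := inp.
  exists (K ^ 2 * offset Es K)%N; split.
  - apply: (@term_cost _ _ _ _ (bcost use_line +
      line_cost * (K ^ 2 * offset Es K)).+1).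
      apply: term_if.
      have -> : bval s use_line by rewrite /= h0.
      by apply: sweep_lineP.
    have : (bcost use_line < 50)%N by [].
    by rewrite !mulnDl; lia.
  - have : (0 < K ^ 2)%N by rewrite expn_gt0 K0.
    by nia.
  - by [].
  - rewrite expn1; apply: (@leq_trans (K ^ 2 * (2 * K * n))).
      by rewrite leq_mul2l N2 orbT.
    have -> : (K ^ 2 * (2 * K * n) = 2 * K ^ 3 * n)%N.
      by rewrite [in RHS](expnS K 2); ring.
    rewrite leq_mul2l leq_min nK /=; apply/orP; right.
    by rewrite leq_pmull // muln_gt0.
have use_lineF : bval s use_line = false.
  by rewrite /= h0 -eqn_leq (negbTE d1).
have bl : (bcost use_line < 50)%N by [].
have bg : (bcost use_grid < 45)%N by [].
have [gr|ngr] := boolP (bval s use_grid).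
  have [d2 dK SN] : [/\ (1 < d)%N, (d < K)%N & (offset Es K ^ d < visits Es)%N].
    move: gr; rewrite /= h0 h1 addn1 => /and3P[d2 dK r]; split=> //.
    by move: r; rewrite hS hP // -ltNge ltr_nat.
  exists (offset Es K ^ d)%N.
  have Nd : (offset Es K ^ d <= (2 * K * n) ^ d)%N by rewrite leq_exp2r // ltnW.
  split.
  - apply: (@term_cost _ _ _ _ (bcost use_line + (bcost use_grid +
      grid_cost * offset Es K ^ d).+1).+1).
      apply: term_if; rewrite use_lineF; apply: term_if; rewrite gr.
      by apply: gridP => //; apply: leq_trans KN; apply: ltnW.
    by rewrite !mulnDl; lia.
  - have : (offset Es K <= offset Es K ^ d)%N.
      by rewrite -{1}(expn1 (offset _ _)) leq_pexp2l ?(leq_trans _ KN) // ltnW.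
    by lia.
  - by move=> n1 _; rewrite minnMr leq_min; have := S2 n1; lia.
  - rewrite minnMr leq_min; apply/andP; split; last by nia.
    apply: leq_trans (ltnW SN) (leq_trans S1 _).
    by rewrite leq_mul2r; apply/orP; right; lia.
exists (visits Es); split.
- apply: (@term_cost _ _ _ _ (bcost use_line + (bcost use_grid +
    dfs_cost * visits Es).+1).+1).
    apply: term_if; rewrite use_lineF; apply: term_if; rewrite (negbTE ngr).
    exact: dfs_searchP.
  by rewrite !mulnDl; lia.
- exact: NS.
- move=> n1 d2; rewrite minnMr leq_min (S2 n1) /=.
  have [dK|Kd] := ltnP d K; last first.
    apply: leq_trans (S2 n1) _; rewrite leq_mul2l /=.
    apply: (@leq_trans (n ^ d)%N); first by rewrite leq_pexp2l.
    by rewrite leq_exp2r ?leq_pmull ?muln_gt0 ?K0 // ltnW.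
  have : (visits Es <= offset Es K ^ d)%N.
    by move: ngr; rewrite /= h0 h1 addn1 d2 dK /= negbK hS hP // ler_nat.
  have : (offset Es K ^ d <= (2 * K * n) ^ d)%N by rewrite leq_exp2r // ltnW.
  lia.
have pK : (0 < n ^ K)%N by rewrite expn_gt0 n0.
rewrite minnMr leq_min; apply/andP; split.
  by apply: leq_trans S1 _; rewrite leq_mul2r; apply/orP; right; lia.
have [dK|Kd] := ltnP d K; last first.
  apply: leq_trans S1 _; apply: leq_mul; first by lia.
  apply: (@leq_trans (n ^ d)%N); first by rewrite leq_pexp2l.
  have [->//|dpos] := posnP d.
  by rewrite leq_exp2r ?leq_pmull ?muln_gt0 ?K0.
have [d0|dpos] := posnP d.
  have all1 := nleaves_dim0 Es d0.
  have := visits_leq all1; rewrite exp1n muln1 => /leq_trans; apply.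
  have -> : ((2 * K * n) ^ d = 1)%N by rewrite d0.
  by rewrite muln1 -/K; lia.
have d2 : (1 < d)%N by rewrite ltn_neqAle eq_sym d1.
have h : (visits Es <= offset Es K ^ d)%N.
  by move: ngr; rewrite /= h0 h1 addn1 d2 dK /= negbK hS hP // ler_nat.
apply: leq_trans h _; apply: (@leq_trans ((2 * K * n) ^ d)%N).
  by rewrite leq_exp2r.
by rewrite leq_pmull // muln_gt0 expn_gt0 K0.
Qed.

Lemma verifierP (R : realType) (n d : nat) (Es : seq (dtree R d))
    (x : 'rV[R]_d) (eps : R) (s : state R) :
  let K := size Es in
  all (fun T => nleaves T <= n)%N Es -> (0 < K)%N -> 0 <= eps ->
  input Es x eps s ->
  (forall a i, ((a == 6) || (8 < a))%N -> narr s a i = 0%N) ->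
  (forall a i, (2 < a)%N -> rarr s a i = 0) ->
  exists s' t,
  [/\ exec verifier s s' t,
      narr s' aOut 0 = 1%N <->
        exists y, in_ball x eps y /\ 0 < total_score Es y,
      (1 < n)%N -> (1 < d)%N ->
        (t <= (2 * verifier_cost) * minn (n ^ K) ((2 * K * n) ^ d))%N &
      (t <= (verifier_cost * (2 * K ^ 3)) * minn (n ^ K) ((2 * K * n) ^ d))%N].
Proof.
move=> K allE K0 eps0 inp fn fr.
have [s1 [t1 [e1 pre l1]]] := preprocessP K0 inp fn fr.
have [B [[s2 [t2 [e2 out l2]]] NB B1 B2]] := branchP allE K0 eps0 pre.
have N0 : (0 < offset Es (size Es))%N by apply: leq_trans K0 (size_leq_offset _).
have lt : ((t1 + t2).+1 <= verifier_cost * B)%N.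
  rewrite /verifier_cost.
  move: (line_cost + grid_cost + dfs_cost)%N l2 => c l2.
  by rewrite mulnDl; lia.
exists s2, (t1 + t2).+1; split=> //.
- by econstructor; eassumption.
- move=> n1 d2; apply: leq_trans lt _.
  by rewrite [(2 * _)%N]mulnC -mulnA leq_mul2l B1 ?orbT.
by apply: leq_trans lt _; rewrite -mulnA leq_mul2l B2 orbT.
Qed.

Theorem theorem1 (R : realType) :
  exists (P : com) (C : nat) (CK : nat -> nat),
  forall (n K d : nat) (E : K.-tuple (dtree R d)) (x : 'rV[R]_d) (eps : R),
    (forall k : 'I_K, (nleaves (tnth E k) <= n)%N) ->
    score E x < 0 ->
    0 <= eps ->
    exists (s : state R) (t : nat),
      [/\ exec P (encode E x eps) s t,
          accepts s <-> attackable E x eps,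
          (1 < n)%N -> (1 < d)%N ->
            (t <= C * minn (n ^ K) ((2 * K * n) ^ d))%N
        & (t <= CK K * minn (n ^ K) ((2 * K * n) ^ d))%N].
Proof.
exists verifier, (2 * verifier_cost)%N, (fun K => verifier_cost * (2 * K ^ 3))%N.
move=> n K d E x eps En sx eps0.
have K0 : (0 < size E)%N.
  rewrite size_tuple lt0n; apply: contraTneq sx => K0.
  rewrite /score big1 ?ltxx // => i _.
  by have := ltn_ord i; rewrite [X in (_ < X)%N]K0.
have allE : all (fun T => nleaves T <= n)%N E by apply/all_tnthP.
have [fn fr] := encode_fresh E x eps.
have [s [t]] := verifierP allE K0 eps0 (encode_input E x eps) fn fr.
rewrite size_tuple => -[ex out t1 t2]; exists s, t; split=> //.
by rewrite attackableE // -out /accepts; split=> /eqP.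
Qed.
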